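(* Let $P$ be any piecewise smooth Jordan loop in $\mathbb{R}^2$, and let $\alpha$ be a piecewise smooth path in $\Gamma(P)$, which is either a closed loop or an arc connecting two diameters of $P$. If $\alpha$ is a hyperbolic arc, then the signed area of the region bounded by the shape loop $Z(\alpha)$ equals, up to sign, the area of the region bounded by $P$. If $\alpha$ is either a null arc or a closed loop, then the signed area of the region bounded by the shape loop $Z(\alpha)$ is $0$.
   Context: A Jordan loop is the image of a circle under a continuous injective map into the plane. A rectangle $R$ with cyclically labeled vertices $R_1,R_2,R_3,R_4$ graces $P$ if its vertices lie in $P$ and the cyclic ordering of the vertices induced by $R$ coincides with the cyclic ordering induced by $P$. $\Gamma(P)\subset(\mathbb{R}^2)^4$ denotes the space of labeled rectangles gracing $P$; an arc of such rectangles may end at a degenerate rectangle (one having one pair of opposite sides of length $0$) whose underlying segment is a diameter of $P$, and such degenerate rectangles are allowed as the endpoints of paths in $\Gamma(P)$. A chord $d$ of $P$ (a segment joining two distinct points of $P$) is a diameter if, at each endpoint of $d$, the line through that endpoint perpendicular to $d$ does not locally separate $P$ into two arcs (i.e. near that endpoint $P$ lies weakly on one side of the line). For a labeled rectangle $R$ let $X(R)=|R_1R_2|$ and $Y(R)=|R_2R_3|$ be the lengths of its first and second sides. If $t\mapsto R_t$ parametrizes a path $\alpha$, the shape curve $Z(\alpha)$ is the curve $t\mapsto (X(R_t),Y(R_t))$ in the plane. If $\alpha$ is a closed loop then $Z(\alpha)$ is a closed loop, and it is also called the shape loop. If $\alpha$ is an arc connecting two diameters, each endpoint of the shape curve lies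 on a coordinate axis. The arc $\alpha$ is hyperbolic if one endpoint of the shape curve lies on the $X$-axis and the other lies on the $Y$-axis; it is null if both endpoints lie on the same axis. In the arc cases the shape loop, still denoted $Z(\alpha)$, is the closed loop obtained by adjoining to the shape curve the relevant parts of the coordinate axes: in the hyperbolic case the two segments joining its endpoints to the origin, and in the null case the segment of the axis joining its two endpoints. The signed area of the region bounded by a closed curve is $\frac12\oint (x\,dy-y\,dx)$. *)

(* Defs.v *)
From HB Require Import structures.
From mathcomp Require Import all_boot all_order all_algebra.
From mathcomp Require Import all_classical all_reals all_analysis.

Set Implicit Arguments.
Unset Strict Implicit.
Unset Printing Implicit Defensive.

Import Order.TTheory GRing.Theory Num.Theory.
Import numFieldNormedType.Exports.
Local Open Scope classical_set_scope.
Local Open Scope ring_scope.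

Definition dot (R : realType) (u v : R * R) : R := u.1 * v.1 + u.2 * v.2.

(* Euclidean distance; the library norm on R * R is the sup norm. *)
Definition dist (R : realType) (p q : R * R) : R :=
  Num.sqrt (dot (p - q) (p - q)).

(* c is C^1 on [a, b] up to the endpoints: dc is its derivative inside and
   extends it continuously to a and b. *)
Definition C1_arc_with (R : realType) (a b : R) (c dc : R -> R * R) : Prop :=
  [/\ {within `[a, b], continuous c}, {within `[a, b], continuous dc} &
      forall t : R, a < t < b ->
        is_derive t 1 (fst \o c) (dc t).1 /\
        is_derive t 1 (snd \o c) (dc t).2].

Definition C1_arc (R : realType) (c : R -> R * R) (a b : R) : Prop :=
  exists dc : R -> R * R, C1_arc_with a b c dc.

(* A smooth arc has a nowhere vanishing velocity, one-sided velocities at the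
   endpoints included; pieces of a loop may therefore meet in corners or
   cusps, but not be degenerate. *)
Definition smooth_arc (R : realType) (c : R -> R * R) (a b : R) : Prop :=
  exists dc : R -> R * R, C1_arc_with a b c dc /\
    forall t : R, a <= t <= b -> dc t != 0.

Definition piecewise (R : realType) (Q : R -> R -> Prop) (a b : R) : Prop :=
  exists (n : nat) (s : nat -> R),
    [/\ s 0%N = a, s n = b &
        forall i : nat, (i < n)%N -> s i < s i.+1 /\ Q (s i) (s i.+1)].

(* The circle is [0, 1] with its endpoints identified. *)
Definition jordan_param (R : realType) (P : set (R * R)) (c : R -> R * R) :
    Prop :=
  [/\ {within `[0, 1], continuous c}, c 0 = c 1,
      (forall s t : R, 0 <= s < 1 -> 0 <= t < 1 -> c s = c t -> s = t) &
      P = c @` `[0, 1]].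

Definition piecewise_smooth_jordan_loop (R : realType) (P : set (R * R)) :
    Prop :=
  exists c : R -> R * R, jordan_param P c /\ piecewise (smooth_arc c) 0 1.

(* The points of the complement of P lying in a bounded component of it. *)
Definition bounded_region (R : realType) (P : set (R * R)) : set (R * R) :=
  [set p | ~ P p /\ bounded_set (connected_component (~` P) p)].

Definition area (R : realType) (A : set (R * R)) : \bar R :=
  (@lebesgue_measure R \x @lebesgue_measure R)%E A.

(* For a piecewise C^1 loop c on [0, 1]; the finitely many points where c has
   no derivative form a null set, so derive1's default value is immaterial. *)
Definition signed_area (R : realType) (c : R -> R * R) : R :=
  2^-1 * \int[@lebesgue_measure R]_(t in `[0, 1])
    ((c t).1 * derive1 (snd \o c) t - (c t).2 * derive1 (fst \o c) t).

(* (R^2)^4; the vertices R_1, R_2, R_3, R_4 are r 0, r 1, r 2, r 3. *)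
Definition quad (R : realType) : Type := 'I_4 -> R * R.

Definition is_rectangle (R : realType) (r : quad R) : Prop :=
  [/\ r 0 != r 1, r 1 != r 2, r 1 - r 0 = r 2 - r 3 &
      dot (r 1 - r 0) (r 2 - r 1) = 0].

(* Letting the parametrization of P vary makes the cyclic order independent
   of a base point and of an orientation of P. *)
Definition graces (R : realType) (P : set (R * R)) (r : quad R) : Prop :=
  exists (c : R -> R * R) (s : 'I_4 -> R),
    [/\ jordan_param P c, forall i : 'I_4, 0 <= s i < 1,
        forall i j : 'I_4, (i < j)%N -> s i < s j &
        forall i : 'I_4, r i = c (s i)].

Definition Gamma (R : realType) (P : set (R * R)) : set (quad R) :=
  [set r | is_rectangle r /\ graces P r].

Definition locally_one_sided (R : realType) (P : set (R * R)) (a b : R * R) :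
    Prop :=
  exists2 e : R, 0 < e &
    (forall p : R * R, P p -> dist p a < e -> 0 <= dot (p - a) (b - a)) \/
    (forall p : R * R, P p -> dist p a < e -> dot (p - a) (b - a) <= 0).

Definition is_diameter (R : realType) (P : set (R * R)) (a b : R * R) : Prop :=
  [/\ P a, P b, a != b, locally_one_sided P a b & locally_one_sided P b a].

Definition degenerate_at_diameter (R : realType) (P : set (R * R))
    (r : quad R) : Prop :=
  [/\ r 0 = r 1, r 2 = r 3 & is_diameter P (r 0) (r 2)] \/
  [/\ r 1 = r 2, r 3 = r 0 & is_diameter P (r 0) (r 2)].

Definition piecewise_C1_path (R : realType) (alpha : R -> quad R) : Prop :=
  forall i : 'I_4, piecewise (C1_arc (fun t => alpha t i)) 0 1.

Definition closed_loop (R : realType) (P : set (R * R)) (alpha : R -> quad R) :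
    Prop :=
  (forall t : R, 0 <= t <= 1 -> Gamma P (alpha t)) /\ alpha 0 = alpha 1.

Definition diameter_arc (R : realType) (P : set (R * R))
    (alpha : R -> quad R) : Prop :=
  [/\ forall t : R, 0 < t < 1 -> Gamma P (alpha t),
      degenerate_at_diameter P (alpha 0) &
      degenerate_at_diameter P (alpha 1)].

Definition shape_curve (R : realType) (alpha : R -> quad R) (t : R) : R * R :=
  (dist (alpha t 0) (alpha t 1), dist (alpha t 1) (alpha t 2)).

Definition on_X_axis (R : realType) (z : R * R) : Prop := z.2 = 0.
Definition on_Y_axis (R : realType) (z : R * R) : Prop := z.1 = 0.

Definition hyperbolic_arc (R : realType) (P : set (R * R))
    (alpha : R -> quad R) : Prop :=
  let z := shape_curve alpha in
  diameter_arc P alpha /\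
  (on_X_axis (z 0) /\ on_Y_axis (z 1) \/ on_Y_axis (z 0) /\ on_X_axis (z 1)).

Definition null_arc (R : realType) (P : set (R * R))
    (alpha : R -> quad R) : Prop :=
  let z := shape_curve alpha in
  diameter_arc P alpha /\
  (on_X_axis (z 0) /\ on_X_axis (z 1) \/ on_Y_axis (z 0) /\ on_Y_axis (z 1)).

Definition segment (R : realType) (p q : R * R) (t : R) : R * R :=
  (1 - t) *: p + t *: q.

Definition concat (R : realType) (c d : R -> R * R) (t : R) : R * R :=
  if t <= 2^-1 then c (2 * t) else d (2 * t - 1).

Definition hyperbolic_shape_loop (R : realType) (alpha : R -> quad R) :
    R -> R * R :=
  let z := shape_curve alpha in
  concat z (concat (segment (z 1) 0) (segment 0 (z 0))).

Definition null_shape_loop (R : realType) (alpha : R -> quad R) :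
    R -> R * R :=
  let z := shape_curve alpha in concat z (segment (z 1) (z 0)).

(* Main.v *)
(* Along a path of rectangles with sides u and v, orthogonality of u and v gives
   X Y' - Y X' = s (det(r1, r1') - det(r2, r2') + det(r3, r3') - det(r4, r4')),
   where s, the sign of det(u, v), is constant. The signed area of the shape
   loop is thus, up to sign, half the alternating sum of the areas swept by the
   four vertices. Let A be twice the area swept along the whole of P and E(p, q)
   twice the area swept along P from p to q. Then E(p, q) + E(q, p) = A, the sum
   E(p, q) + E(q, r) + E(r, p) is A or 2A, and along the path E(ri, rj) grows by
   the difference of the areas swept by rj and ri. Comparing both ends of the
   path, the alternating sum is 0 for a closed loop or a null arc, and A or -A
   for a hyperbolic arc.

   It remains to see that |A| / 2 is the area inside P. For bumps phi and psi
   supported near the coordinates of a point off P, the integral of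
   phi(x) Psi(y) dx along P, with Psi' = psi, is a constant w times the masses of
   phi and psi. This density w is locally constant, 0 far away, and jumps by 1
   across P; as the complement of P has at most two components, w = k with
   |k| = 1 inside P and w = 0 outside. Summing over a fine grid of hat functions,
   all but O(n) of whose cells avoid P, shows that the integral of y dx along P
   is k times the area. *)

From HB Require Import structures.
Require Import Defs.
From mathcomp Require Import all_boot all_order all_algebra.
From mathcomp Require Import all_classical all_reals all_analysis.
From mathcomp Require Import measurable_realfun ring lra.

Set Implicit Arguments.
Unset Strict Implicit.
Unset Printing Implicit Defensive.

Import Order.TTheory GRing.Theory Num.Theory.
Import numFieldNormedType.Exports.
Local Open Scope classical_set_scope.
Local Open Scope ring_scope.

(** The obstacle is that there is no common subdivision: a vertex may meet a corner of P infinitely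
    often, and its parameter on P jumps whenever it passes the base point. So no change of variables
    is made. Integrals are replaced by primitives characterized by a second-order estimate,
    meaningful for Lipschitz functions, and the growth of E(ri, rj) is checked at one time t0 after
    another, where an error O((t - t0)^2), with constants depending on t0, suffices. There the
    nonzero velocity of P enters: it bounds the displacement of a parameter by that of its point.
    The same condition makes x or y locally monotone along P, and the distance to a point of P
    monotone along the two arcs leaving it, so that small circles around the point meet P exactly
    twice; this yields the two components. Bumps spare the choice of an angle function, and their
    integrals are bounded by the product of the masses even when their support meets P, which
    controls the cells that do not avoid P. Finally E(ri, rj) is not continuous where ri and rj
    coincide, so a hyperbolic arc is cut in the middle and each half uses only pairs that stay
    distinct on it. *)

Section ShapeArea.
Context {R : realType}.

(** * Stieltjes primitives of Lipschitz functions *)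

(** Only intervals having [s] as an endpoint are tested, so a corner at [s] does no harm: the two
    sides are treated separately. *)
Definition locally_on (Q : R -> R -> Prop) (a b : R) : Prop :=
  forall s : R,
    (a <= s < b -> exists v, [/\ s < v, v <= b & forall t, s < t <= v -> Q s t])
 /\ (a < s <= b -> exists u, [/\ a <= u, u < s & forall t, u <= t < s -> Q t s]).

(** This replaces the choice of a finite subdivision. Let [m] be the supremum of the points reached
    from [a]: the left-hand condition at [m] shows that [m] is reached, and the right-hand one would
    lead beyond [m] if [m < b]. *)
Lemma interval_induction (T : R -> R -> Prop) (a b : R) :
  a < b ->
  (forall u w v, a <= u -> u < w -> w < v -> v <= b -> T u w -> T w v -> T u v) ->
  locally_on T a b -> T a b.
Proof.
move=> ab Tadd Tloc.
pose E := [set t | a < t <= b /\ T a t].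
have [v0 [av0 v0b Tv0]] := (Tloc a).1 (ltac:(by rewrite lexx ab)).
have E0 : E v0 by split; [rewrite av0|apply: Tv0; rewrite av0 lexx].
have Eub : ubound E b by move=> t [/andP[]].
have supE : has_sup E by split; [exists v0|exists b].
set m := sup E.
have am : a < m by apply: (lt_le_trans av0); apply: (ub_le_sup supE.2).
have mb : m <= b by apply: ge_sup => //; exists v0.
have Tm : T a m.
  have [u [au um Tu]] := (Tloc m).2 (ltac:(by rewrite am mb)).
  have [t [/andP[at_ tb] Tt] ut] : exists2 t, E t & u < t.
    have [t Et] : exists2 t, E t & m - (m - u) < t.
      by apply: sup_adherent => //; rewrite subr_gt0.
    by rewrite subKr => ut; exists t.
  have : t <= m by apply: (ub_le_sup supE.2); split => //; rewrite at_.
  rewrite le_eqVlt => /predU1P[<-//|tm].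
  by apply: (Tadd _ t) => //; apply: Tu; rewrite (ltW ut).
move: mb; rewrite le_eqVlt => /predU1P[<-//|mb].
have [v [mv vb Tv]] := (Tloc m).1 (ltac:(by rewrite (ltW am) mb)).
suff : v <= m by rewrite leNgt mv.
apply: (ub_le_sup supE.2); split; first by rewrite (lt_trans am).
by apply: (Tadd _ m) => //; apply: Tv; rewrite mv lexx.
Qed.

Lemma locally_on_impl (Q T : R -> R -> Prop) (a b : R) :
  (forall u v, a <= u -> u < v -> v <= b -> Q u v -> T u v) ->
  locally_on Q a b -> locally_on T a b.
Proof.
move=> QT H s; split=> hs.
- have [v [sv vb Hv]] := (H s).1 hs; exists v; split=> // t ht.
  case/andP: (hs) (ht) => as_ sb /andP[st tv].
  by apply: QT => //; [exact: le_trans vb|exact: Hv].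
- have [u [au us Hu]] := (H s).2 hs; exists u; split=> // t ht.
  case/andP: (hs) (ht) => as_ sb /andP[ut ts].
  by apply: QT => //; [exact: le_trans ut|exact: Hu].
Qed.

Lemma locally_on_near (Q : R -> R -> Prop) (a b : R) :
  (forall s, a <= s <= b -> exists2 d, 0 < d & forall t, a <= t <= b ->
     `|t - s| < d -> (s < t -> Q s t) /\ (t < s -> Q t s)) -> locally_on Q a b.
Proof.
move=> H s; split=> /andP[h1 h2].
- have [d d0 Hd] := H s ltac:(by rewrite h1 ltW).
  exists (Num.min b (s + d / 2)); split; [by rewrite lt_min h2; lra|by rewrite ge_min lexx|].
  move=> t /andP[st]; rewrite le_min => /andP[tb ts].
  by apply: (Hd t _ _).1 => //; [lra|rewrite gtr0_norm; lra].
- have [d d0 Hd] := H s ltac:(by rewrite h2 andbT ltW).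
  exists (Num.max a (s - d / 2)); split; [by rewrite le_max lexx|by rewrite gt_max h1; lra|].
  move=> t; rewrite ge_max => /andP[/andP[ta ts] ts'].
  by apply: (Hd t _ _).2 => //; [lra|rewrite ltr_norml; lra].
Qed.

Lemma locally_on_sub (Q : R -> R -> Prop) (a b a' b' : R) :
  a <= a' -> b' <= b -> locally_on Q a b -> locally_on Q a' b'.
Proof.
move=> aa bb H s; split=> /andP[h1 h2].
- have [|v [sv vb Hv]] := (H s).1.
    by rewrite (le_trans aa h1) (lt_le_trans h2 bb).
  exists (Num.min v b'); split; [by rewrite lt_min sv h2|by rewrite ge_min lexx orbT|].
  by move=> t /andP[st]; rewrite le_min => /andP[tv _]; apply: Hv; rewrite st.
- have [|u [au us Hu]] := (H s).2.
    by rewrite (le_lt_trans aa h1) (le_trans h2 bb).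
  exists (Num.max u a'); split; [by rewrite le_max lexx orbT|by rewrite gt_max us h1|].
  by move=> t; rewrite ge_max => /andP[/andP[ut _] ts]; apply: Hu; rewrite ut.
Qed.

Lemma locally_on_and (Q T : R -> R -> Prop) (a b : R) :
  locally_on Q a b -> locally_on T a b ->
  locally_on (fun u v => Q u v /\ T u v) a b.
Proof.
move=> HQ HT s; split=> hs.
- have [v [sv vb Hv]] := (HQ s).1 hs; have [w [sw wb Hw]] := (HT s).1 hs.
  exists (Num.min v w); split; [by rewrite lt_min sv|by rewrite ge_min vb|].
  move=> t /andP[st]; rewrite le_min => /andP[tv tw].
  by split; [apply: Hv|apply: Hw]; rewrite st.
- have [v [av sv Hv]] := (HQ s).2 hs; have [w [aw sw Hw]] := (HT s).2 hs.
  exists (Num.max v w); split; [by rewrite le_max av|by rewrite gt_max sv|].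
  move=> t; rewrite ge_max => /andP[/andP[tv tw] ts].
  by split; [apply: Hv|apply: Hw]; rewrite ts ?tv ?tw.
Qed.

(** The piece next to [t] ends at the least breakpoint on the far side of [t]; heredity allows
    cutting it at [t]. *)
Lemma piecewise_locally_on (Q : R -> R -> Prop) (a b : R) :
  (forall u v u' v', u <= u' -> u' < v' -> v' <= v -> Q u v -> Q u' v') ->
  piecewise Q a b -> locally_on Q a b.
Proof.
move=> Qh [n [s [s0 sn H]]] t; split => /andP[h1 h2].
- have : exists i, (i < n)%N /\ s i <= t < s i.+1.
    have : exists i, (i <= n)%N && (t < s i) by exists n; rewrite leqnn sn.
    move=> /ex_minnP[[|i] /andP[ile ti] imin]; first by rewrite s0 ltNge h1 in ti.
    exists i; split => //; rewrite ti andbT leNgt; apply/negP => ti'.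
    by have := imin i; rewrite (ltnW ile) ti' ltnn => /(_ isT).
  move=> [i [iln /andP[h3 h4]]]; have [h5 h6] := H i iln.
  exists (Num.min (s i.+1) b); split; rewrite ?lt_min ?h4 ?ge_min ?lexx ?orbT //.
  move=> w /andP[tw]; rewrite le_min => /andP[ws _].
  exact: (Qh (s i) (s i.+1)).
- have : exists i, (i < n)%N /\ s i < t <= s i.+1.
    have : exists i, (i <= n)%N && (t <= s i) by exists n; rewrite leqnn sn.
    move=> /ex_minnP[[|i] /andP[ile ti] imin]; first by rewrite s0 leNgt h1 in ti.
    exists i; split => //; rewrite ti andbT ltNge; apply/negP => ti'.
    by have := imin i; rewrite (ltnW ile) ti' ltnn => /(_ isT).
  move=> [i [iln /andP[h3 h4]]]; have [h5 h6] := H i iln.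
  exists (Num.max (s i) a); split; rewrite ?gt_max ?h3 ?le_max ?lexx ?orbT //.
  move=> w; rewrite ge_max => /andP[/andP[ws _] wt].
  exact: (Qh (s i) (s i.+1)).
Qed.

Definition lip (x : R -> R) (a b : R) : Prop :=
  exists2 L : R, 0 <= L &
    forall s t, a <= s <= b -> a <= t <= b -> `|x t - x s| <= L * `|t - s|.

(* K is an indefinite integral of f dx: for Lipschitz f and x this
   second-order estimate determines K up to a constant. *)
Definition prim (f x K : R -> R) (a b : R) : Prop :=
  exists2 C : R, 0 <= C &
    forall s t, a <= s <= b -> a <= t <= b ->
      `|K t - K s - f s * (x t - x s)| <= C * (t - s) ^+ 2.

Definition C1_scalar (x dx : R -> R) (a b : R) : Prop :=
  [/\ {within `[a, b], continuous x}, {within `[a, b], continuous dx} &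
      forall t : R, a < t < b -> is_derive t 1 x (dx t)].

Lemma within_itv_eps (f : R -> R) (a b s e : R) :
  {within `[a, b], continuous f} -> a <= s <= b -> 0 < e ->
  exists2 d, 0 < d & forall t, a <= t <= b -> `|t - s| < d -> `|f t - f s| < e.
Proof.
move=> /subspace_continuousP/(_ s) /= H hs e0.
have /H/cvgrPdist_lt/(_ _ e0) : s \in `[a, b] by rewrite in_itv.
rewrite near_withinE /= => /nbhs_ballP[d /= d0 Hd].
exists d => // t ht td; rewrite distrC; apply: Hd; last by rewrite in_itv.
by rewrite /ball /= distrC.
Qed.

Lemma eps_within_itv (f : R -> R) (a b : R) :
  (forall s e, a <= s <= b -> 0 < e ->
     exists2 d, 0 < d & forall t, a <= t <= b -> `|t - s| < d -> `|f t - f s| < e) ->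
  {within `[a, b], continuous f}.
Proof.
move=> H; apply/subspace_continuousP => s /=; rewrite in_itv /= => hs.
apply/cvgrPdist_lt => e e0; have [d d0 Hd] := H s e hs e0.
rewrite near_withinE /=; apply/nbhs_ballP; exists d => // t.
rewrite /ball /= => td; rewrite in_itv /= => ht.
by rewrite distrC; apply: Hd => //; rewrite distrC.
Qed.

Lemma lip_continuous (x : R -> R) (a b : R) :
  lip x a b -> {within `[a, b], continuous x}.
Proof.
move=> [L L0 H]; apply: eps_within_itv => s e hs e0.
exists (e / (L + 1)); first by rewrite divr_gt0 // ltr_pwDr.
move=> t ht; rewrite ltr_pdivlMr ?ltr_pwDr // => td.
apply: (le_lt_trans (H _ _ hs ht)); apply: le_lt_trans td.
by rewrite mulrC ler_wpM2l // lerDl.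
Qed.

Lemma lip_bounded (x : R -> R) (a b : R) :
  lip x a b -> exists2 M, 0 <= M & forall t, a <= t <= b -> `|x t| <= M.
Proof.
move=> [L L0 H]; exists (`|x a| + L * `|b - a|); first by rewrite addr_ge0 ?mulr_ge0.
move=> t ht; rewrite -[x t](subrK (x a)) addrC (le_trans (ler_normD _ _)) // lerD2l.
have ab : a <= b by case/andP: ht => h1 h2; exact: le_trans h2.
apply: (le_trans (H _ _ _ ht)); first by rewrite lexx.
case/andP: ht => at_ tb.
by rewrite ler_wpM2l // !ger0_norm ?subr_ge0 // lerD2r.
Qed.

Lemma lipD (x y : R -> R) (a b : R) :
  lip x a b -> lip y a b -> lip (fun t => x t + y t) a b.
Proof.
move=> [L L0 H] [L' L0' H']; exists (L + L'); first exact: addr_ge0.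
move=> s t hs ht; have := H s t hs ht; have := H' s t hs ht.
rewrite mulrDl => h1 h2.
have -> : x t + y t - (x s + y s) = (x t - x s) + (y t - y s) by ring.
by rewrite (le_trans (ler_normD _ _)) // lerD.
Qed.

Lemma lipM (x y : R -> R) (a b : R) :
  lip x a b -> lip y a b -> lip (fun t => x t * y t) a b.
Proof.
move=> lx ly; have [M M0 HM] := lip_bounded lx; have [N N0 HN] := lip_bounded ly.
case: lx ly => [L L0 H] [L' L0' H']; exists (M * L' + N * L).
  by rewrite addr_ge0 ?mulr_ge0.
move=> s t hs ht.
have -> : x t * y t - x s * y s = x t * (y t - y s) + y s * (x t - x s) by ring.
rewrite (le_trans (ler_normD _ _)) // !normrM mulrDl -!mulrA.
by rewrite lerD // ler_pM // ?HM ?HN ?H ?H'.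
Qed.

Lemma lip_cst (k a b : R) : lip (fun=> k) a b.
Proof. by exists 0 => // s t _ _; rewrite subrr normr0 mul0r. Qed.

Lemma lipN (x : R -> R) (a b : R) :
  lip x a b -> lip (fun t => - x t) a b.
Proof.
move=> [L L0 H]; exists L => // s t hs ht.
by rewrite -opprD normrN; apply: H.
Qed.

Lemma lip_comp (f x : R -> R) (L a b : R) : 0 <= L ->
  (forall u v, `|f v - f u| <= L * `|v - u|) -> lip x a b ->
  lip (fun t => f (x t)) a b.
Proof.
move=> L0 Hf [M M0 H]; exists (L * M); first exact: mulr_ge0.
move=> s t hs ht; apply: (le_trans (Hf _ _)).
by rewrite -mulrA ler_wpM2l // H.
Qed.

Lemma lip_sub (x : R -> R) (a b a' b' : R) :
  a <= a' -> b' <= b -> lip x a b -> lip x a' b'.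
Proof.
move=> aa bb [L L0 H]; exists L => // s t /andP[h1 h2] /andP[h3 h4].
by apply: H; rewrite ?(le_trans aa) ?(le_trans _ bb).
Qed.

Lemma prim_sub (f x K : R -> R) (a b a' b' : R) :
  a <= a' -> b' <= b -> prim f x K a b -> prim f x K a' b'.
Proof.
move=> aa bb [L L0 H]; exists L => // s t /andP[h1 h2] /andP[h3 h4].
by apply: H; rewrite ?(le_trans aa) ?(le_trans _ bb).
Qed.

(** Each half of an interval loses at most a quarter of the quadratic bound, so bisection halves the
    total loss. After [n] bisections the loss is at most [C * (b - a) ^+ 2 / 2 ^+ n], which leaves
    no room for a decrease. *)
Lemma quadratic_incr (K : R -> R) (C a b : R) : 0 <= C -> a <= b ->
  (forall s t, a <= s -> s <= t -> t <= b -> - (C * (t - s) ^+ 2) <= K t - K s) ->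
  K a <= K b.
Proof.
move=> C0 ab H.
have {}H (n : nat) s t : a <= s -> s <= t -> t <= b ->
    - (C * (t - s) ^+ 2 / 2 ^+ n) <= K t - K s.
  elim: n s t => [|n IH] s t as_ st tb; first by rewrite expr0 divr1 H.
  have h1 : a <= (s + t) / 2 by lra.
  have h2 : (s + t) / 2 <= b by lra.
  have h3 : s <= (s + t) / 2 by lra.
  have h4 : (s + t) / 2 <= t by lra.
  have := lerD (IH _ _ as_ h3 h2) (IH _ _ h1 h4 tb).
  have -> : K ((s + t) / 2) - K s + (K t - K ((s + t) / 2)) = K t - K s by ring.
  apply: le_trans; rewrite le_eqVlt; apply/orP; left; apply/eqP.
  have : (2 ^+ n : R) != 0 by rewrite expf_neq0.
  by rewrite [2 ^+ n.+1]exprS; move: (2 ^+ n) => q q0; field.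
rewrite leNgt; apply/negP => Kba.
have d0 : 0 < K a - K b by rewrite subr_gt0.
pose D := C * (b - a) ^+ 2.
have D0 : 0 <= D by rewrite mulr_ge0 // sqr_ge0.
have [n Hn] : exists n : nat, D / (K a - K b) < n%:R.
  exists (Num.truncn (D / (K a - K b))).+1; exact: truncnS_gt.
have n2 : n%:R < (2 ^+ n : R) by rewrite -natrX ltr_nat ltn_expl.
have := H n a b (lexx _) ab (lexx _); rewrite -/D => h.
have : D / 2 ^+ n < K a - K b.
  rewrite ltr_pdivrMr ?exprn_gt0 // mulrC -ltr_pdivrMr //.
  exact: lt_trans n2.
by move: h; lra.
Qed.

(** The first-order term [f s * (x t - x s)] is nonnegative, so only a quadratic loss remains. *)
Lemma prim_increment_ge0 (f x K : R -> R) (a b : R) : a <= b ->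
  prim f x K a b -> (forall s, a <= s <= b -> 0 <= f s) ->
  (forall s t, a <= s -> s <= t -> t <= b -> x s <= x t) -> K a <= K b.
Proof.
move=> ab [C C0 H] f0 xincr; apply: (@quadratic_incr _ C) => // s t as_ st tb.
have hs : a <= s <= b by rewrite as_ (le_trans st).
have ht : a <= t <= b by rewrite tb (le_trans as_).
have := H s t hs ht; rewrite ler_norml => /andP[h _].
have : 0 <= f s * (x t - x s) by rewrite mulr_ge0 ?f0 // subr_ge0 xincr.
by move: h; lra.
Qed.

(** The first-order terms cancel in the difference of the two primitives; [quadratic_incr] applies
    to it and to its opposite. *)
Lemma prim_uniq (f x K K' : R -> R) (a b : R) : a <= b ->
  prim f x K a b -> prim f x K' a b -> K b - K a = K' b - K' a.
Proof.
move=> ab [C C0 H] [C' C0' H'].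
have CC : 0 <= C + C' by rewrite addr_ge0.
have key s t : a <= s -> s <= t -> t <= b ->
    `|(K t - K' t) - (K s - K' s)| <= (C + C') * (t - s) ^+ 2.
  move=> as_ st tb.
  have hs : a <= s <= b by rewrite as_ (le_trans st).
  have ht : a <= t <= b by rewrite tb (le_trans as_).
  have -> : (K t - K' t) - (K s - K' s) = (K t - K s - f s * (x t - x s))
      - (K' t - K' s - f s * (x t - x s)) by ring.
  by rewrite mulrDl (le_trans (ler_normB _ _)) // lerD ?H ?H'.
have h1 : K a - K' a <= K b - K' b.
  apply: (@quadratic_incr (fun t => K t - K' t) _ a b CC ab) => s t as_ st tb.
  by have := key s t as_ st tb; rewrite ler_norml => /andP[].
have h2 : K' a - K a <= K' b - K b.
  apply: (@quadratic_incr (fun t => K' t - K t) _ a b CC ab) => s t as_ st tb.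
  by have := key s t as_ st tb; rewrite ler_norml => /andP[_]; lra.
by lra.
Qed.

Lemma primD (f g x K J : R -> R) (a b : R) :
  prim f x K a b -> prim g x J a b ->
  prim (fun t => f t + g t) x (fun t => K t + J t) a b.
Proof.
move=> [C C0 H] [C' C0' H']; exists (C + C'); first exact: addr_ge0.
move=> s t hs ht.
have -> : K t + J t - (K s + J s) - (f s + g s) * (x t - x s) =
  (K t - K s - f s * (x t - x s)) + (J t - J s - g s * (x t - x s)) by ring.
by rewrite mulrDl (le_trans (ler_normD _ _)) // lerD ?H ?H'.
Qed.

Lemma primZ (k : R) (f x K : R -> R) (a b : R) :
  prim f x K a b -> prim (fun t => k * f t) x (fun t => k * K t) a b.
Proof.
move=> [C C0 H]; exists (`|k| * C); first exact: mulr_ge0.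
move=> s t hs ht.
have -> : k * K t - k * K s - k * f s * (x t - x s) =
  k * (K t - K s - f s * (x t - x s)) by ring.
by rewrite normrM -mulrA ler_wpM2l // H.
Qed.

Lemma prim_ext (f g x y K J : R -> R) (a b : R) :
  (forall t, a <= t <= b -> f t = g t) -> (forall t, a <= t <= b -> x t = y t) ->
  (forall t, a <= t <= b -> K t = J t) ->
  prim f x K a b -> prim g y J a b.
Proof.
move=> fg xy KJ [C C0 H]; exists C => // s t hs ht.
by rewrite -fg // -!xy // -!KJ // H.
Qed.

Lemma prim_cst (k : R) (x : R -> R) (a b : R) :
  prim (fun=> k) x (fun t => k * x t) a b.
Proof.
exists 0 => // s t _ _.
have -> : k * x t - k * x s - k * (x t - x s) = 0 by ring.
by rewrite normr0 mul0r.
Qed.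

Lemma prim_comp (F f x : R -> R) (C a b : R) : 0 <= C ->
  (forall u v, `|F v - F u - f u * (v - u)| <= C * (v - u) ^+ 2) -> lip x a b ->
  prim (fun t => f (x t)) x (fun t => F (x t)) a b.
Proof.
move=> C0 HF [L L0 H]; exists (C * L ^+ 2); first by rewrite mulr_ge0 ?sqr_ge0.
move=> s t hs ht; apply: (le_trans (HF _ _)); rewrite -mulrA ler_wpM2l //.
rewrite -exprMn -[leLHS]real_normK ?num_real // -[leRHS]real_normK ?num_real //.
by rewrite lerXn2r ?nnegrE // normrM (ger0_norm L0) H.
Qed.

(* Chain rule d(F o x) = (f o x) dx under the integral sign. *)
Lemma prim_chain (F f x g K : R -> R) (C a b : R) : 0 <= C ->
  (forall u v, `|F v - F u - f u * (v - u)| <= C * (v - u) ^+ 2) ->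
  lip x a b -> lip g a b ->
  prim (fun t => g t * f (x t)) x K a b -> prim g (fun t => F (x t)) K a b.
Proof.
move=> C0 HF lx lg [D D0 HK].
have [M M0 HM] := lip_bounded lg.
have [E E0 HE] := prim_comp C0 HF lx.
exists (D + M * E); first by rewrite addr_ge0 ?mulr_ge0.
move=> s t hs ht.
have -> : K t - K s - g s * (F (x t) - F (x s)) =
   (K t - K s - g s * f (x s) * (x t - x s))
   - g s * (F (x t) - F (x s) - f (x s) * (x t - x s)) by ring.
rewrite mulrDl (le_trans (ler_normB _ _)) // lerD ?HK //.
by rewrite normrM -mulrA ler_pM // ?HM ?HE.
Qed.

(** Both [K + J] and [f * g] are primitives of the constant 1 with respect to [f * g]: they differ
    in first order only by the product of the increments of [f] and [g], which is quadratic. *)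
Lemma prim_by_parts (f g K J : R -> R) (a b : R) : a <= b ->
  lip f a b -> lip g a b -> prim f g K a b -> prim g f J a b ->
  (K b - K a) + (J b - J a) = f b * g b - f a * g a.
Proof.
move=> ab lf lg [C C0 HK] [D D0 HJ].
case: lf lg => [L L0 Lf] [M M0 Mg].
have h1 : prim (fun=> 1 : R) (fun t => f t * g t) (fun t => f t * g t) a b.
  exists 0 => // s t _ _; have -> : f t * g t - f s * g s - 1 * (f t * g t - f s * g s) = 0 by ring.
  by rewrite normr0 mul0r.
have h2 : prim (fun=> 1 : R) (fun t => f t * g t) (fun t => K t + J t) a b.
  exists (C + D + L * M); first by rewrite !addr_ge0 ?mulr_ge0.
  move=> s t hs ht.
  have -> : K t + J t - (K s + J s) - 1 * (f t * g t - f s * g s) =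
    (K t - K s - f s * (g t - g s)) + (J t - J s - g s * (f t - f s))
    - (f t - f s) * (g t - g s) by ring.
  rewrite (mulrDl (C + D)) (mulrDl C) (le_trans (ler_normB _ _)) // lerD //.
    by rewrite (le_trans (ler_normD _ _)) // lerD ?HK ?HJ.
  rewrite normrM -[(t - s) ^+ 2]real_normK ?num_real //.
  have -> : L * M * `|t - s| ^+ 2 = (L * `|t - s|) * (M * `|t - s|) by ring.
  by rewrite ler_pM // ?Lf ?Mg.
by have := prim_uniq ab h2 h1; lra.
Qed.

Lemma prim_lip (f x K : R -> R) (a b : R) :
  lip f a b -> lip x a b -> prim f x K a b -> lip K a b.
Proof.
move=> lf [L L0 HL] [C C0 HC]; have [M M0 HM] := lip_bounded lf.
exists (C * `|b - a| + M * L); first by rewrite addr_ge0 ?mulr_ge0.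
move=> s t hs ht.
have -> : K t - K s = (K t - K s - f s * (x t - x s)) + f s * (x t - x s) by ring.
rewrite mulrDl (le_trans (ler_normD _ _)) // lerD //.
  apply: (le_trans (HC _ _ hs ht)).
  rewrite -[(t - s) ^+ 2]real_normK ?num_real // expr2 mulrA ler_wpM2r // ler_wpM2l //.
  case/andP: hs => ? ?; case/andP: ht => ? ?.
  by rewrite (ger0_norm (_ : 0 <= b - a)) ?ler_norml; lra.
by rewrite normrM -mulrA ler_pM // ?HM ?HL.
Qed.

(** * Piecewise C^1 functions: Lipschitz bounds and existence of primitives *)

Lemma C1_scalar_sub (x dx : R -> R) (a b a' b' : R) :
  a <= a' -> b' <= b -> C1_scalar x dx a b -> C1_scalar x dx a' b'.
Proof.
move=> aa bb [cx cdx H].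
have sub : `[a', b'] `<=` `[a, b].
  by move=> t /=; rewrite !in_itv /= => /andP[h1 h2]; rewrite (le_trans aa) // (le_trans h2).
split; [exact: continuous_subspaceW cx|exact: continuous_subspaceW cdx|].
by move=> t /andP[h1 h2]; apply: H; rewrite (le_lt_trans aa) // (lt_le_trans h2).
Qed.

Lemma C1_scalar_cst (k a b : R) : C1_scalar (fun=> k) (fun=> 0) a b.
Proof.
split; [|exact: continuous_subspaceT (@cst_continuous _ _ 0)|by move=> t _; exact: is_derive_cst].
exact: continuous_subspaceT (@cst_continuous _ _ k).
Qed.

Lemma C1_scalarD (x dx y dy : R -> R) (a b : R) :
  C1_scalar x dx a b -> C1_scalar y dy a b ->
  C1_scalar (fun t => x t + y t) (fun t => dx t + dy t) a b.
Proof.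
move=> [cx cdx Hx] [cy cdy Hy]; split.
- by move=> t; exact: cvgD (cx t) (cy t).
- by move=> t; exact: cvgD (cdx t) (cdy t).
- by move=> t ht; have h1 := Hx t ht; have h2 := Hy t ht; exact: is_deriveD.
Qed.

Lemma C1_scalarM (x dx y dy : R -> R) (a b : R) :
  C1_scalar x dx a b -> C1_scalar y dy a b ->
  C1_scalar (fun t => x t * y t) (fun t => x t * dy t + y t * dx t) a b.
Proof.
move=> [cx cdx Hx] [cy cdy Hy]; split.
- by move=> t; exact: cvgM (cx t) (cy t).
- by move=> t; exact: cvgD (cvgM (cx t) (cdy t)) (cvgM (cy t) (cdx t)).
- by move=> t ht; have h1 := Hx t ht; have h2 := Hy t ht; exact: is_deriveM.
Qed.

Lemma C1_scalarZ (k : R) (x dx : R -> R) (a b : R) :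
  C1_scalar x dx a b -> C1_scalar (fun t => k * x t) (fun t => k * dx t) a b.
Proof.
have -> : (fun t => k * dx t) = (fun t => k * dx t + x t * 0).
  by apply/funext => t; rewrite mulr0 addr0.
exact: C1_scalarM (C1_scalar_cst k a b).
Qed.

Lemma C1_scalarB (x dx y dy : R -> R) (a b : R) :
  C1_scalar x dx a b -> C1_scalar y dy a b ->
  C1_scalar (fun t => x t - y t) (fun t => dx t - dy t) a b.
Proof.
move=> [cx cdx Hx] [cy cdy Hy]; split.
- by move=> t; exact: cvgB (cx t) (cy t).
- by move=> t; exact: cvgB (cdx t) (cdy t).
- by move=> t ht; have h1 := Hx t ht; have h2 := Hy t ht; exact: is_deriveB.
Qed.

Lemma C1_scalar_MVT (x dx : R -> R) (a b : R) : a < b ->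
  C1_scalar x dx a b -> exists2 t, a < t < b & x b - x a = dx t * (b - a).
Proof.
move=> ab [cx cdx H].
have d t : t \in `]a, b[%R -> is_derive t 1 x (dx t) by rewrite in_itv /=; exact: H.
have [t] := MVT ab d cx.
by rewrite in_itv /= => ht ->; exists t.
Qed.

Lemma within_itv_bounded (f : R -> R) (a b : R) :
  {within `[a, b], continuous f} ->
  exists2 M, 0 <= M & forall t, a <= t <= b -> `|f t| <= M.
Proof.
have [ab cf|ba _] := leP a b; last first.
  by exists 0 => // t /andP[h1 h2]; have := le_trans h1 h2; rewrite leNgt ba.
have [c _ Hc] := EVT_max ab cf; have [d _ Hd] := EVT_min ab cf.
exists (`|f c| + `|f d|); first by rewrite addr_ge0.
move=> t ht; have {}ht : t \in `[a, b]%R by rewrite in_itv.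
have := Hc t ht; have := Hd t ht; have := ler_norm (f c); have := ler_norm (- f d).
have := normr_ge0 (f c); have := normr_ge0 (f d).
by rewrite normrN ler_norml; lra.
Qed.

Lemma C1_scalar_lip (x dx : R -> R) (a b : R) :
  C1_scalar x dx a b -> lip x a b.
Proof.
move=> H; have [M M0 HM] := within_itv_bounded (let: And3 _ h _ := H in h).
exists M => // s t.
wlog st : s t / s <= t.
  move=> W hs ht; have [st|/ltW ts] := leP s t; first exact: W.
  by rewrite distrC [in leRHS]distrC; apply: W.
move=> /andP[as_ sb] /andP[at_ tb]; move: st; rewrite le_eqVlt => /predU1P[->|st].
  by rewrite !subrr normr0 mulr0.
have [r /andP[sr rt] ->] := C1_scalar_MVT st (C1_scalar_sub as_ tb H).
by rewrite normrM ler_wpM2r // HM //; lra.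
Qed.

Lemma lip_cat (x : R -> R) (u w v : R) :
  u < w -> w < v -> lip x u w -> lip x w v -> lip x u v.
Proof.
move=> uw wv [L L0 H] [L' L0' H']; exists (L + L'); first exact: addr_ge0.
move=> s t.
wlog st : s t / s <= t.
  move=> W hs ht; have [st|/ltW ts] := leP s t; first exact: W.
  by rewrite distrC [in leRHS]distrC; apply: W.
move=> /andP[us sv] /andP[ut tv]; rewrite mulrDl.
have Lst : 0 <= L * `|t - s| by rewrite mulr_ge0.
have Lst' : 0 <= L' * `|t - s| by rewrite mulr_ge0.
have [tw|wt] := leP t w.
  have : `|x t - x s| <= L * `|t - s| by apply: H; lra.
  by lra.
have [sw|ws] := leP s w; last first.
  have : `|x t - x s| <= L' * `|t - s| by apply: H'; lra.
  by lra.
have -> : x t - x s = (x w - x s) + (x t - x w) by ring.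
have h1 : `|x w - x s| <= L * `|w - s| by apply: H; lra.
have h2 : `|x t - x w| <= L' * `|t - w| by apply: H'; lra.
rewrite (le_trans (ler_normD _ _)) // lerD // ?(le_trans h1) ?(le_trans h2) //.
  by rewrite ler_wpM2l // !ger0_norm; lra.
by rewrite ler_wpM2l // !ger0_norm; lra.
Qed.

Lemma locally_C1_lip (x : R -> R) (a b : R) : a < b ->
  locally_on (fun u v => exists dx, C1_scalar x dx u v) a b -> lip x a b.
Proof.
move=> ab H; apply: interval_induction ab _ _; first by move=> *; apply: lip_cat; eassumption.
by apply: locally_on_impl H => u v _ _ _ [dx]; exact: C1_scalar_lip.
Qed.

Lemma continuous_antiderivative (h : R -> R) (a b : R) : a < b ->
  {within `[a, b], continuous h} -> exists K : R -> R, C1_scalar K h a b.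
Proof.
move=> ab ch.
have hi := continuous_compact_integrable (@segment_compact _ a b) ch.
exists (fun x => parameterized_integral lebesgue_measure a x h); split => //.
  by apply: parameterized_integral_continuous => //; exact: ltW.
move=> t /andP[at_ tb].
have ct : {for t, continuous h}.
  by apply: within_continuous_continuous ch _ => //; rewrite in_itv /= at_.
have [d1 d2] := continuous_FTC1_closed tb hi at_ ct.
by split; [exact: d1|rewrite -derive1E d2].
Qed.

(** Exchanging [s] and [t] replaces [f s] by [f t], which costs [(f t - f s) * (x t - x s)], again a
    quadratic term. *)
Lemma prim_ordered (f x K : R -> R) (C a b : R) : 0 <= C ->
  lip f a b -> lip x a b ->
  (forall s t, a <= s -> s <= t -> t <= b ->
     `|K t - K s - f s * (x t - x s)| <= C * (t - s) ^+ 2) -> prim f x K a b.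
Proof.
move=> C0 [L L0 HL] [M M0 HM] H; exists (C + L * M); first by rewrite addr_ge0 ?mulr_ge0.
move=> s t hs ht; case/andP: (hs) => as_ sb; case/andP: (ht) => at_ tb.
rewrite mulrDl; have [st|/ltW ts] := leP s t.
  by rewrite (le_trans (H s t as_ st tb)) // lerDl mulr_ge0 ?sqr_ge0 ?mulr_ge0.
have -> : K t - K s - f s * (x t - x s) =
  - (K s - K t - f t * (x s - x t)) + (f t - f s) * (x t - x s) by ring.
rewrite (le_trans (ler_normD _ _)) // lerD //; first by rewrite normrN -sqrrN opprB H.
by rewrite normrM -[(t - s) ^+ 2]real_normK ?num_real // expr2 mulrACA ler_pM // ?HL ?HM.
Qed.

(** The mean value theorem for [K - f u * x] turns the error into [(f r - f u) * dx r * (v - u)],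
    and [f] is Lipschitz. The second conclusion links these primitives to Lebesgue integrals. *)
Lemma C1_prim_exists (f x dx : R -> R) (a b : R) : a < b ->
  C1_scalar x dx a b -> lip f a b ->
  exists K, prim f x K a b /\ C1_scalar K (fun t => f t * dx t) a b.
Proof.
move=> ab Hx [L L0 HL]; have [cx cdx dxx] := Hx.
have [M M0 HM] := within_itv_bounded cdx.
have cf : {within `[a, b], continuous f} by apply: lip_continuous; exists L.
have [|K HK] := @continuous_antiderivative (fun t => f t * dx t) _ _ ab.
  by move=> t; exact: cvgM (cf t) (cdx t).
exists K; split => //.
apply: (@prim_ordered _ _ _ (L * M)); [exact: mulr_ge0|by exists L|exact: C1_scalar_lip Hx|].
move=> u v au; rewrite le_eqVlt => /predU1P[-> _|uv vb].
  by rewrite !subrr mulr0 subrr normr0 expr0n mulr0.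
have HD := C1_scalar_sub au vb (C1_scalarB HK (C1_scalarZ (f u) Hx)).
have [r /andP[ur rv]] := C1_scalar_MVT uv HD.
have -> : K v - K u - f u * (x v - x u) = K v - f u * x v - (K u - f u * x u) by ring.
move=> ->; rewrite -mulrBl !normrM expr2 mulrA (ger0_norm (_ : 0 <= v - u)); last by lra.
rewrite ler_wpM2r //; first by lra.
rewrite -mulrA [M * _]mulrC mulrA ler_pM // ?HM //; last by lra.
apply: (le_trans (HL _ _ _ _)); [by lra|by lra|].
by rewrite ler_wpM2l // ler_norml; lra.
Qed.

Lemma prim_cat (f x K J : R -> R) (u w v : R) : u < w -> w < v ->
  lip f u v -> lip x u v -> prim f x K u w -> prim f x J w v ->
  prim f x (fun t => if t <= w then K t else J t - J w + K w) u v.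
Proof.
move=> uw wv [L L0 HL] [M M0 HM] [C C0 HC] [D D0 HD].
have LM : 0 <= L * M by exact: mulr_ge0.
apply: (@prim_ordered _ _ _ (C + D + L * M)); [by rewrite !addr_ge0|by exists L|by exists M|].
move=> s t us st tv; have t20 : 0 <= (t - s) ^+ 2 by exact: sqr_ge0.
have [Ct [Dt Lt]] : 0 <= C * (t - s) ^+ 2 /\ 0 <= D * (t - s) ^+ 2 /\ 0 <= L * M * (t - s) ^+ 2.
  by split; [|split]; exact: mulr_ge0.
rewrite !mulrDl; have [tw|wt] := leP t w.
  rewrite (le_trans st tw); apply: (le_trans (HC s t _ _)); lra.
have [sw|ws] := leP s w; last first.
  have -> : J t - J w + K w - (J s - J w + K w) = J t - J s by ring.
  by apply: (le_trans (HD s t _ _)); lra.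
have -> : J t - J w + K w - K s - f s * (x t - x s) =
  (K w - K s - f s * (x w - x s)) + (J t - J w - f w * (x t - x w))
   + (f w - f s) * (x t - x w) by ring.
have sq p q : s <= p -> p <= q -> q <= t -> `|q - p| <= t - s /\ (q - p) ^+ 2 <= (t - s) ^+ 2.
  move=> sp pq qt; have h := lerB qt sp; have h0 : 0 <= q - p by rewrite subr_ge0.
  by rewrite ger0_norm // lerXn2r ?nnegrE // (le_trans h0).
have [ws1 ws2] := sq _ _ (lexx s) sw (ltW wt).
have [wt1 wt2] := sq _ _ sw (ltW wt) (lexx t).
rewrite (le_trans (ler_normD _ _)) // lerD // ?(le_trans (ler_normD _ _)) ?lerD //.
- by apply: (le_trans (HC s w _ _)); rewrite ?ler_wpM2l //; lra.
- by apply: (le_trans (HD w t _ _)); rewrite ?ler_wpM2l //; lra.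
- rewrite normrM expr2 mulrACA ler_pM //.
    by apply: (le_trans (HL s w _ _)); rewrite ?ler_wpM2l //; lra.
  by apply: (le_trans (HM w t _ _)); rewrite ?ler_wpM2l //; lra.
Qed.

Lemma prim_exists (f x : R -> R) (a b : R) : a < b ->
  locally_on (fun u v => exists dx, C1_scalar x dx u v) a b -> lip f a b ->
  exists K, prim f x K a b.
Proof.
move=> ab H lf; have lx := locally_C1_lip ab H.
pose T u v := exists K, prim f x K u v.
suff : T a b by [].
apply: interval_induction ab _ _.
  move=> u w v au uw wv vb [K HK] [J HJ].
  exists (fun t => if t <= w then K t else J t - J w + K w).
  by apply: prim_cat => //; [apply: lip_sub lf|apply: lip_sub lx].
apply: locally_on_impl H => u v au uv vb [dx Hx].
have [|K [HK _]] := @C1_prim_exists f _ _ _ _ uv Hx; last by exists K.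
exact: lip_sub lf.
Qed.

(** * Lebesgue integrals of derivatives *)

(** Measurability travels with the value because gluing intervals requires it. The equation in the
    extended reals excludes an infinite integral, which the real-valued integral would turn into
    0. *)
Definition has_integral (G : R -> R) (a b I : R) : Prop :=
  measurable_fun `[a, b] G /\
  (\int[@lebesgue_measure R]_(t in `[a, b]) (G t)%:E = I%:E)%E.

Lemma has_integral_Rint (G : R -> R) (a b I : R) :
  has_integral G a b I -> \int[@lebesgue_measure R]_(t in `[a, b]) G t = I.
Proof. by move=> [_ H]; rewrite /Rintegral H. Qed.

Lemma has_integral_cat (G : R -> R) (u w v I J : R) :
  u < w -> w < v -> has_integral G u w I -> has_integral G w v J ->
  has_integral G u v (I + J).
Proof.
move=> uw wv [m1 h1] [m2 h2].
have E : (`[u, v] = `[u, w] `|` `]w, v])%classic.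
  by rewrite -itv_bndbnd_setU // bnd_simp ltW.
have m2' : measurable_fun `]w, v] G by apply: measurable_funS m2 => //; apply: subset_itvr; rewrite bnd_simp.
have mG : measurable_fun `[u, v] G by rewrite E; apply/measurable_funU.
split => //; rewrite E integral_setU //=.
- rewrite h1 integral_itv_obnd_cbnd ?h2 //; exact/measurable_EFinP.
- by rewrite -E; exact/measurable_EFinP.
- apply/disj_setPS => t /=; rewrite !in_itv /= => -[/andP[_ tw] /andP[wt _]].
  by move: tw; rewrite leNgt wt.
Qed.

(** [G] is left free at the endpoints, where [derive1] of a curve with corners has no meaning. *)
Lemma has_integral_C1 (G K h : R -> R) (a b : R) : a < b ->
  C1_scalar K h a b -> (forall t, a < t < b -> G t = h t) ->
  has_integral G a b (K b - K a).
Proof.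
move=> ab [cK ch dK] Gh.
have mh : measurable_fun `[a, b] h by exact: subspace_continuous_measurable_fun.
have mh' : measurable_fun `]a, b[ h.
  by apply: measurable_funS mh => //; apply: subset_itvW; rewrite ?lexx.
have mG' : measurable_fun `]a, b[ G.
  apply: eq_measurable_fun mh' => t; rewrite inE /= in_itv /= => ht.
  by rewrite Gh.
split.
  by apply/measurable_fun_itv_obnd_cbndP/measurable_fun_itv_bndo_bndcP.
have Gh' : {in `]a, b[, G =1 h}.
  by move=> t; rewrite in_itv /= => ht; rewrite Gh.
have mh'' : measurable_fun `]a, b[ h by [].
rewrite (eq_integral_itv_bounded _ _ mG' mh'' Gh').
have [cK1 cK2 cK3] := (continuous_within_itvP _ ab).1 cK.
rewrite (@continuous_FTC2 _ h K) //.
  split => // t; rewrite in_itv /= => ht.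
  by have := dK t ht => -[].
move=> t; rewrite in_itv /= => ht; have := dK t ht => h1.
by rewrite derive1E derive_val.
Qed.

(** * Areas swept along a regular loop *)

Definition regular_arc (x y : R -> R) (u v : R) : Prop :=
  exists dx dy : R -> R, [/\ C1_scalar x dx u v, C1_scalar y dy u v &
    forall t, u <= t <= v -> dx t != 0 \/ dy t != 0].

Record regular_loop (x y : R -> R) : Prop := RegularLoop {
  loop_regular : locally_on (regular_arc x y) 0 1;
  loop_x : x 0 = x 1;
  loop_y : y 0 = y 1;
  loop_inj : forall s t, 0 <= s < 1 -> 0 <= t < 1 -> x s = x t -> y s = y t -> s = t }.

Definition d1 (x y : R -> R) (s t : R) : R :=
  `|x t - x s| + `|y t - y s|.

(* F is an indefinite integral of x dy - y dx. *)
Definition area_prim (x y F : R -> R) (a b : R) : Prop :=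
  exists2 C : R, 0 <= C &
    forall s t, a <= s <= b -> a <= t <= b ->
      `|F t - F s - (x s * (y t - y s) - y s * (x t - x s))| <= C * (t - s) ^+ 2.

Lemma area_primB (x y K J : R -> R) (a b : R) :
  prim x y K a b -> prim y x J a b -> area_prim x y (fun t => K t - J t) a b.
Proof.
move=> [C C0 H] [D D0 H']; exists (C + D); first exact: addr_ge0.
move=> s t hs ht.
have -> : K t - J t - (K s - J s) - (x s * (y t - y s) - y s * (x t - x s)) =
  (K t - K s - x s * (y t - y s)) - (J t - J s - y s * (x t - x s)) by ring.
by rewrite mulrDl (le_trans (ler_normB _ _)) // lerD ?H ?H'.
Qed.

Lemma area_prim_sub (x y K : R -> R) (a b a' b' : R) :
  a <= a' -> b' <= b -> area_prim x y K a b -> area_prim x y K a' b'.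
Proof.
move=> aa bb [L L0 H]; exists L => // s t /andP[h1 h2] /andP[h3 h4].
by apply: H; rewrite ?(le_trans aa) ?(le_trans _ bb).
Qed.

Lemma regular_loop_lipx (x y : R -> R) :
  regular_loop x y -> lip x 0 1.
Proof.
move=> [H _ _ _]; apply: locally_C1_lip ltr01 _.
by apply: locally_on_impl H => u v _ _ _ [dx [dy [h1 _ _]]]; exists dx.
Qed.

Lemma regular_loop_lipy (x y : R -> R) :
  regular_loop x y -> lip y 0 1.
Proof.
move=> [H _ _ _]; apply: locally_C1_lip ltr01 _.
by apply: locally_on_impl H => u v _ _ _ [dx [dy [_ h1 _]]]; exists dy.
Qed.

Lemma regular_loop_continuous (x y : R -> R) : regular_loop x y ->
  {within `[0, 1], continuous x} /\ {within `[0, 1], continuous y}.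
Proof.
move=> J; split; apply: lip_continuous; [exact: regular_loop_lipx J|exact: regular_loop_lipy J].
Qed.

Lemma locally_quadratic_cst (G : R -> R) (a b : R) : a < b ->
  (forall t0, a <= t0 <= b -> exists d C, [/\ 0 < d, 0 <= C &
     forall t, a <= t <= b -> `|t - t0| < d -> `|G t - G t0| <= C * (t - t0) ^+ 2]) ->
  G a = G b.
Proof.
move=> ab H.
have key e : 0 < e -> `|G b - G a| <= e * (b - a).
  move=> e0; apply: (@interval_induction (fun u v => `|G v - G u| <= e * (v - u))) => //.
    move=> u w v _ uw wv _ h1 h2.
    have -> : G v - G u = (G w - G u) + (G v - G w) by ring.
    by rewrite (le_trans (ler_normD _ _)) //; move: h1 h2; lra.
  apply: locally_on_near => s hs; have [d [C [d0 C0 Hd]]] := H s hs.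
  exists (Num.min d (e / (C + 1))); first by rewrite lt_min d0 divr_gt0 // ltr_pwDr.
  move=> t ht; rewrite lt_min => /andP[td]; rewrite ltr_pdivlMr ?ltr_pwDr // => te.
  have Gt : `|G t - G s| <= e * `|t - s|.
    apply: (le_trans (Hd t ht td)).
    rewrite -[(t - s) ^+ 2]real_normK ?num_real // expr2 mulrA ler_wpM2r //.
    by apply: le_trans (ltW te); rewrite mulrC ler_wpM2l // lerDl.
  split=> st; first by rewrite -(gtr0_norm (_ : 0 < t - s)) ?subr_gt0.
  by rewrite -(gtr0_norm (_ : 0 < s - t)) ?subr_gt0 // distrC [`|s - t|]distrC.
apply/eqP; rewrite eq_sym -subr_eq0 -normr_le0; apply/ler_addgt0Pl => e e0.
rewrite addr0; have := key (e / (b - a)); rewrite divfK ?gt_eqF ?subr_gt0 //.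
by apply; rewrite divr_gt0 // subr_gt0.
Qed.

Lemma area_prim_uniq (x y F G : R -> R) (a b : R) : a < b ->
  area_prim x y F a b -> area_prim x y G a b -> F b - F a = G b - G a.
Proof.
move=> ab [C C0 HC] [D D0 HD].
have : F a - G a = F b - G b; last by lra.
apply: (@locally_quadratic_cst (fun t => F t - G t)) => // s hs.
exists 1, (C + D); split; [by []|exact: addr_ge0|move=> t ht _].
have -> : F t - G t - (F s - G s) = (F t - F s - (x s * (y t - y s) - y s * (x t - x s)))
   - (G t - G s - (x s * (y t - y s) - y s * (x t - x s))) by ring.
by rewrite mulrDl (le_trans (ler_normB _ _)) // lerD ?HC ?HD.
Qed.

(** Near [s] the derivative keeps at least half its size, whence the factor 2. *)
Lemma C1_expanding (x dx : R -> R) (u v s : R) : u < v ->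
  C1_scalar x dx u v -> u <= s <= v -> dx s != 0 ->
  exists2 d, 0 < d & forall t, u <= t <= v -> `|t - s| < d ->
    `|t - s| <= 2 / `|dx s| * `|x t - x s|.
Proof.
move=> uv Hx hs dxs; have [cx cdx dxx] := Hx.
have n0 : 0 < `|dx s| by rewrite normr_gt0.
have [d d0 Hd] := within_itv_eps cdx hs (divr_gt0 n0 (ltr0n _ 2)).
exists d => // t ht td; rewrite mulrAC ler_pdivlMr //.
have key p q : u <= p -> p < q -> q <= v -> `|p - s| < d -> `|q - s| < d ->
    (q - p) * `|dx s| <= 2 * `|x q - x p|.
  move=> up pq qv; rewrite !ltr_norml => /andP[h1 h2] /andP[h3 h4].
  have [r /andP[pr rq] ->] := C1_scalar_MVT pq (C1_scalar_sub up qv Hx).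
  rewrite normrM (ger0_norm (_ : 0 <= q - p)); last by lra.
  have : `|dx r - dx s| < `|dx s| / 2 by apply: Hd; rewrite ?ltr_norml; lra.
  have : `|dx s| <= `|dx r| + `|dx s - dx r|.
    by rewrite (le_trans _ (ler_normD _ _)) // addrC subrK.
  rewrite distrC => h5 h6.
  have : (q - p) * `|dx s| <= (q - p) * (2 * `|dx r|) by rewrite ler_wpM2l; lra.
  by lra.
case/andP: (hs) => us sv; case/andP: (ht) => ut tv.
have [st|ts|<-] := ltgtP s t; last by rewrite subrr normr0 mul0r mulr_ge0.
  rewrite (ger0_norm (_ : 0 <= t - s)); last by lra.
  by apply: key; rewrite // subrr normr0.
rewrite distrC [in leRHS]distrC (ger0_norm (_ : 0 <= s - t)); last by lra.
by apply: key; rewrite // subrr normr0.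
Qed.

Lemma regular_arc_expanding (x y : R -> R) (u v s : R) : u < v ->
  regular_arc x y u v -> u <= s <= v ->
  exists d C, [/\ 0 < d, 0 <= C & forall t, u <= t <= v -> `|t - s| < d ->
    `|t - s| <= C * d1 x y s t].
Proof.
move=> uv [dx [dy [Hx Hy H]]] hs.
have [h|h] := H s hs.
  have [d d0 Hd] := C1_expanding uv Hx hs h.
  exists d, (2 / `|dx s|); split => // t ht td; apply: (le_trans (Hd t ht td)).
  by rewrite ler_wpM2l // lerDl.
have [d d0 Hd] := C1_expanding uv Hy hs h.
exists d, (2 / `|dy s|); split => // t ht td; apply: (le_trans (Hd t ht td)).
by rewrite ler_wpM2l // lerDr.
Qed.

Lemma arc_away (x y : R -> R) (u v p q : R) :
  {within `[u, v], continuous x} -> {within `[u, v], continuous y} ->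
  (forall t, u <= t <= v -> x t = p -> y t = q -> False) ->
  exists2 e, 0 < e & forall t, u <= t <= v -> e <= `|x t - p| + `|y t - q|.
Proof.
move=> cx cy H; have [uv|vu] := leP u v; last first.
  by exists 1 => // t /andP[h1 h2]; have := le_trans h1 h2; rewrite leNgt vu.
have [|c] := @EVT_min _ (fun t => `|x t - p| + `|y t - q|) _ _ uv.
  apply/subspace_continuousP => t ht; apply: cvgD; apply: cvg_norm.
    by apply: cvgB; [move/subspace_continuousP: cx; apply|exact: cvg_cst].
  by apply: cvgB; [move/subspace_continuousP: cy; apply|exact: cvg_cst].
rewrite in_itv /= => hc Hc; exists (`|x c - p| + `|y c - q|).
  rewrite lt_neqAle addr_ge0 // andbT eq_sym paddr_eq0 // !normr_eq0 !subr_eq0.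
  by apply/negP => /andP[/eqP h1 /eqP h2]; exact: H hc h1 h2.
by move=> t ht; apply: Hc; rewrite in_itv.
Qed.

(** By compactness and injectivity, parameters not close to [s0] stay at a positive distance from
    its point; for [s0 = 0] those close to 1 are excepted as well, because the loop closes there. *)
Lemma loop_isolated (x y : R -> R) (s0 d : R) :
  regular_loop x y -> 0 <= s0 < 1 -> 0 < d ->
  exists2 e, 0 < e & forall t, 0 <= t <= 1 -> d1 x y s0 t < e ->
    `|t - s0| < d \/ s0 = 0 /\ 1 - d < t.
Proof.
move=> J s01 d0; have [_ Jx Jy Jinj] := J.
have away a b : 0 <= a -> b <= 1 -> (forall t, a <= t <= b -> t <> s0 /\ (s0 = 0 -> t <> 1)) ->
    exists2 e, 0 < e & forall t, a <= t <= b -> e <= d1 x y s0 t.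
  move=> a0 b1 ne; have sub : `[a, b]%classic `<=` `[0, 1]%classic.
    by move=> t /=; rewrite !in_itv /= => /andP[h1 h2]; rewrite (le_trans a0) // (le_trans h2).
  apply: (@arc_away x y a b (x s0) (y s0)).
  - exact: continuous_subspaceW sub (regular_loop_continuous J).1.
  - exact: continuous_subspaceW sub (regular_loop_continuous J).2.
  move=> t ht ex ey; have [n0 n1] := ne t ht; case/andP: ht => at_ tb.
  have := le_trans tb b1; rewrite le_eqVlt => /predU1P[t1|t1].
    apply: (n1 _ t1); apply/esym; apply: Jinj; rewrite ?lexx ?ltr01 // ?Jx ?Jy -t1 //.
  by apply: n0; apply: Jinj; rewrite // (le_trans a0).
case/andP: (s01) => s00 s0lt; clear J Jx Jy Jinj s01.
have [||e e0 He] := away 0 (s0 - d) (lexx _); first by lra.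
  by move=> t ht; split; lra.
(* At the base point the interval must stop before 1, where the loop returns to its start. *)
have [|||e' e0' He'] := away (s0 + d) (if s0 == 0 then 1 - d else 1).
- lra.
- by case: ifP; lra.
- by move=> t; case: eqP => z ht; split; lra.
exists (Num.min e e'); first by rewrite lt_min e0.
move=> t ht; rewrite lt_min ltr_distl => /andP[h h'].
have [c|c] := ltP (s0 - d) t; last by have := He t ltac:(lra); rewrite leNgt h.
have [c'|c'] := ltP t (s0 + d); first by left.
move: He' => /(_ t); rewrite [_ <= d1 _ _ _ _]leNgt h'.
case: eqP => z H; last by have := H ltac:(lra).
have [c2|c2] := ltP (1 - d) t; first by right.
by have := H ltac:(lra).
Qed.

(* The second case is that of the base point, where s may be close to 1. *)
Lemma loop_chord_arc (x y : R -> R) (s0 : R) :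
  regular_loop x y -> 0 <= s0 < 1 ->
  exists e C, [/\ 0 < e, 0 <= C & forall s, 0 <= s < 1 -> d1 x y s0 s < e ->
    `|s - s0| <= C * d1 x y s0 s \/ s0 = 0 /\ `|1 - s| <= C * d1 x y s0 s].
Proof.
move=> J s01; have [Jreg Jx Jy _] := J; case/andP: (s01) => s00 s0lt.
have [v [sv v1 Hv]] := (Jreg s0).1 s01.
have [d [C [d0 C0 Hd]]] := @regular_arc_expanding x y s0 v s0 sv
  (Hv v ltac:(by rewrite sv lexx)) ltac:(by rewrite lexx ltW).
(* The parameter from which the loop is followed backwards: there the base point is read as 1. *)
pose s1 := if s0 == 0 then 1 else s0.
have s1r : 0 < s1 <= 1 by rewrite /s1; case: eqP => z; [rewrite ltr01 lexx|lra].
have d1E s : d1 x y s1 s = d1 x y s0 s.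
  by rewrite /s1; case: eqP => // ->; rewrite /d1 Jx Jy.
have [u [u0 us Hu]] := (Jreg s1).2 s1r.
have [d' [C' [d0' C0' Hd']]] := @regular_arc_expanding x y u s1 s1 us
  (Hu u ltac:(by rewrite us lexx)) ltac:(by rewrite lexx ltW).
pose m := Num.min (Num.min d d') (Num.min (v - s0) (s1 - u)).
have m0 : 0 < m by rewrite !lt_min d0 d0' !subr_gt0 sv us.
have [md [md' [mv mu]]] : m <= d /\ m <= d' /\ m <= v - s0 /\ m <= s1 - u.
  by rewrite !ge_min !lexx !orbT.
have [e e0 He] := loop_isolated J s01 m0.
exists e, (C + C'); split=> [//||s /andP[s0' s1'] hs]; first exact: addr_ge0.
have dd : 0 <= d1 x y s0 s by rewrite addr_ge0.
have right : s0 <= s -> s - s0 < m -> `|s - s0| <= (C + C') * d1 x y s0 s.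
  move=> h1 h2; apply: (le_trans (Hd s _ _)); rewrite ?ger0_norm ?subr_ge0 //.
  - by rewrite h1; move: h2 mv; clear; lra.
  - exact: lt_le_trans h2 md.
  - by rewrite ler_wpM2r // lerDl.
have left_ : s <= s1 -> s1 - s < m -> `|s1 - s| <= (C + C') * d1 x y s0 s.
  move=> h1 h2; rewrite -d1E distrC; apply: (le_trans (Hd' s _ _)).
  - by rewrite h1 andbT; move: h2 mu; clear; lra.
  - by rewrite distrC ger0_norm ?subr_ge0 // (lt_le_trans h2).
  - by rewrite ler_wpM2r ?d1E // lerDr.
have sr : 0 <= s <= 1 by rewrite s0' ltW.
have [|[z h]] := He s sr hs; last first.
  right; split => //; move: left_; rewrite /s1 z eqxx; apply; first exact: ltW.
  by move: h; clear; lra.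
rewrite ltr_distl => /andP[h1 h2].
have [ss|ss] := leP s0 s; first by left; apply: right => //; move: h2; clear; lra.
left; rewrite distrC; move: left_; rewrite /s1; case: eqP => z.
  by move: ss s0'; rewrite z ltNge => /negP.
by apply; [exact: ltW|move: h1; clear; lra].
Qed.

(* Twice the area swept by the position vector along the loop, from parameter
   u forward to parameter v. *)
Definition sweep (F : R -> R) (u v : R) : R :=
  F v - F u + (if v < u then F 1 - F 0 else 0).

Lemma sweep_sym (F : R -> R) (u v : R) : u != v ->
  sweep F u v + sweep F v u = F 1 - F 0.
Proof. by rewrite /sweep; case: ltgtP => // _ _; ring. Qed.

(** The increments of [F] cancel, so only the passages through the base point are counted: one if
    [u], [v], [w] are in forward cyclic order, two otherwise. *)
Lemma sweep_triangle (F : R -> R) (u v w : R) :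
  u != v -> v != w -> w != u ->
  sweep F u v + sweep F v w + sweep F w u = F 1 - F 0 \/
  sweep F u v + sweep F v w + sweep F w u = 2 * (F 1 - F 0).
Proof.
rewrite /sweep; case: (ltgtP v u) => // vu _; case: (ltgtP w v) => // wv _;
case: (ltgtP u w) => // uw _; try (by left; ring); try (by right; ring).
- by have := lt_trans vu (lt_trans uw wv); rewrite ltxx.
- by have := lt_trans vu (lt_trans wv uw); rewrite ltxx.
Qed.

(* r is a Lipschitz path on the loop, u t the parameter in [0, 1[ of r t, and
   W the indefinite integral of r.1 dr.2 - r.2 dr.1. *)
Record path_on (x y : R -> R) (rx ry u W : R -> R) (a b : R) : Prop :=
  PathOn {
    path_lipx : lip rx a b;
    path_lipy : lip ry a b;
    path_range : forall t, a <= t <= b -> 0 <= u t < 1;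
    path_x : forall t, a <= t <= b -> x (u t) = rx t;
    path_y : forall t, a <= t <= b -> y (u t) = ry t;
    path_prim : area_prim rx ry W a b }.

Lemma path_on_sub (x y rx ry u W : R -> R) (a b a' b' : R) :
  a <= a' -> b' <= b -> path_on x y rx ry u W a b -> path_on x y rx ry u W a' b'.
Proof.
move=> aa bb [h1 h2 h3 h4 h5 h6].
have sub t : a' <= t <= b' -> a <= t <= b by move=> /andP[h h']; lra.
split; [exact: lip_sub h1|exact: lip_sub h2| | | |exact: area_prim_sub h6];
  by move=> t /sub; auto.
Qed.

(* k tells whether the parameter jumps by one turn between t0 and t. *)
Lemma path_local (x y F rx ry u W : R -> R) (a b t0 : R) :
  regular_loop x y -> area_prim x y F 0 1 ->
  path_on x y rx ry u W a b -> a <= t0 <= b ->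
  exists d C, [/\ 0 < d, 0 <= C & forall t, a <= t <= b -> `|t - t0| < d ->
    exists k : bool, [/\ k -> u t0 = 0,
      `|u t - k%:R - u t0| <= C * `|t - t0| &
      `|F (u t) - (if k then F 1 - F 0 else 0) - F (u t0) - (W t - W t0)| <= C * (t - t0) ^+ 2]].
Proof.
move=> J [D D0 HD] [[L L0 HL] [M M0 HM] Hu Hx Hy [E E0 HE]] h0.
have [e [C [e0 C0 HC]]] := loop_chord_arc J (Hu t0 h0).
have [_ Jx Jy _] := J.
(* The chord-arc constant times the l1 speed of [r]: a bound for the speed of the parameter, up to a
   full turn. *)
pose B := C * (L + M).
have B0 : 0 <= B by rewrite mulr_ge0 // addr_ge0.
have LM : 0 < L + M + 1 by lra.
exists (e / (L + M + 1)), (B + D * B ^+ 2 + E); split; first exact: divr_gt0.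
  by rewrite !addr_ge0 // mulr_ge0 // sqr_ge0.
move=> t ht; rewrite ltr_pdivlMr // => td.
have dd : d1 x y (u t0) (u t) <= (L + M) * `|t - t0|.
  by rewrite /d1 !Hx // !Hy // mulrDl lerD ?HL ?HM.
have n0 : 0 <= `|t - t0| by [].
have {HC} := HC (u t) (Hu t ht) ltac:(nra).
have Cdd : C * d1 x y (u t0) (u t) <= B * `|t - t0|.
  by rewrite -mulrA ler_wpM2l.
have sqB p q : `|q - p| <= B * `|t - t0| -> (q - p) ^+ 2 <= B ^+ 2 * (t - t0) ^+ 2.
  move=> h; rewrite -exprMn -[leLHS]real_normK ?num_real // -[leRHS]real_normK ?num_real //.
  by rewrite lerXn2r ?nnegrE // normrM (ger0_norm B0).
have T0 : 0 <= (t - t0) ^+ 2 by exact: sqr_ge0.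
have X1 : B * `|t - t0| <= (B + D * B ^+ 2 + E) * `|t - t0|.
  by rewrite ler_wpM2r // -addrA lerDl addr_ge0 // mulr_ge0 // sqr_ge0.
have X2 p q : `|p| <= D * (B ^+ 2 * (t - t0) ^+ 2) -> `|q| <= E * (t - t0) ^+ 2 ->
    `|p - q| <= (B + D * B ^+ 2 + E) * (t - t0) ^+ 2.
  move=> h1 h2; rewrite (le_trans (ler_normB _ _)) // (le_trans (lerD h1 h2)) //.
  by have := mulr_ge0 B0 T0; rewrite !mulrDl mulrA; lra.
have HEt := HE t0 t h0 ht.
have hu0 := Hu t0 h0; have hu := Hu t ht.
have uI (q : R) : 0 <= q < 1 -> 0 <= q <= 1 by move=> /andP[-> /ltW].
move=> [h|[u0 h]].
- exists false; rewrite !subr0; split => //; first by apply: le_trans X1; apply: le_trans Cdd.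
  set z := rx t0 * (ry t - ry t0) - ry t0 * (rx t - rx t0).
  have -> : F (u t) - F (u t0) - (W t - W t0) =
     (F (u t) - F (u t0) - z) - (W t - W t0 - z) by ring.
  apply: X2 => //; rewrite /z -!Hx // -!Hy //.
  apply: (le_trans (HD (u t0) (u t) (uI _ hu0) (uI _ hu))).
  by rewrite ler_wpM2l // sqB // (le_trans h).
- exists true; split => //=.
    rewrite u0 subr0 distrC; apply: le_trans X1; exact: le_trans Cdd.
  set z := rx t0 * (ry t - ry t0) - ry t0 * (rx t - rx t0).
  have -> : F (u t) - (F 1 - F 0) - F (u t0) - (W t - W t0) =
     (F (u t) - F 1 - z) - (W t - W t0 - z) by rewrite u0; ring.
  apply: X2 => //; rewrite /z -!Hx // -!Hy // u0 Jx Jy.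
  apply: (le_trans (HD 1 (u t) (ltac:(by rewrite ler01 lexx)) (uI _ hu))).
  by rewrite ler_wpM2l // sqB // distrC (le_trans h).
Qed.

(** By [path_local] the difference between [sweep] and the areas swept by the two points changes by
    a quadratic amount near each time, hence is constant. A jump of a parameter by one turn is
    absorbed by the conditional term of [sweep]. *)
Lemma sweep_increment (x y F rx ry u W sx sy v V : R -> R) (a b : R) :
  a < b -> regular_loop x y -> area_prim x y F 0 1 ->
  path_on x y rx ry u W a b -> path_on x y sx sy v V a b ->
  (forall t, a <= t <= b -> u t != v t) ->
  sweep F (u b) (v b) - sweep F (u a) (v a) = (V b - V a) - (W b - W a).
Proof.
move=> ab J HF Hr Hs uv.
have : sweep F (u a) (v a) - (V a - W a) = sweep F (u b) (v b) - (V b - W b); last by lra.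
apply: (@locally_quadratic_cst (fun t => sweep F (u t) (v t) - (V t - W t))) => // t0 h0.
have [d [C [d0 C0 Hd]]] := path_local J HF Hr h0.
have [d' [C' [d0' C0' Hd']]] := path_local J HF Hs h0.
have uv0 : 0 < `|u t0 - v t0| by rewrite normr_gt0 subr_eq0 uv.
have ut0 := path_range Hr h0; have vt0 := path_range Hs h0.
have uv1 : `|u t0 - v t0| < 1 by rewrite ltr_norml; lra.
(* If each of the two parameters, corrected by its turn, moves by less than [g], they neither meet
   nor get a full turn apart. *)
pose g := Num.min (`|u t0 - v t0| / 2) ((1 - `|u t0 - v t0|) / 2).
have g0 : 0 < g by rewrite lt_min; lra.
have CC : 0 < C + C' + 1 by lra.
exists (Num.min (Num.min d d') (g / (C + C' + 1))), (C + C'); split.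
- by rewrite !lt_min d0 d0' divr_gt0.
- exact: addr_ge0.
move=> t ht; rewrite !lt_min ltr_pdivlMr // => /andP[/andP[td td'] tg].
have [k [k1 k2 k3]] := Hd t ht td; have [l [l1 l2 l3]] := Hd' t ht td'.
have n0 : 0 <= `|t - t0| by [].
have k4 : `|u t - k%:R - u t0| < g by apply: (le_lt_trans k2); nra.
have l4 : `|v t - l%:R - v t0| < g by apply: (le_lt_trans l2); nra.
have ut := path_range Hr ht; have vt := path_range Hs ht.
have -> : sweep F (u t) (v t) - (V t - W t) - (sweep F (u t0) (v t0) - (V t0 - W t0)) =
   (F (v t) - (if l then F 1 - F 0 else 0) - F (v t0) - (V t - V t0))
   - (F (u t) - (if k then F 1 - F 0 else 0) - F (u t0) - (W t - W t0)).
  (* A single jump occurs at parameter 0 and reverses the order of the two parameters; without a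
     jump the order is kept. Both cannot jump, as both would be 0 at time [t0]. *)
  have : (if v t < u t then F 1 - F 0 else 0) - (if v t0 < u t0 then F 1 - F 0 else 0) =
     (if k then F 1 - F 0 else 0) - (if l then F 1 - F 0 else 0) :> R.
    have g1 : g <= `|u t0 - v t0| / 2 by rewrite ge_min lexx.
    have g2 : g <= (1 - `|u t0 - v t0|) / 2 by rewrite ge_min lexx orbT.
    clear J HF Hr Hs Hd Hd' uv k3 l3 k2 l2 td td' tg n0 ht h0 CC g0 d0 d0' C0 C0' ab.
    move: k4 l4 g1 g2 uv0; rewrite !ltr_norml.
    have [uv0|uv0|uv0] := ltgtP (v t0) (u t0).
    - rewrite (gtr0_norm (_ : 0 < u t0 - v t0)); last by lra.
      case: k l k1 l1 => -[] k1 l1 /=; rewrite ?subr0.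
      + by have := k1 isT; lra.
      + by have := k1 isT; lra.
      + have := l1 isT; case: (ltP (v t) (u t)); lra.
      + case: (ltP (v t) (u t)); lra.
    - rewrite (ltr0_norm (_ : u t0 - v t0 < 0)); last by lra.
      case: k l k1 l1 => -[] k1 l1 /=; rewrite ?subr0.
      + by have := l1 isT; lra.
      + have := k1 isT; case: (ltP (v t) (u t)); lra.
      + by have := l1 isT; lra.
      + case: (ltP (v t) (u t)); lra.
    - by rewrite uv0 subrr normr0 ltxx.
  by rewrite /sweep; lra.
rewrite mulrDl addrC (le_trans (ler_normD _ _)) // normrN; exact: lerD.
Qed.

Lemma closed_pair_area (x y F rx ry u W sx sy v V : R -> R) :
  regular_loop x y -> area_prim x y F 0 1 ->
  path_on x y rx ry u W 0 1 -> path_on x y sx sy v V 0 1 ->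
  (forall t, 0 <= t <= 1 -> u t != v t) -> u 0 = u 1 -> v 0 = v 1 ->
  V 1 - V 0 = W 1 - W 0.
Proof.
move=> J HF Hr Hs uv u01 v01.
by have := sweep_increment ltr01 J HF Hr Hs uv; rewrite u01 v01; lra.
Qed.

(** The two merging vertices cannot be compared directly, as their parameters coincide at both ends.
    Each is compared with a vertex that stays distinct from both. *)
Lemma null_pair_area
  (x y F r1x r1y u1 W1 r2x r2y u2 W2 sx sy v V : R -> R) :
  regular_loop x y -> area_prim x y F 0 1 ->
  path_on x y r1x r1y u1 W1 0 1 -> path_on x y r2x r2y u2 W2 0 1 ->
  path_on x y sx sy v V 0 1 ->
  (forall t, 0 <= t <= 1 -> u1 t != v t) -> (forall t, 0 <= t <= 1 -> u2 t != v t) ->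
  u1 0 = u2 0 -> u1 1 = u2 1 ->
  W1 1 - W1 0 = W2 1 - W2 0.
Proof.
move=> J HF H1 H2 Hs uv1 uv2 e0 e1.
have h1 := sweep_increment ltr01 J HF H1 Hs uv1.
have h2 := sweep_increment ltr01 J HF H2 Hs uv2.
by move: h1 h2; rewrite e0 e1; lra.
Qed.

(** The pairs 01 and 23 collide at time 0, the pairs 12 and 30 at time 1. Such a pair is compared
    only over the half of the path where it stays distinct, and the values of [sweep] at time 1/2
    tie the two halves together. *)
Lemma hyperbolic_area (x y F : R -> R) (rx ry u W : nat -> R -> R) :
  regular_loop x y -> area_prim x y F 0 1 ->
  (forall i, (i < 4)%N -> path_on x y (rx i) (ry i) (u i) (W i) 0 1) ->
  (forall t i j, 0 < t < 1 -> (i < j < 4)%N -> u i t != u j t) ->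
  u 0%N 0 = u 1%N 0 -> u 2%N 0 = u 3%N 0 -> u 0%N 0 != u 2%N 0 ->
  u 1%N 1 = u 2%N 1 -> u 3%N 1 = u 0%N 1 -> u 0%N 1 != u 2%N 1 ->
  let dW i := W i 1 - W i 0 in
  `|dW 0%N - dW 1%N + dW 2%N - dW 3%N| = `|F 1 - F 0|.
Proof.
move=> J HF HP Hu a01 a23 a02 b12 b30 b02 /=.
have h : (0 : R) < 1 / 2 by lra.
have h' : (1 / 2 : R) < 1 by lra.
have P i : (i < 4)%N -> path_on x y (rx i) (ry i) (u i) (W i) 0 (1 / 2).
  by move=> i4; apply: path_on_sub (HP i i4) => //; exact: ltW.
have P' i : (i < 4)%N -> path_on x y (rx i) (ry i) (u i) (W i) (1 / 2) 1.
  by move=> i4; apply: path_on_sub (HP i i4) => //; exact: ltW.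
have Hu' t i j : 0 < t < 1 -> (i < 4)%N -> (j < 4)%N -> i != j -> u i t != u j t.
  move=> ht i4 j4; case: ltngtP => // ij _.
    by apply: Hu; rewrite ?ij.
  by rewrite eq_sym; apply: Hu; rewrite ?ij.
have first i j : (i < 4)%N -> (j < 4)%N -> i != j -> u i 0 != u j 0 ->
    sweep F (u i (1/2)) (u j (1/2)) - sweep F (u i 0) (u j 0) =
    W j (1/2) - W j 0 - (W i (1/2) - W i 0).
  move=> i4 j4 ij ij0; apply: (sweep_increment h J HF (P i i4) (P j j4)) => t /andP[t0 t1].
  move: t0; rewrite le_eqVlt => /predU1P[<-//|t0]; apply: Hu' => //; lra.
have second i j : (i < 4)%N -> (j < 4)%N -> i != j -> u i 1 != u j 1 ->
    sweep F (u i 1) (u j 1) - sweep F (u i (1/2)) (u j (1/2)) =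
    W j 1 - W j (1/2) - (W i 1 - W i (1/2)).
  move=> i4 j4 ij ij0; apply: (sweep_increment h' J HF (P' i i4) (P' j j4)) => t /andP[t0 t1].
  move: t1; rewrite le_eqVlt => /predU1P[->//|t1]; apply: Hu' => //; lra.
have a12 : u 1%N 0 != u 2%N 0 by rewrite -a01.
have a13 : u 1%N 0 != u 3%N 0 by rewrite -a01 -a23.
have a03 : u 0%N 0 != u 3%N 0 by rewrite -a23.
have b01 : u 0%N 1 != u 1%N 1 by rewrite b12.
have b23 : u 2%N 1 != u 3%N 1 by rewrite b30 eq_sym.
have b13 : u 1%N 1 != u 3%N 1 by rewrite b30 b12 eq_sym.
have m01 := Hu' (1/2) 0%N 1%N ltac:(lra) isT isT isT.
have m12 := Hu' (1/2) 1%N 2%N ltac:(lra) isT isT isT.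
have m20 := Hu' (1/2) 2%N 0%N ltac:(lra) isT isT isT.
have f12 := first 1%N 2%N isT isT isT a12.
have f20 := first 2%N 0%N isT isT isT ltac:(by rewrite eq_sym).
have f13 := first 1%N 3%N isT isT isT a13.
have f30 := first 3%N 0%N isT isT isT ltac:(by rewrite eq_sym).
have f02 := first 0%N 2%N isT isT isT a02.
have s01 := second 0%N 1%N isT isT isT b01.
have s13 := second 1%N 3%N isT isT isT b13.
have s02 := second 0%N 2%N isT isT isT b02.
have s23 := second 2%N 3%N isT isT isT b23.
have symA := sweep_sym F a02.
have symB := sweep_sym F b02.
move: f12 f20 f13 f30 f02 s01 s13 s02 s23; rewrite -a23 -a01 b30 b12.
set D := (X in `|X| = _).
(* One turn or two records the cyclic order of the first three vertices at the middle of the path;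
   this decides the sign of [D]. *)
have T := sweep_triangle F m01 m12 m20.
move=> f12 f20 f13 f30 f02 s01 s13 s02 s23.
suff [->|->] : D = - (F 1 - F 0) \/ D = F 1 - F 0; [by rewrite normrN|by []|].
rewrite /D; clear - T f12 f20 f13 f30 f02 s01 s13 s02 s23 symA symB.
by case: T => T; [left|right]; lra.
Qed.

(** * The shape curve *)

Definition darea (e : R -> R * R) (t : R) : R :=
  (e t).1 * derive1 (snd \o e) t - (e t).2 * derive1 (fst \o e) t.

Lemma signed_area_has_integral (e : R -> R * R) (I : R) :
  has_integral (darea e) 0 1 I -> signed_area e = 2^-1 * I.
Proof. by move=> /has_integral_Rint h; rewrite /signed_area h. Qed.

Lemma near_open_itv (P : R -> Prop) (a b t : R) : a < t < b ->
  (forall s, a < s < b -> P s) -> \forall s \near t, P s.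
Proof.
move=> /andP[h1 h2] H; near=> s; apply: H; apply/andP; split; near: s.
  exact: lt_nbhsr.
exact: lt_nbhsl.
Unshelve. all: by end_near.
Qed.

Lemma is_derive_eq_itv (f g : R -> R) (a b t df : R) : a < t < b ->
  (forall s, a < s < b -> f s = g s) -> is_derive t 1 f df -> is_derive t 1 g df.
Proof.
move=> ht fg; apply: near_eq_is_derive.
exact: (@near_open_itv (fun s => f s = g s) a b).
Qed.

Lemma is_derive_affine (f : R -> R) (s k h df : R) :
  is_derive (s + k * h) 1 f df -> is_derive h 1 (fun t => f (s + k * t)) (k * df).
Proof.
move=> H; have H' : is_derive h 1 (fun t : R => s + k * t) k.
  by apply: is_derive_eq; rewrite /GRing.scale /=; ring.
by have := @is_derive1_comp _ f (fun t => s + k * t) h _ _ H H'; rewrite mulrC.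
Qed.

Lemma C1_scalar_affine (x dx : R -> R) (u v s k a b : R) : k != 0 ->
  (forall h, a <= h <= b -> u <= s + k * h <= v) ->
  (forall h, a < h < b -> u < s + k * h < v) ->
  C1_scalar x dx u v -> C1_scalar (fun h => x (s + k * h)) (fun h => k * dx (s + k * h)) a b.
Proof.
move=> k0 range range' [cx cdx H].
have comp (f : R -> R) : {within `[u, v], continuous f} ->
    {within `[a, b], continuous (fun h => f (s + k * h))}.
  move=> cf; apply: eps_within_itv => h e hh e0.
  have [r r0 Hr] := within_itv_eps cf (range h hh) e0.
  exists (r / `|k|) => [|t ht]; first by rewrite divr_gt0 // normr_gt0.
  rewrite ltr_pdivlMr ?normr_gt0 // => td; apply: Hr; first exact: range.
  have -> : s + k * t - (s + k * h) = (t - h) * k by ring.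
  by rewrite normrM.
split; first exact: comp.
  by have c := comp _ cdx; move=> t; exact: cvgM (cvg_cst k) (c t).
by move=> h hh; apply: is_derive_affine; exact: H (range' h hh).
Qed.

Lemma is_derive_norm2 (u v : R -> R) (t du dv : R) :
  is_derive t 1 u du -> is_derive t 1 v dv -> 0 < u t ^+ 2 + v t ^+ 2 ->
  is_derive t 1 (fun s => Num.sqrt (u s ^+ 2 + v s ^+ 2))
    ((u t * du + v t * dv) / Num.sqrt (u t ^+ 2 + v t ^+ 2)).
Proof.
move=> hu hv p0.
have h1 : is_derive t 1 (fun s => u s ^+ 2 + v s ^+ 2) (2 * (u t * du + v t * dv)).
  by apply: is_derive_eq; rewrite /GRing.scale /=; ring.
have h2 := is_derive1_sqrt p0.
have := @is_derive1_comp _ Num.sqrt (fun s => u s ^+ 2 + v s ^+ 2) t _ _ h2 h1.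
move=> /is_derive_eq; apply.
have : Num.sqrt (u t ^+ 2 + v t ^+ 2) != 0 by rewrite gt_eqF // sqrtr_gt0.
by move: (Num.sqrt _) => S S0; field.
Qed.

(** If the other coordinate has no derivative at [t], the default value of [derive1] is multiplied
    by 0. *)
Lemma darea_axis_x (e : R -> R * R) (a b t : R) : a < t < b ->
  (forall s, a < s < b -> (e s).2 = 0) -> darea e t = 0.
Proof.
move=> ht H; have h : is_derive t 1 (snd \o e) 0.
  have h0 : is_derive t 1 (cst 0 : R -> R) 0 by apply: is_derive_eq.
  by apply: is_derive_eq_itv ht _ h0 => s hs /=; rewrite H.
by rewrite /darea derive1E derive_val H // mulr0 mul0r subrr.
Qed.

Lemma darea_axis_y (e : R -> R * R) (a b t : R) : a < t < b ->
  (forall s, a < s < b -> (e s).1 = 0) -> darea e t = 0.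
Proof.
move=> ht H; have h : is_derive t 1 (fst \o e) 0.
  have h0 : is_derive t 1 (cst 0 : R -> R) 0 by apply: is_derive_eq.
  by apply: is_derive_eq_itv ht _ h0 => s hs /=; rewrite H.
by rewrite /darea derive1E [derive1 (fst \o e) t]derive1E derive_val H // mulr0 mul0r subrr.
Qed.

Lemma has_integral0 (G : R -> R) (a b : R) : a < b ->
  (forall t, a < t < b -> G t = 0) -> has_integral G a b 0.
Proof.
move=> ab H; have C : C1_scalar (cst 0 : R -> R) (cst 0) a b.
  split; [by apply: continuous_subspaceT => t; exact: cvg_cst|
          by apply: continuous_subspaceT => t; exact: cvg_cst|by move=> t _; apply: is_derive_eq].
by have := has_integral_C1 ab C H; rewrite subrr.
Qed.

(* With orthogonal u, v and delta = det(u, v) one has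
   |u|^2 <v, v'> - |v|^2 <u, u'> = delta (det(u, v') + det(v, u')),
   and |delta| = |u||v|. *)
Lemma shape_derivative (u1 u2 v1 v2 du1 du2 dv1 dv2 : R) :
  u1 * v1 + u2 * v2 = 0 -> 0 < u1 ^+ 2 + u2 ^+ 2 -> 0 < v1 ^+ 2 + v2 ^+ 2 ->
  let X := Num.sqrt (u1 ^+ 2 + u2 ^+ 2) in let Y := Num.sqrt (v1 ^+ 2 + v2 ^+ 2) in
  X * ((v1 * dv1 + v2 * dv2) / Y) - Y * ((u1 * du1 + u2 * du2) / X) =
  Num.sg (u1 * v2 - u2 * v1) * (u1 * dv2 - u2 * dv1 + (v1 * du2 - v2 * du1)).
Proof.
move=> orth u0 v0 X Y.
have X0 : 0 < X by rewrite sqrtr_gt0.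
have Y0 : 0 < Y by rewrite sqrtr_gt0.
have X2 : X ^+ 2 = u1 ^+ 2 + u2 ^+ 2 by rewrite sqr_sqrtr // ltW.
have Y2 : Y ^+ 2 = v1 ^+ 2 + v2 ^+ 2 by rewrite sqr_sqrtr // ltW.
set d := u1 * v2 - u2 * v1.
have d2 : d ^+ 2 = (X * Y) ^+ 2.
  by rewrite exprMn X2 Y2 -[LHS]addr0 -[0](expr0n R 2) -orth /d; ring.
have d0 : `|d| = X * Y.
  have XY0 : 0 <= X * Y by rewrite mulr_ge0 // ltW.
  by apply/eqP; rewrite -(@eqrXn2 _ 2) // real_normK ?num_real // d2.
have key : X ^+ 2 * (v1 * dv1 + v2 * dv2) - Y ^+ 2 * (u1 * du1 + u2 * du2) =
    d * (u1 * dv2 - u2 * dv1 + (v1 * du2 - v2 * du1)).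
  have e1 : d * u1 = X ^+ 2 * v2 - u2 * (u1 * v1 + u2 * v2) by rewrite X2 /d; ring.
  have e2 : d * u2 = u1 * (u1 * v1 + u2 * v2) - X ^+ 2 * v1 by rewrite X2 /d; ring.
  have e3 : d * v1 = v2 * (u1 * v1 + u2 * v2) - Y ^+ 2 * u2 by rewrite Y2 /d; ring.
  have e4 : d * v2 = Y ^+ 2 * u1 - v1 * (u1 * v1 + u2 * v2) by rewrite Y2 /d; ring.
  rewrite orth in e1 e2 e3 e4.
  have -> : d * (u1 * dv2 - u2 * dv1 + (v1 * du2 - v2 * du1)) =
    (d * u1) * dv2 - (d * u2) * dv1 + ((d * v1) * du2 - (d * v2) * du1) by ring.
  by rewrite e1 e2 e3 e4; ring.
have Xn : X != 0 by rewrite gt_eqF.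
have Yn : Y != 0 by rewrite gt_eqF.
have dn : d = Num.sg d * (X * Y) by rewrite -d0 -numEsg.
move: key; rewrite {1}dn; move: (Num.sg d) (X) (Y) Xn Yn => s x y xn yn key.
apply: (@mulfI _ (x * y)); first by rewrite mulf_neq0.
rewrite (mulrCA (x * y) s) mulrA -key.
by field; rewrite xn yn.
Qed.

Lemma piecewise_impl (Q T : R -> R -> Prop) (a b : R) :
  (forall u v, Q u v -> T u v) -> piecewise Q a b -> piecewise T a b.
Proof.
move=> QT [n [s [s0 sn H]]]; exists n, s; split => // i ilt.
by have [h1 h2] := H i ilt; split => //; apply: QT.
Qed.

Definition C1_curve (c : R -> R * R) (u v : R) : Prop :=
  exists dx dy : R -> R, C1_scalar (fst \o c) dx u v /\ C1_scalar (snd \o c) dy u v.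

Lemma within_fst (c : R -> R * R) (A : set R) :
  {within A, continuous c} -> {within A, continuous (fst \o c)}.
Proof.
move=> /subspace_continuousP H; apply/subspace_continuousP => t At.
by apply: (cvg_comp _ _ (H t At)); exact: cvg_fst.
Qed.

Lemma within_snd (c : R -> R * R) (A : set R) :
  {within A, continuous c} -> {within A, continuous (snd \o c)}.
Proof.
move=> /subspace_continuousP H; apply/subspace_continuousP => t At.
by apply: (cvg_comp _ _ (H t At)); exact: cvg_snd.
Qed.

Lemma C1_arc_with_scalar (c dc : R -> R * R) (u v : R) :
  C1_arc_with u v c dc ->
  C1_scalar (fst \o c) (fst \o dc) u v /\ C1_scalar (snd \o c) (snd \o dc) u v.
Proof.
move=> [cc cdc H]; split; split; try exact: within_fst; try exact: within_snd;
  by move=> t ht; have [] := H t ht.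
Qed.

Lemma C1_arc_curve (c : R -> R * R) (u v : R) :
  C1_arc c u v -> C1_curve c u v.
Proof.
by move=> [dc /C1_arc_with_scalar[h1 h2]]; exists (fst \o dc), (snd \o dc).
Qed.

Lemma smooth_arc_regular (c : R -> R * R) (u v : R) :
  smooth_arc c u v -> regular_arc (fst \o c) (snd \o c) u v.
Proof.
move=> [dc [/C1_arc_with_scalar[h1 h2] H]]; exists (fst \o dc), (snd \o dc); split => //.
move=> t /H /=; case: (dc t) => p q /=; have [->|] := eqVneq p 0; last by move=> p0 _; left.
by have [->|q0 _] := eqVneq q 0; [rewrite eqxx|right].
Qed.

Lemma piecewise_C1_locally (c : R -> R * R) (a b : R) :
  piecewise (C1_arc c) a b -> locally_on (C1_curve c) a b.
Proof.
move=> /(piecewise_impl (@C1_arc_curve c)); apply: piecewise_locally_on.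
move=> u v u' v' uu _ vv [dx [dy [h1 h2]]]; exists dx, dy.
by split; [exact: C1_scalar_sub h1|exact: C1_scalar_sub h2].
Qed.

Lemma piecewise_smooth_locally (c : R -> R * R) (a b : R) :
  piecewise (smooth_arc c) a b -> locally_on (regular_arc (fst \o c) (snd \o c)) a b.
Proof.
move=> /(piecewise_impl (@smooth_arc_regular c)); apply: piecewise_locally_on.
move=> u v u' v' uu _ vv [dx [dy [h1 h2 h3]]]; exists dx, dy.
split; [exact: C1_scalar_sub h1|exact: C1_scalar_sub h2|].
by move=> t /andP[h4 h5]; apply: h3; rewrite (le_trans uu) // (le_trans h5).
Qed.

Lemma C1_curve_lip (c : R -> R * R) (a b : R) : a < b ->
  locally_on (C1_curve c) a b -> lip (fst \o c) a b /\ lip (snd \o c) a b.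
Proof.
move=> ab H; split; apply: locally_C1_lip ab _; apply: locally_on_impl H => u v _ _ _ [dx [dy [h1 h2]]].
  by exists dx.
by exists dy.
Qed.

Lemma area_prim_C1 (x y dx dy : R -> R) (a b : R) : a < b ->
  C1_scalar x dx a b -> C1_scalar y dy a b ->
  exists J, area_prim x y J a b /\ C1_scalar J (fun t => x t * dy t - y t * dx t) a b.
Proof.
move=> ab Hx Hy.
have [J [J1 J2]] := C1_prim_exists ab Hy (C1_scalar_lip Hx).
have [K [K1 K2]] := C1_prim_exists ab Hx (C1_scalar_lip Hy).
by exists (fun t => J t - K t); split; [exact: area_primB|exact: C1_scalarB].
Qed.

Lemma area_prim_exists (c : R -> R * R) (a b : R) : a < b ->
  locally_on (C1_curve c) a b -> exists W, area_prim (fst \o c) (snd \o c) W a b.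
Proof.
move=> ab H; have [lx ly] := C1_curve_lip ab H.
have hx : locally_on (fun u v => exists dx, C1_scalar (fst \o c) dx u v) a b.
  by apply: locally_on_impl H => u v _ _ _ [dx [dy [h1 h2]]]; exists dx.
have hy : locally_on (fun u v => exists dx, C1_scalar (snd \o c) dx u v) a b.
  by apply: locally_on_impl H => u v _ _ _ [dx [dy [h1 h2]]]; exists dy.
have [J HJ] := prim_exists ab hy lx; have [K HK] := prim_exists ab hx ly.
by exists (fun t => J t - K t); exact: area_primB.
Qed.

Lemma sgr_constant (f : R -> R) (a b : R) :
  {within `[a, b], continuous f} -> (forall t, a < t < b -> f t != 0) ->
  forall s t, a < s < b -> a < t < b -> Num.sg (f s) = Num.sg (f t).
Proof.
move=> cf f0 s t.
wlog st : s t / s <= t.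
  by move=> W hs ht; have [st|/ltW ts] := leP s t; [exact: W|apply/esym/W].
move=> hs ht; case/andP: (hs) => as_ sb; case/andP: (ht) => at_ tb.
have cst : {within `[s, t], continuous f}.
  apply: continuous_subspaceW cf => r /=; rewrite !in_itv /= => /andP[h1 h2].
  by rewrite (le_trans (ltW as_)) // (le_trans h2) // ltW.
have no0 : ~~ (Num.min (f s) (f t) <= 0 <= Num.max (f s) (f t)).
  apply/negP => /(IVT st cst)[r]; rewrite in_itv /= => /andP[h1 h2] /eqP.
  by apply/negP/f0; rewrite (lt_le_trans as_) // (le_lt_trans h2).
move: no0; rewrite ge_min le_max.
by case: (ltgtP (f s) 0) (f0 s hs) => // fs _; case: (ltgtP (f t) 0) (f0 t ht) => // ft _ _;
  rewrite ?(gtr0_sg fs) ?(ltr0_sg fs) ?(gtr0_sg ft) ?(ltr0_sg ft).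
Qed.

Lemma distE (p q : R * R) :
  dist p q = Num.sqrt ((q.1 - p.1) ^+ 2 + (q.2 - p.2) ^+ 2).
Proof. by rewrite /dist /dot /=; congr Num.sqrt; ring. Qed.

Lemma neq_sqr_dist (p q : R * R) :
  p != q -> 0 < (q.1 - p.1) ^+ 2 + (q.2 - p.2) ^+ 2.
Proof.
case: p q => [p1 p2] [q1 q2] /= pq.
rewrite lt_neqAle addr_ge0 ?sqr_ge0 // andbT eq_sym paddr_eq0 ?sqr_ge0 //.
rewrite !sqrf_eq0 !subr_eq0; apply: contra pq => /andP[/eqP -> /eqP ->].
by rewrite eqxx.
Qed.

(** The last vertex of a parallelogram is r0 + r2 - r1, and its velocity satisfies the same
    relation; inserting both turns the expression det(u, v') + det(v, u') of [shape_derivative] into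
    the alternating sum. *)
Lemma shape_darea (alpha : R -> quad R) (dx dy : 'I_4 -> R -> R) (a b t : R) :
  a < t < b -> (forall s, a < s < b -> is_rectangle (alpha s)) ->
  (forall i, is_derive t 1 (fun s => (alpha s i).1) (dx i t)) ->
  (forall i, is_derive t 1 (fun s => (alpha s i).2) (dy i t)) ->
  let r i := alpha t i in
  let h i := (r i).1 * dy i t - (r i).2 * dx i t in
  exists X' Y', [/\ is_derive t 1 (fst \o shape_curve alpha) X',
    is_derive t 1 (snd \o shape_curve alpha) Y' &
    (shape_curve alpha t).1 * Y' - (shape_curve alpha t).2 * X' =
    Num.sg (((r 1).1 - (r 0).1) * ((r 2).2 - (r 1).2) -
            ((r 1).2 - (r 0).2) * ((r 2).1 - (r 1).1)) * (h 0 - h 1 + h 2 - h 3)].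
Proof.
move=> ht rect Hx Hy r h.
have [n01 n12 par orth] := rect t ht.
have p3x s : a < s < b -> (alpha s 0).1 + (alpha s 2).1 - (alpha s 1).1 = (alpha s 3).1.
  by move=> /rect[_ _ /(congr1 fst) /= e _]; lra.
have p3y s : a < s < b -> (alpha s 0).2 + (alpha s 2).2 - (alpha s 1).2 = (alpha s 3).2.
  by move=> /rect[_ _ /(congr1 snd) /= e _]; lra.
have d3 (f : 'I_4 -> R -> R) (df : 'I_4 -> R) :
    (forall i, is_derive t 1 (f i) (df i)) ->
    (forall s, a < s < b -> f 0 s + f 2 s - f 1 s = f 3 s) ->
    df 3 = df 0 + df 2 - df 1.
  move=> Hf e; have h0 := Hf 0; have h1 := Hf 1; have h2 := Hf 2; have h3 := Hf 3.
  have h4 : is_derive t 1 (fun s => f 0 s + f 2 s - f 1 s) (df 0 + df 2 - df 1).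
    exact: is_deriveB.
  have h5 := is_derive_eq_itv ht e h4.
  by rewrite -(@derive_val _ _ _ _ _ _ _ h3) -(@derive_val _ _ _ _ _ _ _ h5).
have ex := d3 (fun i s => (alpha s i).1) (fun i => dx i t) Hx p3x.
have ey := d3 (fun i s => (alpha s i).2) (fun i => dy i t) Hy p3y.
have dB (f g : R -> R) df dg : is_derive t 1 f df -> is_derive t 1 g dg ->
    is_derive t 1 (fun s => f s - g s) (df - dg) by move=> ? ?; exact: is_deriveB.
pose u1 s := (alpha s 1).1 - (alpha s 0).1.
pose u2 s := (alpha s 1).2 - (alpha s 0).2.
pose v1 s := (alpha s 2).1 - (alpha s 1).1.
pose v2 s := (alpha s 2).2 - (alpha s 1).2.
have hu1 : is_derive t 1 u1 (dx 1 t - dx 0 t) by apply: dB.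
have hu2 : is_derive t 1 u2 (dy 1 t - dy 0 t) by apply: dB.
have hv1 : is_derive t 1 v1 (dx 2 t - dx 1 t) by apply: dB.
have hv2 : is_derive t 1 v2 (dy 2 t - dy 1 t) by apply: dB.
have u0 := neq_sqr_dist n01; have v0 := neq_sqr_dist n12.
have hX := is_derive_norm2 hu1 hu2 u0; have hY := is_derive_norm2 hv1 hv2 v0.
have EX : fst \o shape_curve alpha = (fun s => Num.sqrt (u1 s ^+ 2 + u2 s ^+ 2)).
  by apply/funext => s /=; rewrite distE.
have EY : snd \o shape_curve alpha = (fun s => Num.sqrt (v1 s ^+ 2 + v2 s ^+ 2)).
  by apply/funext => s /=; rewrite distE.
eexists; eexists; split; [rewrite EX; exact: hX|rewrite EY; exact: hY|].
rewrite /= !distE -/(u1 t) -/(u2 t) -/(v1 t) -/(v2 t) shape_derivative //.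
congr (_ * _); rewrite /h ex ey -p3x // -p3y // /u1 /u2 /v1 /v2 -/(r 0) -/(r 1) -/(r 2).
ring.
Qed.

Lemma locally_on_all (Q : 'I_4 -> R -> R -> Prop) (a b : R) :
  (forall i, locally_on (Q i) a b) -> locally_on (fun u v => forall i, Q i u v) a b.
Proof.
move=> H; have h := locally_on_and (locally_on_and (H 0) (H 1)) (locally_on_and (H 2) (H 3)).
apply: locally_on_impl h => u v _ _ _ [[h0 h1] [h2 h3]] i.
have : [|| i == 0, i == 1, i == 2 | i == 3] by case: i => -[|[|[|[|]]]].
by move=> /or4P[] /eqP ->.
Qed.

Lemma rectangle_distinct (r : quad R) (i j : 'I_4) :
  is_rectangle r -> i != j -> r i != r j.
Proof.
move=> [n01 n12 par orth].
have p1 : (r 1).1 - (r 0).1 = (r 2).1 - (r 3).1 by have := congr1 fst par.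
have p2 : (r 1).2 - (r 0).2 = (r 2).2 - (r 3).2 by have := congr1 snd par.
have q01 := neq_sqr_dist n01; have q12 := neq_sqr_dist n12.
move: orth; rewrite /dot /= => orth.
have n (p q : R * R) : 0 < (q.1 - p.1) ^+ 2 + (q.2 - p.2) ^+ 2 -> p != q.
  by move=> h; apply/eqP => e; move: h; rewrite e !subrr expr0n /= addr0 ltxx.
have n23 : r 2 != r 3.
  by apply: n; move: q01; rewrite p1 p2 -[in X in X -> _]sqrrN opprB -[((r 2).2 - _) ^+ 2]sqrrN opprB.
have e1 : (r 3).1 - (r 0).1 = (r 2).1 - (r 1).1 by lra.
have e2 : (r 3).2 - (r 0).2 = (r 2).2 - (r 1).2 by lra.
have n03 : r 0 != r 3 by apply: n; rewrite e1 e2.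
have n02 : r 0 != r 2.
  apply: n.
  have -> : (r 2).1 - (r 0).1 = ((r 1).1 - (r 0).1) + ((r 2).1 - (r 1).1) by ring.
  have -> : (r 2).2 - (r 0).2 = ((r 1).2 - (r 0).2) + ((r 2).2 - (r 1).2) by ring.
  by move: q01 q12; nra.
have n13 : r 1 != r 3.
  apply: n.
  have -> : (r 3).1 - (r 1).1 = ((r 2).1 - (r 1).1) - ((r 1).1 - (r 0).1) by lra.
  have -> : (r 3).2 - (r 1).2 = ((r 2).2 - (r 1).2) - ((r 1).2 - (r 0).2) by lra.
  by move: q01 q12; nra.
have all4 (k : 'I_4) : [|| k == 0, k == 1, k == 2 | k == 3] by case: k => -[|[|[|[|]]]].
have := all4 i; have := all4 j.
by move=> /or4P[] /eqP -> /or4P[] /eqP ->; rewrite ?eqxx //= => _; rewrite // eq_sym.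
Qed.

(** The factor [l] serves both the shape curve itself ([l = 1]) and the first half of a [concat]
    ([l = 2]). Side lengths need not be C^1 up to a degenerate end, so the antiderivative of the
    integrand is built from the vertices, which are C^1 up to the ends of each piece. *)
Lemma shape_integral (alpha : R -> quad R) (W : 'I_4 -> R -> R)
    (l : R) (e : R -> R * R) : 0 < l ->
  piecewise_C1_path alpha ->
  (forall i, area_prim (fun t => (alpha t i).1) (fun t => (alpha t i).2) (W i) 0 1) ->
  (forall t, 0 < t < 1 -> is_rectangle (alpha t)) ->
  (forall t, 0 < t < l^-1 -> e t = shape_curve alpha (l * t)) ->
  exists2 sgn : R, `|sgn| = 1 &
  has_integral (darea e) 0 l^-1
    (sgn * ((W 0 1 - W 0 0) - (W 1 1 - W 1 0) + (W 2 1 - W 2 0) - (W 3 1 - W 3 0))).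
Proof.
move=> l0 pwa HW rect He.
have C1a i : locally_on (C1_curve (alpha^~ i)) 0 1 by exact: piecewise_C1_locally.
have lx i : lip (fun t => (alpha t i).1) 0 1 by have [] := C1_curve_lip ltr01 (C1a i).
have ly i : lip (fun t => (alpha t i).2) 0 1 by have [] := C1_curve_lip ltr01 (C1a i).
pose d t := ((alpha t 1).1 - (alpha t 0).1) * ((alpha t 2).2 - (alpha t 1).2) -
            ((alpha t 1).2 - (alpha t 0).2) * ((alpha t 2).1 - (alpha t 1).1).
have ld : lip d 0 1.
  by apply: lipD; [|apply: lipN]; apply: lipM; apply: lipD => //; apply: lipN.
have d0 t : 0 < t < 1 -> d t != 0.
  move=> ht; have [n01 n12 _ orth] := rect t ht.
  have q01 := neq_sqr_dist n01; have q12 := neq_sqr_dist n12.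
  apply/eqP => dt; have := mulr_gt0 q01 q12.
  (* Lagrange's identity: |u|^2 |v|^2 = det(u, v)^2 + <u, v>^2. *)
  have -> : (((alpha t 1).1 - (alpha t 0).1) ^+ 2 + ((alpha t 1).2 - (alpha t 0).2) ^+ 2) *
    (((alpha t 2).1 - (alpha t 1).1) ^+ 2 + ((alpha t 2).2 - (alpha t 1).2) ^+ 2) =
    d t ^+ 2 + dot (alpha t 1 - alpha t 0) (alpha t 2 - alpha t 1) ^+ 2.
    by rewrite /d /dot /=; ring.
  by rewrite orth dt expr0n addr0 ltxx.
have h01 : 0 < (2^-1 : R) < 1 by rewrite invr_gt0 ltr0n /= invf_lt1 // ltr1n.
(* Any interior time would do: the determinant [d] is continuous and has no zero inside, so its sign
   is constant there. *)
exists (Num.sg (d 2^-1)); first by rewrite normr_sg d0 ?h01.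
set sgn := Num.sg _.
pose K t := sgn * (W 0 t - W 1 t + W 2 t - W 3 t).
have -> : sgn * ((W 0 1 - W 0 0) - (W 1 1 - W 1 0) + (W 2 1 - W 2 0) - (W 3 1 - W 3 0)) =
  K 1 - K 0 by rewrite /K; ring.
suff : has_integral (darea e) (l^-1 * 0) (l^-1 * 1) (K 1 - K 0) by rewrite mulr0 mulr1.
apply: (@interval_induction (fun p q => has_integral (darea e) (l^-1 * p) (l^-1 * q) (K q - K p))) => //.
  move=> u w v _ uw wv _ h1 h2.
  have -> : K v - K u = (K w - K u) + (K v - K w) by ring.
  by apply: has_integral_cat h1 h2; rewrite ltr_pM2l ?invr_gt0.
apply: locally_on_impl (locally_on_all C1a) => p q p0 pq q1 Hpq.
have /choice[dd Hdd] : forall i : 'I_4, exists dxy : (R -> R) * (R -> R),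
   C1_scalar (fun t => (alpha t i).1) dxy.1 p q /\ C1_scalar (fun t => (alpha t i).2) dxy.2 p q.
  by move=> i; have [dx [dy h]] := Hpq i; exists (dx, dy).
have /choice[J HJ] : forall i : 'I_4, exists J,
    area_prim (fun t => (alpha t i).1) (fun t => (alpha t i).2) J p q /\
    C1_scalar J (fun t => (alpha t i).1 * (dd i).2 t - (alpha t i).2 * (dd i).1 t) p q.
  by move=> i; have [h1 h2] := Hdd i; exact: area_prim_C1.
have EJ i : W i q - W i p = J i q - J i p.
  by apply: (area_prim_uniq pq); [exact: area_prim_sub (HW i)|have [] := HJ i].
pose h t := sgn * (((alpha t 0).1 * (dd 0).2 t - (alpha t 0).2 * (dd 0).1 t)
                 - ((alpha t 1).1 * (dd 1).2 t - (alpha t 1).2 * (dd 1).1 t)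
                 + ((alpha t 2).1 * (dd 2).2 t - (alpha t 2).2 * (dd 2).1 t)
                 - ((alpha t 3).1 * (dd 3).2 t - (alpha t 3).2 * (dd 3).1 t)).
pose I t := sgn * (J 0 t - J 1 t + J 2 t - J 3 t).
have HI : C1_scalar I h p q := C1_scalarZ sgn
  (C1_scalarB (C1_scalarD (C1_scalarB (HJ 0).2 (HJ 1).2) (HJ 2).2) (HJ 3).2).
have pq' : l^-1 * p < l^-1 * q by rewrite ltr_pM2l ?invr_gt0.
have -> : K q - K p = I (0 + l * (l^-1 * q)) - I (0 + l * (l^-1 * p)).
  rewrite !add0r !mulrA divff ?gt_eqF // !mul1r /K /I -!mulrBr; congr (_ * _).
  by have := EJ 0; have := EJ 1; have := EJ 2; have := EJ 3; lra.
have le_pq t : (l^-1 * p <= t <= l^-1 * q) = (p <= 0 + l * t <= q).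
  by rewrite add0r ![l^-1 * _]mulrC ler_pdivrMr // ler_pdivlMr // ![t * l]mulrC.
have lt_pq t : (l^-1 * p < t < l^-1 * q) = (p < 0 + l * t < q).
  by rewrite add0r ![l^-1 * _]mulrC ltr_pdivrMr // ltr_pdivlMr // ![t * l]mulrC.
apply: (has_integral_C1 pq' (C1_scalar_affine (lt0r_neq0 l0) _ _ HI)) => t.
- by rewrite le_pq.
- by rewrite lt_pq.
rewrite lt_pq => ht.
have htl : 0 < t < l^-1.
  rewrite -[l^-1]mul1r ltr_pdivlMr // -(pmulr_rgt0 t l0) [t * l]mulrC -[l * t]add0r.
  by case/andP: ht => h1 h2; rewrite (le_lt_trans p0 h1) (lt_le_trans h2 q1).
have rect' s : p < s < q -> is_rectangle (alpha s).
  by move=> /andP[h1 h2]; apply: rect; rewrite (le_lt_trans p0 h1) (lt_le_trans h2 q1).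
have [X' [Y' [HX HY HXY]]] := @shape_darea alpha (fun i => (dd i).1) (fun i => (dd i).2)
  p q _ ht rect' (fun i => let: And3 _ _ k := (Hdd i).1 in k _ ht)
  (fun i => let: And3 _ _ k := (Hdd i).2 in k _ ht).
have EX : is_derive t 1 (fst \o e) (l * X').
  apply: (is_derive_eq_itv htl) (is_derive_affine HX) => s hs.
  by rewrite /comp He // add0r.
have EY : is_derive t 1 (snd \o e) (l * Y').
  apply: (is_derive_eq_itv htl) (is_derive_affine HY) => s hs.
  by rewrite /comp He // add0r.
rewrite /darea !derive1E (@derive_val _ _ _ _ _ _ _ EX) (@derive_val _ _ _ _ _ _ _ EY) He //.
move: HXY; rewrite /= -/(d (0 + l * t)).
have -> : Num.sg (d (0 + l * t)) = sgn.
  apply: (sgr_constant (lip_continuous ld) d0) => //.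
  by case/andP: ht => h1 h2; rewrite (le_lt_trans p0 h1) (lt_le_trans h2 q1).
by rewrite /h !add0r => HXY; rewrite -HXY; ring.
Qed.

(** * From the paths of the vertices to the signed area of the shape loop *)

Lemma dist_eq0 (p q : R * R) : dist p q = 0 -> p = q.
Proof.
move=> /eqP; rewrite distE sqrtr_eq0 => h; apply/eqP/negPn/negP => /neq_sqr_dist.
by rewrite ltNge h.
Qed.

Lemma jordan_regular_loop (P : set (R * R)) (c : R -> R * R) :
  jordan_param P c -> piecewise (smooth_arc c) 0 1 ->
  regular_loop (fst \o c) (snd \o c).
Proof.
move=> [_ c01 cinj _] pw; split; rewrite /= ?c01 //.
  exact: piecewise_smooth_locally.
move=> s t hs ht ex ey; apply: cinj => //.
by move: ex ey; case: (c s) (c t) => [? ?] [? ?] /= -> ->.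
Qed.

Lemma jordan_parameter (P : set (R * R)) (c : R -> R * R) (p : R * R) :
  jordan_param P c -> P p -> exists2 s, 0 <= s < 1 & c s = p.
Proof.
move=> [_ c01 _ ->] [s /=]; rewrite in_itv /= => /andP[s0].
rewrite le_eqVlt => /predU1P[->|s1] <-; last by exists s; rewrite // s0.
by exists 0; rewrite // lexx ltr01.
Qed.

Lemma gamma_on (P : set (R * R)) (r : quad R) (i : 'I_4) :
  Gamma P r -> P (r i).
Proof.
move=> [_ [c [s [[_ _ _ ->] hs _ ->]]]]; exists (s i) => //=.
by rewrite in_itv /=; case/andP: (hs i) => -> /ltW ->.
Qed.

Lemma degenerate_on (P : set (R * R)) (r : quad R) (i : 'I_4) :
  degenerate_at_diameter P r -> P (r i).
Proof.
have : [|| i == 0, i == 1, i == 2 | i == 3] by case: i => -[|[|[|[|]]]].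
by move=> /or4P[] /eqP -> [[e1 e2 [p0 p2 _ _ _]]|[e1 e2 [p0 p2 _ _ _]]];
  rewrite -?e1 // ?e1 // -?e2 // ?e2.
Qed.

Lemma degenerate_x (P : set (R * R)) (r : quad R) :
  degenerate_at_diameter P r -> dist (r 0) (r 1) = 0 ->
  [/\ r 0 = r 1, r 2 = r 3 & r 0 <> r 2].
Proof.
move=> [[e1 e2 [_ _ /eqP n _ _]]|[e1 e2 [_ _ /eqP n _ _]]] /dist_eq0 e //.
by case: n; rewrite e e1.
Qed.

Lemma degenerate_y (P : set (R * R)) (r : quad R) :
  degenerate_at_diameter P r -> dist (r 1) (r 2) = 0 ->
  [/\ r 1 = r 2, r 3 = r 0 & r 0 <> r 2].
Proof.
move=> [[e1 e2 [_ _ /eqP n _ _]]|[e1 e2 [_ _ /eqP n _ _]]] /dist_eq0 e //.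
by case: n; rewrite e1 e.
Qed.

Lemma axis_has_integral0 (e : R -> R * R) (a b : R) : a < b ->
  (forall s, a < s < b -> (e s).2 = 0) \/ (forall s, a < s < b -> (e s).1 = 0) ->
  has_integral (darea e) a b 0.
Proof.
move=> ab [H|H]; apply: has_integral0 => // t ht.
  exact: darea_axis_x ht H.
exact: darea_axis_y ht H.
Qed.

Lemma invr2_itv : 0 < (2^-1 : R) < 1.
Proof. by rewrite invr_gt0 ltr0n /= invf_lt1 // ltr1n. Qed.

Lemma concat_axis_integral (z d : R -> R * R) (I : R) :
  has_integral (darea (concat z d)) 0 2^-1 I ->
  (forall s, 0 < s < 2^-1 -> (d s).2 = 0) \/ (forall s, 0 < s < 2^-1 -> (d s).1 = 0) ->
  (forall s, 2^-1 < s < 1 -> (d s).2 = 0) \/ (forall s, 2^-1 < s < 1 -> (d s).1 = 0) ->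
  has_integral (darea (concat z d)) 0 1 I.
Proof.
move=> H H1 H2; case/andP: invr2_itv => i0 i1.
have E s : 2^-1 < s -> concat z d s = d (2 * s - 1).
  by rewrite /concat; case: leP.
(* The time at which [2 * s - 1] reaches [2^-1], where [d], if it is itself a [concat], passes from
   one axis to the other. *)
pose m : R := 2^-1 + 2^-1 / 2.
have k1 : has_integral (darea (concat z d)) 2^-1 m 0.
  apply: axis_has_integral0; first by rewrite /m; lra.
  by case: H1 => H1; [left|right] => s /andP[s1 s2]; rewrite E // H1 //; move: s2; rewrite /m; lra.
have k2 : has_integral (darea (concat z d)) m 1 0.
  apply: axis_has_integral0; first by rewrite /m; lra.
  case: H2 => H2; [left|right] => s /andP[]; rewrite /m => s1 s2.
    by rewrite E ?H2 //; lra.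
  by rewrite E ?H2 //; lra.
have k3 : has_integral (darea (concat z d)) 2^-1 1 (0 + 0).
  by apply: has_integral_cat k1 k2; rewrite /m; lra.
by have := has_integral_cat i0 i1 H k3; rewrite !addr0.
Qed.

Lemma segment_on_X_axis (p q : R * R) (s : R) :
  on_X_axis p -> on_X_axis q -> (segment p q s).2 = 0.
Proof.
rewrite /on_X_axis => p0 q0.
have -> : (segment p q s).2 = (1 - s) * p.2 + s * q.2 by [].
by rewrite p0 q0 !mulr0 addr0.
Qed.

Lemma segment_on_Y_axis (p q : R * R) (s : R) :
  on_Y_axis p -> on_Y_axis q -> (segment p q s).1 = 0.
Proof.
rewrite /on_Y_axis => p0 q0.
have -> : (segment p q s).1 = (1 - s) * p.1 + s * q.1 by [].
by rewrite p0 q0 !mulr0 addr0.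
Qed.

Lemma area_by_loop (P : set (R * R)) (alpha : R -> quad R)
    (c : R -> R * R) (F : R -> R) :
  jordan_param P c -> piecewise (smooth_arc c) 0 1 ->
  area_prim (fst \o c) (snd \o c) F 0 1 -> piecewise_C1_path alpha ->
  area (bounded_region P) = (`|F 1 - F 0| / 2)%:E ->
  [/\ hyperbolic_arc P alpha ->
        `|signed_area (hyperbolic_shape_loop alpha)|%:E = area (bounded_region P),
      null_arc P alpha -> signed_area (null_shape_loop alpha) = 0 &
      closed_loop P alpha -> signed_area (shape_curve alpha) = 0].
Proof.
move=> cP cpw HF pwa ->.
have J := jordan_regular_loop cP cpw.
have C1a i : locally_on (C1_curve (alpha^~ i)) 0 1 by exact: piecewise_C1_locally.
have /choice[W HW] : forall i : 'I_4, exists W,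
    area_prim (fun t => (alpha t i).1) (fun t => (alpha t i).2) W 0 1.
  by move=> i; exact: area_prim_exists ltr01 (C1a i).
pose D := (W 0 1 - W 0 0) - (W 1 1 - W 1 0) + (W 2 1 - W 2 0) - (W 3 1 - W 3 0).
(* Equal points have equal parameters, even at different times; the case of times 0 and 1 is what a
   closed loop requires. *)
have paths : (forall t i, 0 <= t <= 1 -> P (alpha t i)) ->
    exists u : 'I_4 -> R -> R,
      (forall i, path_on (fst \o c) (snd \o c) (fun t => (alpha t i).1)
                   (fun t => (alpha t i).2) (u i) (W i) 0 1) /\
      (forall t s i j, 0 <= t <= 1 -> 0 <= s <= 1 ->
         (u i t = u j s) <-> (alpha t i = alpha s j)).
  move=> HP.
  have /choice[u Hu] : forall i : 'I_4, exists ui : R -> R, forall t, 0 <= t <= 1 ->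
      0 <= ui t < 1 /\ c (ui t) = alpha t i.
    move=> i; have /choice[ui Hui] : forall t : R, exists s, 0 <= t <= 1 ->
        0 <= s < 1 /\ c s = alpha t i.
      move=> t; have [ht|nt] := boolP (0 <= t <= 1); last by exists 0.
      by have [s h1 h2] := jordan_parameter cP (HP t i ht); exists s.
    by exists ui.
  exists u; split=> [i|t s i j ht hs].
    have [lx ly] := C1_curve_lip ltr01 (C1a i).
    by split => // t ht; have [h1 h2] := Hu i t ht; rewrite //= h2.
  have [h1 h2] := Hu i t ht; have [h3 h4] := Hu j s hs.
  split=> e; first by rewrite -h2 -h4 e.
  by have [_ _ cinj _] := cP; apply: cinj => //; rewrite h2 h4.
have arc_on : diameter_arc P alpha -> forall t i, 0 <= t <= 1 -> P (alpha t i).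
  move=> [G d0 d1] t i /andP[]; rewrite le_eqVlt => /predU1P[<- _|t0].
    exact: (degenerate_on i d0).
  rewrite le_eqVlt => /predU1P[->|t1]; first exact: (degenerate_on i d1).
  have ht : 0 < t < 1 by rewrite t0.
  exact: (gamma_on i (G t ht)).
have half_integral (d : R -> R * R) : diameter_arc P alpha ->
    exists2 sgn : R, `|sgn| = 1 &
    has_integral (darea (concat (shape_curve alpha) d)) 0 2^-1 (sgn * D).
  move=> [G _ _]; apply: shape_integral => //.
    by move=> t /G[].
  by move=> t /andP[_ /ltW t1]; rewrite /concat t1.
have t01 : 0 <= (0 : R) <= 1 by rewrite lexx ler01.
have t11 : 0 <= (1 : R) <= 1 by rewrite lexx ler01.
split.
- move=> [arc ax].
  have [u [Hu uP]] := paths (arc_on arc).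
  have [s0 s1 HI] := half_integral
    (concat (segment (shape_curve alpha 1) 0) (segment 0 (shape_curve alpha 0))) arc.
  have {HI} HI : has_integral (darea (hyperbolic_shape_loop alpha)) 0 1 (s0 * D).
    case/andP: invr2_itv => i0 i1.
    apply: (concat_axis_integral HI).
      case: ax => -[a0 a1]; [right|left] => s /andP[_ /ltW h]; rewrite /concat h.
        exact: segment_on_Y_axis.
      exact: segment_on_X_axis.
    case: ax => -[a0 a1]; [left|right] => s /andP[h _];
      rewrite /concat (leNgt s) h.
      exact: segment_on_X_axis.
    exact: segment_on_Y_axis.
  rewrite (signed_area_has_integral HI) !normrM s1 mul1r mulrC (ger0_norm (_ : 0 <= 2^-1)) ?invr_ge0 //.
  congr (_ * _)%:E.
  have [Gm d0 d1] := arc.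
  have neq t i j : 0 < t < 1 -> i != j -> u i t != u j t.
    move=> ht ij; have [r _] := Gm t ht; apply: contra_neq (rectangle_distinct r ij).
    case/andP: ht => h1 h2; have ht' : 0 <= t <= 1 by rewrite !ltW.
    exact: (uP t t i j ht' ht').1.
  have neqE (g : nat -> 'I_4) : (forall i j, (i < j < 4)%N -> g i != g j) ->
      forall t i j, 0 < t < 1 -> (i < j < 4)%N -> u (g i) t != u (g j) t.
    by move=> gi t i j ht ij; apply: neq => //; apply: gi.
  have ueq t i j : 0 <= t <= 1 -> alpha t i = alpha t j -> u i t = u j t.
    by move=> ht; apply: (uP t t i j ht ht).2.
  have une t i j : 0 <= t <= 1 -> alpha t i <> alpha t j -> u i t != u j t.
    by move=> ht n; apply/eqP => /(uP t t i j ht ht).1.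
  have hyp (g : nat -> 'I_4) : (forall i j, (i < j < 4)%N -> g i != g j) ->
      alpha 0 (g 0%N) = alpha 0 (g 1%N) -> alpha 0 (g 2%N) = alpha 0 (g 3%N) ->
      alpha 0 (g 0%N) <> alpha 0 (g 2%N) ->
      alpha 1 (g 1%N) = alpha 1 (g 2%N) -> alpha 1 (g 3%N) = alpha 1 (g 0%N) ->
      alpha 1 (g 0%N) <> alpha 1 (g 2%N) ->
      let dW i := W (g i) 1 - W (g i) 0 in
      `|dW 0%N - dW 1%N + dW 2%N - dW 3%N| = `|F 1 - F 0|.
    move=> gi e1 e2 e3 f1 f2 f3.
    apply: (@hyperbolic_area _ _ F (fun i t => (alpha t (g i)).1)
      (fun i t => (alpha t (g i)).2) (fun i => u (g i)) (fun i => W (g i)) J HF);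
      try exact: ueq; try exact: une.
      by move=> i _; apply: Hu.
    by move=> t i j ht ij; apply: neqE.
  case: ax => -[a0 a1].
  + have [e1 e2 e3] := degenerate_y d0 a0; have [f1 f2 f3] := degenerate_x d1 a1.
    (* [hyperbolic_area] wants the first two labels to coincide at time 0. Here 1 and 2 do, so the
       labels are shifted by one, which changes the sign of the alternating sum. *)
    rewrite -(@hyp (nth 0 [:: 1; 2; 3; 0])) //=.
    * by rewrite -normrN /D; congr (Num.Def.normr _); ring.
    * by case=> [|[|[|[|i]]]] [|[|[|[|j]]]] //; rewrite ?ltnS ?ltn0 ?andbF.
    * by rewrite e2 e1; exact: nesym.
    * by rewrite -f1 -f2.
  + have [e1 e2 e3] := degenerate_x d0 a0; have [f1 f2 f3] := degenerate_y d1 a1.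
    rewrite -(@hyp (nth 0 [:: 0; 1; 2; 3])) //=.
    by case=> [|[|[|[|i]]]] [|[|[|[|j]]]] //; rewrite ?ltnS ?ltn0 ?andbF.
- move=> [arc ax].
  have [u [Hu uP]] := paths (arc_on arc).
  have [s0 s1 HI] := half_integral (segment (shape_curve alpha 1) (shape_curve alpha 0)) arc.
  have {HI} HI : has_integral (darea (null_shape_loop alpha)) 0 1 (s0 * D).
    apply: (concat_axis_integral HI).
      case: ax => -[a0 a1]; [left|right] => s _; first exact: segment_on_X_axis.
      exact: segment_on_Y_axis.
    case: ax => -[a0 a1]; [left|right] => s _; first exact: segment_on_X_axis.
    exact: segment_on_Y_axis.
  rewrite (signed_area_has_integral HI).
  suff -> : D = 0 by rewrite !mulr0.
  have [Gm d0 d1] := arc.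
  have ueq t i j : 0 <= t <= 1 -> alpha t i = alpha t j -> u i t = u j t.
    by move=> ht; apply: (uP t t i j ht ht).2.
  have neq i j : i != j -> alpha 0 i <> alpha 0 j -> alpha 1 i <> alpha 1 j ->
      forall t, 0 <= t <= 1 -> u i t != u j t.
    move=> ij n0 n1 t ht; apply/eqP => /(uP t t i j ht ht).1.
    case/andP: (ht); rewrite le_eqVlt => /predU1P[<-//|t0].
    rewrite le_eqVlt => /predU1P[->//|t1].
    by have [r _] := Gm t ltac:(by rewrite t0); apply/eqP/rectangle_distinct.
  have pair i j k : alpha 0 i = alpha 0 j -> alpha 1 i = alpha 1 j ->
      alpha 0 i <> alpha 0 k -> alpha 1 i <> alpha 1 k -> i != k -> j != k ->
      W i 1 - W i 0 = W j 1 - W j 0.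
    move=> e0 e1 n0 n1 ik jk.
    apply: (null_pair_area J HF (Hu i) (Hu j) (Hu k)); try exact: ueq.
      exact: neq.
    by apply: neq; rewrite // -?e0 -?e1.
  case: ax => -[a0 a1].
  + have [e1 e2 e3] := degenerate_y d0 a0; have [f1 f2 f3] := degenerate_y d1 a1.
    have h1 := @pair 1 2 0 e1 f1 ltac:(by rewrite e1; apply: nesym)
      ltac:(by rewrite f1; apply: nesym) isT isT.
    have h2 := @pair 3 0 2 e2 f2 ltac:(by rewrite e2) ltac:(by rewrite f2) isT isT.
    by rewrite /D; lra.
  + have [e1 e2 e3] := degenerate_x d0 a0; have [f1 f2 f3] := degenerate_x d1 a1.
    have h1 := @pair 0 1 2 e1 f1 e3 f3 isT isT.
    have h2 := @pair 2 3 0 e2 f2 (nesym e3) (nesym f3) isT isT.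
    by rewrite /D; lra.
- move=> [G a01].
  have [u [Hu uP]] := paths (fun t i ht => gamma_on i (G t ht)).
  have [||s0 s1 HI] := @shape_integral alpha W 1 (shape_curve alpha) ltr01 pwa HW.
  + by move=> t /andP[h1 h2]; have [] := G t ltac:(by rewrite !ltW).
  + by move=> t _; rewrite mul1r.
  rewrite invr1 in HI.
  rewrite (signed_area_has_integral HI).
  have pair i j : i != j -> W j 1 - W j 0 = W i 1 - W i 0.
    move=> ij; apply: (closed_pair_area J HF (Hu i) (Hu j)).
    + move=> t ht; apply/eqP => /(uP t t i j ht ht).1.
      by have [r _] := G t ht; apply/eqP/rectangle_distinct.
    + by apply: (uP 0 1 i i t01 t11).2; rewrite a01.
    + by apply: (uP 0 1 j j t01 t11).2; rewrite a01.
  by rewrite (@pair 0 1) // (@pair 2 3) //; ring.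
Qed.

(** * The density of a loop *)

(* The Riemann-Stieltjes integral of f dx over [0, 1]. *)
Definition oint (f x : R -> R) : R :=
  let K := xget (cst 0) [set K | prim f x K 0 1] in K 1 - K 0.

Lemma oint_prim (f x K : R -> R) :
  prim f x K 0 1 -> oint f x = K 1 - K 0.
Proof.
move=> HK; rewrite /oint; case: xgetP => [K' _ HK'|/(_ K)//].
exact: prim_uniq ler01 HK' HK.
Qed.

Definition ointable (x : R -> R) : Prop :=
  lip x 0 1 /\ forall f, lip f 0 1 -> exists K, prim f x K 0 1.

Lemma ointD (f g x : R -> R) : ointable x ->
  lip f 0 1 -> lip g 0 1 -> oint (fun t => f t + g t) x = oint f x + oint g x.
Proof.
move=> [_ ix] lf lg; have [K HK] := ix f lf; have [J HJ] := ix g lg.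
by rewrite (oint_prim HK) (oint_prim HJ) (oint_prim (primD HK HJ)); ring.
Qed.

Lemma ointZ (k : R) (f x : R -> R) : ointable x ->
  lip f 0 1 -> oint (fun t => k * f t) x = k * oint f x.
Proof.
move=> [_ ix] lf; have [K HK] := ix f lf.
by rewrite (oint_prim HK) (oint_prim (primZ k HK)); ring.
Qed.

Lemma oint_cst (k : R) (x : R -> R) :
  oint (fun=> k) x = k * (x 1 - x 0).
Proof. by rewrite (oint_prim (prim_cst k x 0 1)); ring. Qed.

Lemma oint_ext (f g x : R -> R) : ointable x -> lip f 0 1 ->
  (forall t, 0 <= t <= 1 -> f t = g t) -> oint f x = oint g x.
Proof.
move=> [_ ix] lf fg; have [K HK] := ix f lf.
rewrite (oint_prim HK) (@oint_prim g x K) //.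
exact: prim_ext HK.
Qed.

Lemma lip_sum (I : Type) (r : seq I) (f : I -> R -> R) (a b : R) :
  (forall i, lip (f i) a b) -> lip (fun t => \sum_(i <- r) f i t) a b.
Proof.
move=> lf; elim: r => [|i r IH].
  have -> : (fun t : R => \sum_(i <- [::]) f i t) = (fun=> 0).
    by apply/funext => t; rewrite big_nil.
  exact: lip_cst.
have -> : (fun t : R => \sum_(j <- i :: r) f j t) = (fun t => f i t + \sum_(j <- r) f j t).
  by apply/funext => t; rewrite big_cons.
exact: lipD.
Qed.

Lemma oint_sum (I : Type) (r : seq I) (f : I -> R -> R) (x : R -> R) :
  ointable x -> (forall i, lip (f i) 0 1) ->
  oint (fun t => \sum_(i <- r) f i t) x = \sum_(i <- r) oint (f i) x.
Proof.
move=> ix lf; elim: r => [|i r IH].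
  have -> : (fun t : R => \sum_(i <- [::]) f i t) = (fun=> 0).
    by apply/funext => t; rewrite big_nil.
  by rewrite big_nil oint_cst mul0r.
have -> : (fun t : R => \sum_(j <- i :: r) f j t) = (fun t => f i t + \sum_(j <- r) f j t).
  by apply/funext => t; rewrite big_cons.
by rewrite big_cons ointD ?IH //; exact: lip_sum.
Qed.

(* phi has support in [a, b] and mass m; Phi is its antiderivative. *)
Record bump (phi Phi : R -> R) (a b m : R) : Prop := Bump {
  bump_lip : exists2 L, 0 <= L & forall u v, `|phi v - phi u| <= L * `|v - u|;
  bump_prim : exists2 C, 0 <= C &
    forall u v, `|Phi v - Phi u - phi u * (v - u)| <= C * (v - u) ^+ 2;
  bump_ge0 : forall u, 0 <= phi u;
  bump_out : forall u, u <= a \/ b <= u -> phi u = 0;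
  bump_left : forall u, u <= a -> Phi u = 0;
  bump_right : forall u, b <= u -> Phi u = m }.

Section BumpTheory.
Implicit Types (phi Phi x : R -> R).

Lemma bump_widen phi Phi a b a' b' m : a' <= a -> b <= b' ->
  bump phi Phi a b m -> bump phi Phi a' b' m.
Proof.
move=> aa bb [h1 h2 h3 h4 h5 h6]; split => // u.
- by move=> [h|h]; apply: h4; [left; exact: le_trans h aa|right; exact: le_trans bb h].
- by move=> h; apply: h5; exact: le_trans h aa.
- by move=> h; apply: h6; exact: le_trans bb h.
Qed.

Lemma bump_nondecr phi Phi a b m u v : bump phi Phi a b m -> u <= v -> Phi u <= Phi v.
Proof.
move=> [_ [C C0 HC] p0 _ _ _] uv.
apply: (quadratic_incr C0 uv) => s t _ st _.
have := HC s t; rewrite ler_norml => /andP[h _].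
by have : 0 <= phi s * (t - s) by [rewrite mulr_ge0 ?subr_ge0]; move: h; lra.
Qed.

Lemma bump_range phi Phi a b m u : bump phi Phi a b m -> 0 <= Phi u <= m.
Proof.
move=> B; apply/andP; split.
  rewrite -(bump_left B (_ : Num.min u a <= a)) ?ge_min ?lexx ?orbT //.
  by apply: bump_nondecr B _; rewrite ge_min lexx.
rewrite -(bump_right B (_ : b <= Num.max u b)) ?le_max ?lexx ?orbT //.
by apply: bump_nondecr B _; rewrite le_max lexx.
Qed.

Lemma bump_mass_ge0 phi Phi a b m : bump phi Phi a b m -> 0 <= m.
Proof. by move=> B; have /andP[h1 h2] := bump_range 0 B; exact: le_trans h2. Qed.

Lemma bump_comp_lip phi Phi a b m x : bump phi Phi a b m -> lip x 0 1 ->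
  lip (fun t => phi (x t)) 0 1.
Proof. by move=> [[L L0 HL] _ _ _ _ _]; exact: lip_comp L0 HL. Qed.

Lemma bump_comp_prim phi Phi a b m x : bump phi Phi a b m -> lip x 0 1 ->
  prim (fun t => phi (x t)) x (fun t => Phi (x t)) 0 1.
Proof. by move=> [_ [C C0 HC] _ _ _ _]; exact: prim_comp C0 HC. Qed.

Lemma bump_comp_lip2 phi Phi a b m x : bump phi Phi a b m -> lip x 0 1 ->
  lip (fun t => Phi (x t)) 0 1.
Proof.
by move=> B lx; apply: prim_lip (bump_comp_prim B lx) => //; exact: bump_comp_lip B lx.
Qed.

(** By [prim_chain] the two integrals are those of Psi(y) dPhi(x) and Phi(x) dPsi(y), and a closed
    loop leaves no boundary term. *)
Lemma oint_by_parts phi Phi a b m psi Psi c d n (x y : R -> R) :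
  bump phi Phi a b m -> bump psi Psi c d n -> ointable x -> ointable y ->
  x 0 = x 1 -> y 0 = y 1 ->
  oint (fun t => Psi (y t) * phi (x t)) x = - oint (fun t => Phi (x t) * psi (y t)) y.
Proof.
move=> B D [lx ix] [ly iy] x01 y01.
have l1 := bump_comp_lip2 D ly; have l2 := bump_comp_lip B lx.
have l3 := bump_comp_lip2 B lx; have l4 := bump_comp_lip D ly.
have [K HK] := ix _ (lipM l1 l2); have [J HJ] := iy _ (lipM l3 l4).
rewrite (oint_prim HK) (oint_prim HJ).
have [C C0 HC] := bump_prim B; have [C' C0' HC'] := bump_prim D.
have HK' := prim_chain C0 HC lx l1 HK; have HJ' := prim_chain C0' HC' ly l3 HJ.
by have := prim_by_parts ler01 l1 l3 HK' HJ'; rewrite x01 y01; lra.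
Qed.

End BumpTheory.

Definition off_square (x y : R -> R) (p q r : R) : Prop :=
  forall t, 0 <= t <= 1 -> p - r <= x t <= p + r -> q - r <= y t <= q + r -> False.

(* By Green's formula w is minus the winding number of the loop about the
   square of radius r centred at (p, q). *)
Definition density_on (x y : R -> R) (p q r w : R) : Prop :=
  off_square x y p q r /\
  forall phi Phi psi Psi m n, bump phi Phi (p - r) (p + r) m ->
    bump psi Psi (q - r) (q + r) n ->
    oint (fun t => Psi (y t) * phi (x t)) x = w * m * n.

(** * Hat functions; existence and uniqueness of the density *)

Definition posp (u : R) : R := Num.max u 0.

(** The tent of height [d] over [[c - d, c + d]], written as a second difference of the positive
    part so that sums over a grid telescope. *)
Definition hat (d c u : R) : R :=
  posp (u - c + d) - 2 * posp (u - c) + posp (u - c - d).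

Definition hat_int (d c u : R) : R :=
  posp (u - c + d) ^+ 2 / 2 - posp (u - c) ^+ 2 + posp (u - c - d) ^+ 2 / 2.

Lemma posp_lip (u v : R) : `|posp v - posp u| <= `|v - u|.
Proof.
have := ler_norm (v - u); have := ler_norm (u - v); rewrite distrC ler_norml.
rewrite /posp; case: (leP u 0) => h1; case: (leP v 0) => h2 h3 h4.
all: by apply/andP; split; lra.
Qed.

Lemma posp_quad (u v : R) :
  `|posp v ^+ 2 / 2 - posp u ^+ 2 / 2 - posp u * (v - u)| <= (v - u) ^+ 2.
Proof.
have u2 := sqr_ge0 u; have v2 := sqr_ge0 v; have uv2 := sqr_ge0 (v - u).
rewrite /posp ler_norml; case: (leP u 0) => h1; case: (leP v 0) => h2.
- by rewrite expr0n /=; apply/andP; split; lra.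
- have : u * v <= 0 by rewrite mulr_le0_ge0 // ltW.
  by rewrite expr0n /= => h; apply/andP; split; lra.
- have : u * v <= 0 by rewrite mulr_ge0_le0 // ltW.
  by rewrite expr0n /= => h; apply/andP; split; lra.
- by apply/andP; split; lra.
Qed.

Lemma hat_bump (d c : R) : 0 < d ->
  bump (hat d c) (hat_int d c) (c - d) (c + d) (d ^+ 2).
Proof.
move=> d0; split.
- exists 4 => // u v; rewrite /hat.
  have h1 := posp_lip (u - c + d) (v - c + d).
  have h2 := posp_lip (u - c) (v - c).
  have h3 := posp_lip (u - c - d) (v - c - d).
  have e k : v - c + k - (u - c + k) = v - u by ring.
  rewrite e in h1; rewrite e in h3; have e0 : v - c - (u - c) = v - u by ring.
  rewrite e0 in h2; move: h1 h2 h3; rewrite !ler_norml; lra.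
- exists 4 => // u v; rewrite /hat /hat_int.
  have h1 := posp_quad (u - c + d) (v - c + d).
  have h2 := posp_quad (u - c) (v - c).
  have h3 := posp_quad (u - c - d) (v - c - d).
  have e k : v - c + k - (u - c + k) = v - u by ring.
  rewrite e in h1; rewrite e in h3; have e0 : v - c - (u - c) = v - u by ring.
  rewrite e0 in h2; move: h1 h2 h3; rewrite !ler_norml.
  move: (posp (u - c + d)) (posp (u - c)) (posp (u - c - d)) => a1 a2 a3.
  move: (posp (v - c + d)) (posp (v - c)) (posp (v - c - d)) => b1 b2 b3.
  by move: (v - u) => h; lra.
- move=> u; rewrite /hat /posp.
  by case: (leP (u - c + d) 0); case: (leP (u - c) 0); case: (leP (u - c - d) 0); lra.
- move=> u; rewrite /hat /posp.
  by case: (leP (u - c + d) 0); case: (leP (u - c) 0); case: (leP (u - c - d) 0); lra.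
- move=> u; rewrite /hat_int /posp => h.
  by case: (leP (u - c + d) 0); case: (leP (u - c) 0); case: (leP (u - c - d) 0); nra.
- move=> u; rewrite /hat_int /posp => h.
  by case: (leP (u - c + d) 0); case: (leP (u - c) 0); case: (leP (u - c - d) 0); nra.
Qed.

Lemma regular_loop_ointable (x y : R -> R) :
  regular_loop x y -> ointable x /\ ointable y.
Proof.
move=> J; have lx := regular_loop_lipx J; have ly := regular_loop_lipy J.
have [H _ _ _] := J; split; split=> // f lf; apply: prim_exists ltr01 _ lf.
  by apply: locally_on_impl H => u v _ _ _ [dx [dy [h1 _ _]]]; exists dx.
by apply: locally_on_impl H => u v _ _ _ [dx [dy [_ h1 _]]]; exists dy.
Qed.

(** The bump in [y] can be exchanged for a hat at the price of the ratio of the masses; integration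
    by parts swaps the roles of the coordinates, so the bump in [x] can be exchanged as well. This
    leaves the integral for two hats, which defines [w] after division by their masses. *)
Lemma density_exists (x y : R -> R) (p q r : R) :
  regular_loop x y -> 0 < r -> off_square x y p q r ->
  exists w, density_on x y p q r w.
Proof.
move=> J r0 off; have [ix iy] := regular_loop_ointable J; have [_ Jx Jy _] := J.
have Hp := hat_bump p r0; have Hq := hat_bump q r0.
exists (oint (fun t => hat_int r q (y t) * hat r p (x t)) x / (r ^+ 2 * r ^+ 2)).
split=> // phi Phi psi Psi m n Bphi Bpsi.
have l2 B phi' Phi' m' (b : bump phi' Phi' (p - r) (p + r) m') := bump_comp_lip2 b ix.1.
(* Where the loop has [phi' (z t)] nonzero, it is not in the square, so [v t] lies on one side of
   the support and both antiderivatives are 0 there, or both equal their masses. *)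
have step phi' Phi' psi' Psi' psi2 Psi2 (a1 b1 m' c1 d1 n' n2 : R) (z v : R -> R) :
    ointable z -> ointable v ->
    bump phi' Phi' a1 b1 m' -> bump psi' Psi' c1 d1 n' -> bump psi2 Psi2 c1 d1 n2 ->
    (forall t, 0 <= t <= 1 -> a1 <= z t <= b1 -> c1 <= v t <= d1 -> False) ->
    n2 * oint (fun t => Psi' (v t) * phi' (z t)) z =
    n' * oint (fun t => Psi2 (v t) * phi' (z t)) z.
  move=> iz iv b bb b2 off'.
  have lz := bump_comp_lip b iz.1; have lv := bump_comp_lip2 bb iv.1.
  have lv2 := bump_comp_lip2 b2 iv.1.
  rewrite -!ointZ //; try exact: lipM.
  apply: oint_ext => //; first by apply: lipM; [exact: lip_cst|exact: lipM].
  move=> t ht; rewrite !mulrA.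
  have [za|za] := leP (z t) a1; first by rewrite (bump_out b (or_introl za)) !mulr0.
  have [zb|zb] := leP b1 (z t); first by rewrite (bump_out b (or_intror zb)) !mulr0.
  have [vc|vc] := leP (v t) c1; first by rewrite (bump_left bb vc) (bump_left b2 vc) !mulr0.
  have [vd|vd] := leP d1 (v t); first by rewrite (bump_right bb vd) (bump_right b2 vd) [n2 * _]mulrC.
  by case: (off' t ht); rewrite !ltW.
have s1 := step _ _ _ _ _ _ _ _ _ _ _ _ _ x y ix iy Bphi Bpsi Hq off.
have s2 := step _ _ _ _ _ _ _ _ _ _ _ _ _ y x iy ix Hq Bphi Hp
  (fun t ht h1 h2 => off t ht h2 h1).
have e1 := oint_by_parts Bphi Hq ix iy Jx Jy.
have e2 := oint_by_parts Hp Hq ix iy Jx Jy.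
have r2 : r ^+ 2 != 0 by rewrite expf_neq0 // gt_eqF.
apply: (mulfI r2); apply: (mulfI r2); rewrite s1 mulrCA e1 mulrN s2 -mulrN -e2.
by field; rewrite gt_eqF.
Qed.

Lemma density_on_sub (x y : R -> R) (p q r p' q' r' w : R) :
  p - r <= p' - r' -> p' + r' <= p + r -> q - r <= q' - r' -> q' + r' <= q + r ->
  density_on x y p q r w -> density_on x y p' q' r' w.
Proof.
move=> h1 h2 h3 h4 [off H]; split.
  by move=> t ht /andP[? ?] /andP[? ?]; apply: (off t ht); lra.
by move=> phi Phi psi Psi m n B1 B2; apply: H; [exact: bump_widen B1|exact: bump_widen B2].
Qed.

Lemma density_on_uniq (x y : R -> R) (p q r r' w w' : R) :
  0 < r -> 0 < r' -> density_on x y p q r w -> density_on x y p q r' w' -> w = w'.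
Proof.
move=> r0 r0' H H'; pose s := Num.min r r'.
have s0 : 0 < s by rewrite lt_min r0.
have sr : s <= r by rewrite ge_min lexx.
have sr' : s <= r' by rewrite ge_min lexx orbT.
have [|||| _ K] := @density_on_sub _ _ _ _ _ p q s _ _ _ _ _ H; try lra.
have [|||| _ K'] := @density_on_sub _ _ _ _ _ p q s _ _ _ _ _ H'; try lra.
have := K _ _ _ _ _ _ (hat_bump p s0) (hat_bump q s0).
rewrite (K' _ _ _ _ _ _ (hat_bump p s0) (hat_bump q s0)) => /esym.
have s2 : s ^+ 2 != 0 by rewrite expf_neq0 // gt_eqF.
by move/(mulIf s2)/(mulIf s2).
Qed.

(** If the square is to the left or right of the loop, phi(x) vanishes along it; if above, Psi(y)
    vanishes; if below, Psi(y) is constant and dPhi(x) integrates to 0 over the closed loop. *)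
Lemma density_far (x y : R -> R) : regular_loop x y ->
  exists2 M, 0 < M & forall p q, M < `|p| \/ M < `|q| ->
    density_on x y p q 1 0.
Proof.
move=> J; have [ix iy] := regular_loop_ointable J; have [_ Jx Jy _] := J.
have [A A0 HA] := lip_bounded ix.1; have [B B0 HB] := lip_bounded iy.1.
exists (A + B + 1); first by lra.
move=> p q pq.
have out : [\/ A + 1 < p, p < - (A + 1), B + 1 < q | q < - (B + 1)].
  case: pq; rewrite ltr_normr => /orP[h|h].
  - by apply: Or41; lra.
  - by apply: Or42; lra.
  - by apply: Or43; lra.
  - by apply: Or44; lra.
have bA t : 0 <= t <= 1 -> - A <= x t <= A by move/HA; rewrite ler_norml.
have bB t : 0 <= t <= 1 -> - B <= y t <= B by move/HB; rewrite ler_norml.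
split.
  by move=> t ht h1 h2; have := bA t ht; have := bB t ht; case: out; lra.
move=> phi Phi psi Psi m n Bp Bq; rewrite !mul0r.
have lx := bump_comp_lip Bp ix.1; have ly := bump_comp_lip2 Bq iy.1.
have zero (f : R -> R) : lip f 0 1 -> (forall t, 0 <= t <= 1 -> f t = 0) -> oint f x = 0.
  move=> lf f0; rewrite (@oint_ext f (fun=> 0)) //.
  by rewrite oint_cst mul0r.
case: out => h.
- apply: zero; first exact: lipM.
  move=> t ht; rewrite (bump_out Bp) ?mulr0 //; left.
  by case/andP: (bA t ht); lra.
- apply: zero; first exact: lipM.
  move=> t ht; rewrite (bump_out Bp) ?mulr0 //; right.
  by case/andP: (bA t ht); lra.
- apply: zero; first exact: lipM.
  move=> t ht; rewrite (bump_left Bq) ?mul0r //.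
  by case/andP: (bB t ht); lra.
rewrite (@oint_ext _ (fun t => n * phi (x t))) //; first last.
- move=> t ht; rewrite (bump_right Bq) //.
  by case/andP: (bB t ht); lra.
- exact: lipM.
rewrite ointZ // (oint_prim (bump_comp_prim Bp ix.1)) Jx subrr mulr0 //.
Qed.

(** * A bound on bump integrals by the product of the masses *)

Lemma primN (f x K : R -> R) (a b : R) :
  prim f x K a b -> prim f (fun t => - x t) (fun t => - K t) a b.
Proof.
move=> [C C0 H]; exists C => // s t hs ht; rewrite -normrN.
have -> : - (- K t - - K s - f s * (- x t - - x s)) = K t - K s - f s * (x t - x s) by ring.
exact: H.
Qed.

Definition monotone_on (x : R -> R) (a b : R) : Prop :=
  (forall s t, a <= s -> s <= t -> t <= b -> x s <= x t) \/
  (forall s t, a <= s -> s <= t -> t <= b -> x t <= x s).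

(** For monotone [x] the integrand [f dx] has a constant sign, so the bounds [0 <= g <= n] can be
    integrated; the decreasing case is reduced to [- x]. *)
Lemma prim_monotone_bound (f g x K J : R -> R) (n a b : R) : a <= b ->
  prim (fun t => g t * f t) x K a b -> prim f x J a b ->
  (forall t, a <= t <= b -> 0 <= f t) -> (forall t, a <= t <= b -> 0 <= g t <= n) ->
  monotone_on x a b -> `|K b - K a| <= n * `|J b - J a|.
Proof.
move=> ab HK HJ f0 gn.
have gf0 t : a <= t <= b -> 0 <= g t * f t.
  by move=> ht; case/andP: (gn t ht) => g0 _; rewrite mulr_ge0 ?f0.
have HD : prim (fun t => (n - g t) * f t) x (fun t => n * J t - K t) a b.
  have := primD (primZ n HJ) (primZ (-1) HK); apply: prim_ext => // t ht; ring.
have ngf0 t : a <= t <= b -> 0 <= (n - g t) * f t.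
  by move=> ht; case/andP: (gn t ht) => _ g0; rewrite mulr_ge0 ?f0 // subr_ge0.
move=> [incr|decr].
  have k1 := prim_increment_ge0 ab HK gf0 incr.
  have k2 := prim_increment_ge0 ab HD ngf0 incr.
  have k3 := prim_increment_ge0 ab HJ f0 incr.
  by rewrite !ger0_norm ?subr_ge0 //; lra.
have decr' s t : a <= s -> s <= t -> t <= b -> - x s <= - x t.
  by move=> h1 h2 h3; rewrite lerN2 decr.
have k1 := prim_increment_ge0 ab (primN HK) gf0 decr'.
have k2 := prim_increment_ge0 ab (primN HD) ngf0 decr'.
have k3 := prim_increment_ge0 ab (primN HJ) f0 decr'.
by rewrite !ler0_norm; lra.
Qed.

Definition strict_monotone_on (x : R -> R) (a b : R) : Prop :=
  (forall s t, a <= s -> s < t -> t <= b -> x s < x t) \/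
  (forall s t, a <= s -> s < t -> t <= b -> x t < x s).

Lemma strict_monotoneW (x : R -> R) (a b : R) :
  strict_monotone_on x a b -> monotone_on x a b.
Proof.
move=> [H|H]; [left|right] => s t as_;
  by rewrite le_eqVlt => /predU1P[->//|st tb]; exact/ltW/H.
Qed.

Lemma C1_locally_strict (x dx : R -> R) (u v s : R) : u < v ->
  C1_scalar x dx u v -> u <= s <= v -> dx s != 0 ->
  exists2 d, 0 < d & forall p q, u <= p -> q <= v ->
    `|p - s| < d -> `|q - s| < d -> strict_monotone_on x p q.
Proof.
move=> uv Hx hs dxs; have [cx cdx dxx] := Hx.
have n0 : 0 < `|dx s| by rewrite normr_gt0.
have [d d0 Hd] := within_itv_eps cdx hs n0.
exists d => // p q up qv ps qs.
have inc a b : p <= a -> a < b -> b <= q -> exists r, `|dx r - dx s| < `|dx s| /\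
    x b - x a = dx r * (b - a).
  move=> pa ab bq.
  have [r /andP[ar rb] e] := C1_scalar_MVT ab (C1_scalar_sub (le_trans up pa) (le_trans bq qv) Hx).
  exists r; split => //; apply: Hd; first by lra.
  by move: ps qs; rewrite !ltr_norml; lra.
have [pos|neg] := leP 0 (dx s); [left|right] => a b pa ab bq; have [r [h e]] := inc a b pa ab bq.
  have dr : 0 < dx r by move: h; rewrite (ger0_norm pos) ltr_norml; lra.
  by rewrite -subr_gt0 e mulr_gt0 // subr_gt0.
have dr : dx r < 0 by move: h; rewrite (ltr0_norm neg) ltr_norml; lra.
by rewrite -subr_lt0 e nmulr_rlt0 // subr_gt0.
Qed.

Lemma regular_arc_monotone (x y : R -> R) (u v s : R) : u < v ->
  regular_arc x y u v -> u <= s <= v ->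
  exists2 d, 0 < d & forall p q, u <= p -> q <= v ->
    `|p - s| < d -> `|q - s| < d -> monotone_on x p q \/ monotone_on y p q.
Proof.
move=> uv [dx [dy [Hx Hy H]]] hs; have [h|h] := H s hs.
  have [d d0 Hd] := C1_locally_strict uv Hx hs h.
  by exists d => // p q *; left; apply: strict_monotoneW; exact: Hd.
have [d d0 Hd] := C1_locally_strict uv Hy hs h.
by exists d => // p q *; right; apply: strict_monotoneW; exact: Hd.
Qed.

Lemma regular_loop_locally_monotone (x y : R -> R) :
  regular_loop x y ->
  locally_on (fun u v => monotone_on x u v \/ monotone_on y u v) 0 1.
Proof.
move=> [H _ _ _] s; split=> hs.
- have [v [sv v1 Hv]] := (H s).1 hs.
  have [d d0 Hd] := @regular_arc_monotone x y s v s sv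
    (Hv v ltac:(by rewrite sv lexx)) ltac:(by rewrite lexx ltW).
  exists (Num.min v (s + d / 2)); split; [by rewrite lt_min sv; lra|by rewrite ge_min v1|].
  move=> t /andP[st]; rewrite le_min => /andP[tv td].
  apply: Hd => //; rewrite ?subrr ?normr0 //.
  by rewrite ltr_norml; lra.
- have [u [u0 us Hu]] := (H s).2 hs.
  have [d d0 Hd] := @regular_arc_monotone x y u s s us
    (Hu u ltac:(by rewrite us lexx)) ltac:(by rewrite lexx ltW).
  exists (Num.max u (s - d / 2)); split; [by rewrite le_max u0|by rewrite gt_max us; lra|].
  move=> t; rewrite ge_max => /andP[/andP[tv td] ts].
  apply: Hd => //; rewrite ?subrr ?normr0 //.
  by rewrite ltr_norml; lra.
Qed.

(** Needed for the grid cells that meet the loop. The constant must not depend on the slopes of the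
    bumps, so Lipschitz estimates are of no use; monotonicity of [x] or [y] on short arcs gives
    bounds by the masses alone. *)
Lemma oint_bound (x y : R -> R) : regular_loop x y ->
  exists2 C, 0 <= C & forall phi Phi psi Psi a b c d m n,
    bump phi Phi a b m -> bump psi Psi c d n ->
    `|oint (fun t => Psi (y t) * phi (x t)) x| <= C * m * n.
Proof.
move=> J; have [[lx ix] [ly iy]] := regular_loop_ointable J.
pose T u v := exists2 C, 0 <= C & forall phi Phi psi Psi a b c d m n K,
    bump phi Phi a b m -> bump psi Psi c d n ->
    prim (fun t => Psi (y t) * phi (x t)) x K 0 1 -> `|K v - K u| <= C * m * n.
have [C C0 HC] : T 0 1; last first.
  exists C => // phi Phi psi Psi a b c d m n Bp Bq.
  have l1 := bump_comp_lip2 Bq ly; have l2 := bump_comp_lip Bp lx.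
  have [K HK] := ix _ (lipM l1 l2).
  by rewrite (oint_prim HK); apply: HC Bp Bq HK.
apply: (interval_induction ltr01).
  move=> u w v _ _ _ _ [C C0 HC] [D D0 HD]; exists (C + D); first exact: addr_ge0.
  move=> phi Phi psi Psi a b c d m n K Bp Bq HK.
  have -> : K v - K u = (K w - K u) + (K v - K w) by ring.
  rewrite (le_trans (ler_normD _ _)) // !mulrDl lerD //.
    exact: HC Bp Bq HK.
  exact: HD Bp Bq HK.
apply: locally_on_impl (regular_loop_locally_monotone J) => u v u0 uv v1 mono.
(* If [y] is the monotone coordinate, one integrates by parts: one product of masses for the new
   integral and one for each of the two boundary terms. *)
exists 3 => // phi Phi psi Psi a b c d m n K Bp Bq HK.
have l1 := bump_comp_lip2 Bq ly; have l2 := bump_comp_lip Bp lx.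
have l3 := bump_comp_lip2 Bp lx; have l4 := bump_comp_lip Bq ly.
have m0 := bump_mass_ge0 Bp; have n0 := bump_mass_ge0 Bq.
have mn : 0 <= m * n by rewrite mulr_ge0.
have rx t := bump_range (x t) Bp; have ry t := bump_range (y t) Bq.
have uv' := ltW uv.
have dPhi : `|Phi (x v) - Phi (x u)| <= m.
  by have := rx u; have := rx v; rewrite ler_norml; lra.
have dPsi : `|Psi (y v) - Psi (y u)| <= n.
  by have := ry u; have := ry v; rewrite ler_norml; lra.
rewrite -mulrA; case: mono => mono.
  have := prim_monotone_bound uv' (prim_sub u0 v1 HK)
    (prim_sub u0 v1 (bump_comp_prim Bp lx)) (fun t _ => bump_ge0 Bp (x t)) (fun t _ => ry t) mono.
  move=> h; apply: (le_trans h); apply: (le_trans (ler_wpM2l n0 dPhi)).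
  by rewrite mulrC; lra.
have [L HL] := iy _ (lipM l3 l4).
have [C C0 HC] := bump_prim Bp; have [C' C0' HC'] := bump_prim Bq.
have HK' := prim_chain C0 HC lx l1 HK; have HL' := prim_chain C0' HC' ly l3 HL.
have parts := prim_by_parts uv' (lip_sub u0 v1 l1) (lip_sub u0 v1 l3)
  (prim_sub u0 v1 HK') (prim_sub u0 v1 HL').
have := prim_monotone_bound uv' (prim_sub u0 v1 HL)
  (prim_sub u0 v1 (bump_comp_prim Bq ly)) (fun t _ => bump_ge0 Bq (y t)) (fun t _ => rx t) mono.
move=> h.
have h1 : `|L v - L u| <= m * n by apply: (le_trans h); rewrite ler_wpM2l.
have pr t : 0 <= Psi (y t) * Phi (x t) <= m * n.
  have /andP[a1 a2] := rx t; have /andP[b1 b2] := ry t.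
  by rewrite mulr_ge0 //= mulrC ler_pM.
have := pr u; have := pr v; move: h1; rewrite !ler_norml.
move: parts; set A := _ * _; set B := _ * _ => parts.
by lra.
Qed.

(** * The density jumps by one across the loop *)

(** Otherwise [x] would be constant and [y] injective. But [y] starts and ends at the same value, so
    it takes the value [m] halfway between [y 0] and [y 2^-1] once in each half of the loop. *)
Lemma regular_loop_x_moves (x y : R -> R) : regular_loop x y ->
  exists u v dx s,
  [/\ [/\ 0 <= u, u < v & v <= 1], C1_scalar x dx u v, u < s < v & dx s != 0].
Proof.
move=> J; have [H Jx Jy inj] := J.
have lx := regular_loop_lipx J; have ly := regular_loop_lipy J.
apply: contrapT => no.
have flat u v : 0 <= u -> u < v -> v <= 1 -> regular_arc x y u v -> x u = x v.
  move=> u0 uv v1 [dx [_ [Hx _ _]]].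
  have [r hr e] := C1_scalar_MVT uv Hx.
  have [z|nz] := eqVneq (dx r) 0; first by move: e; rewrite z mul0r => /subr0_eq ->.
  by case: no; exists u, v, dx, r.
have cst s : 0 <= s <= 1 -> x 0 = x s.
  move=> /andP[]; rewrite le_eqVlt => /predU1P[<-//|s0] s1.
  apply: (@interval_induction (fun u v => x u = x v) _ _ s0).
    by move=> u w v _ _ _ _ -> ->.
  apply: locally_on_impl (locally_on_sub (lexx _) s1 H) => u v u0 uv vs.
  by apply: flat; rewrite // (le_trans vs).
have [i0 i1] := andP invr2_itv.
set h : R := 2^-1 in i0 i1 *.
have cy := lip_continuous ly.
have yne s t : 0 <= s < 1 -> 0 <= t < 1 -> s != t -> y s != y t.
  move=> hs ht; apply: contra_neq => e; apply: inj => //.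
  have hs' : 0 <= s <= 1 by case/andP: hs => -> /ltW ->.
  have ht' : 0 <= t <= 1 by case/andP: ht => -> /ltW ->.
  by rewrite -(cst s hs') -(cst t ht').
have hh : 0 <= h < 1 by rewrite ltW.
have z0 : 0 <= (0 : R) < 1 by rewrite lexx ltr01.
have yh : y 0 != y h by apply: yne => //; rewrite lt_eqF.
pose m := (y 0 + y h) / 2.
have mid : Num.min (y 0) (y h) <= m <= Num.max (y 0) (y h).
  by rewrite /m; case: (leP (y 0) (y h)) => ?; apply/andP; split; lra.
have mid' : Num.min (y h) (y 1) <= m <= Num.max (y h) (y 1).
  by rewrite -Jy minC maxC.
have [|s1] := IVT (ltW i0) _ mid.
  apply: continuous_subspaceW cy => r /=; rewrite !in_itv /= => /andP[h1 h2].
  by rewrite h1 (le_trans h2) // ltW.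
rewrite in_itv /= => /andP[a1 b1] e1.
have [|s2] := IVT (ltW i1) _ mid'.
  apply: continuous_subspaceW cy => r /=; rewrite !in_itv /= => /andP[h1 h2].
  by rewrite h2 (le_trans _ h1) // ltW.
rewrite in_itv /= => /andP[a2 b2] e2.
have m0 : m != y 0 by apply/eqP => e; move/eqP: yh; apply; move: e; rewrite /m; lra.
have mh : m != y h by apply/eqP => e; move/eqP: yh; apply; move: e; rewrite /m; lra.
have n1 : s1 != h by apply: contra_neq mh => e; rewrite -e1 e.
have n2 : s2 != 1 by apply: contra_neq m0 => e; rewrite -e2 e Jy.
have l1 : s1 < h by rewrite lt_neqAle n1.
have l2 : s2 < 1 by rewrite lt_neqAle n2.
have : y s1 != y s2.
  apply: yne.
  - by rewrite a1 (lt_trans l1).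
  - by rewrite l2 andbT (le_trans _ a2) // ltW.
  - by rewrite lt_eqF // (lt_le_trans l1).
by rewrite e1 e2 eqxx.
Qed.

Lemma increasing_gap (x : R -> R) (s d d' : R) : 0 < d' -> d' <= d ->
  (forall a b, s - d <= a -> a < b -> b <= s + d -> x a < x b) ->
  [/\ x (s - d') < x s, x s < x (s + d') &
    forall t, d' <= `|t - s| -> `|t - s| < d -> x t <= x (s - d') \/ x (s + d') <= x t].
Proof.
move=> d'0 d'd inc; split; [by apply: inc; lra|by apply: inc; lra|move=> t].
rewrite ler_normr ltr_norml le_eqVlt [d' <= - _]le_eqVlt => /orP[]/predU1P[e|h] h'.
- by right; rewrite e subrKC.
- by right; apply/ltW/inc; lra.
- by left; rewrite e opprB subKr.
- by left; apply/ltW/inc; lra.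
Qed.

(* s0 is a parameter near which x is strictly monotone. *)
Lemma loop_graph_box (x y : R -> R) : regular_loop x y ->
  exists s0 d r g, [/\ [/\ 0 < r, 0 < d, 0 <= s0 - d & s0 + d <= 1], r <= g,
    forall t, 0 <= t <= 1 -> `|t - s0| <= d -> `|y t - y s0| <= g,
    forall t, 0 <= t <= 1 -> d <= `|t - s0| -> `|x t - x s0| <= r -> 7 * g <= `|y t - y s0| &
    (x (s0 - d) < x s0 - r /\ x s0 + r < x (s0 + d)) \/
    (x (s0 + d) < x s0 - r /\ x s0 + r < x (s0 - d))].
Proof.
move=> J; have [u [v [dx [s0 [[u0 uv v1] Hx hs ds]]]]] := regular_loop_x_moves J.
have hs' : u <= s0 <= v by case/andP: hs => /ltW -> /ltW ->.
have [r0 r00 Hr] := C1_locally_strict uv Hx hs' ds.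
pose d := Num.min (r0 / 2) (Num.min (s0 - u) (v - s0)).
have d0 : 0 < d by rewrite !lt_min !subr_gt0 hs divr_gt0.
have [dd ud vd] : [/\ d <= r0 / 2, d <= s0 - u & d <= v - s0].
  by rewrite !ge_min !lexx !orbT.
have mono : strict_monotone_on x (s0 - d) (s0 + d).
  by apply: Hr; rewrite ?ltr_norml; lra.
have [L L0 HL] := regular_loop_lipy J.
have s00 : 0 < s0 by lra.
have s01 : 0 <= s0 < 1 by lra.
have [sd sd1] : 0 <= s0 - d /\ s0 + d <= 1 by lra.
have [e e0 He] := loop_isolated J s01 d0.
(* The rest of the loop has l1 distance at least [e = 8 * g] from the point, so where its [x]
   differs by at most [r <= g] its [y] differs by at least [7 * g]. *)
pose g := e / 8; have g0 : 0 < g by rewrite divr_gt0.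
(* Short enough for [y] to move by at most [g] along the arc. *)
pose d' := Num.min d (g / (L + 1)).
have L1 : 0 < L + 1 by rewrite ltr_pwDr.
have d'0 : 0 < d' by rewrite lt_min d0 divr_gt0.
have d'd : d' <= d by rewrite ge_min lexx.
have d'g : (L + 1) * d' <= g by rewrite mulrC -ler_pdivlMr // ge_min lexx orbT.
have sides : [/\ x (s0 - d') < x s0, x s0 < x (s0 + d') &
     forall t, d' <= `|t - s0| -> `|t - s0| < d -> x t <= x (s0 - d') \/ x (s0 + d') <= x t] \/
   [/\ x (s0 + d') < x s0, x s0 < x (s0 - d') &
     forall t, d' <= `|t - s0| -> `|t - s0| < d -> x (s0 - d') <= x t \/ x t <= x (s0 + d')].
  case: mono => mono; [by left; exact: increasing_gap mono|right].
  have [|h1 h2 h3] := @increasing_gap (fun t => - x t) s0 d d' d'0 d'd.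
    by move=> a b *; rewrite ltrN2; exact: mono.
  split; [by rewrite -ltrN2|by rewrite -ltrN2|move=> t g1 g2].
  by case: (h3 t g1 g2); rewrite lerN2; [left|right].
have out t : 0 <= t <= 1 -> d <= `|t - s0| -> e <= `|x t - x s0| + `|y t - y s0|.
  move=> ht far; rewrite leNgt; apply/negP => /(He t ht)[|[z _]]; first by rewrite ltNge far.
  by move: s00; rewrite z ltxx.
have near_ t : 0 <= t <= 1 -> `|t - s0| <= d' -> `|y t - y s0| <= g.
  move=> ht h; have s02 : 0 <= s0 <= 1 by case/andP: s01 => -> /ltW.
  apply: (le_trans (HL _ _ s02 ht)); apply: le_trans d'g.
  by rewrite ler_pM // lerDl.
clear He HL hs ds Hx uv u0 v1 Hr hs' r00 dd ud vd L1 d'g L0 mono dx J e0.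
move: sides; move em: (x (s0 - d')) => xm; move ep: (x (s0 + d')) => xp sides.
pose r := Num.min g (Num.min (`|xm - x s0| / 2) (`|xp - x s0| / 2)).
have rg : r <= g by rewrite ge_min lexx.
have r1 : r <= `|xm - x s0| / 2 by rewrite !ge_min lexx !orbT.
have r2 : r <= `|xp - x s0| / 2 by rewrite !ge_min lexx !orbT.
exists s0, d', r, g; split => //.
- split => //; rewrite ?(le_trans sd) ?lerB // ?(le_trans _ sd1) ?lerD2l //.
  rewrite !lt_min g0 /= !divr_gt0 ?normr_gt0 ?subr_eq0 //.
    by case: sides => -[h h' _]; [rewrite gt_eqF|rewrite lt_eqF].
  by case: sides => -[h h' _]; [rewrite lt_eqF|rewrite gt_eqF].
- move=> t ht h1 h2; have [h3|h3] := leP d `|t - s0|.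
    by move: (out t ht h3) h2 rg; rewrite /g; clear; lra.
  exfalso; case: sides => -[k1 k2 /(_ t h1 h3) k3]; move: r1 r2 h2 k3.
    rewrite ltr0_norm ?subr_lt0 // gtr0_norm ?subr_gt0 // ler_norml.
    by move=> + + + []; move: k1 k2; clear; lra.
  rewrite gtr0_norm ?subr_gt0 // ltr0_norm ?subr_lt0 // ler_norml.
  by move=> + + + []; move: k1 k2; clear; lra.
- case: sides => -[k1 k2 _]; [left|right]; move: r1 r2; rewrite em ep.
    rewrite ltr0_norm ?subr_lt0 // gtr0_norm ?subr_gt0 //.
    by move: k1 k2; clear; lra.
  rewrite gtr0_norm ?subr_gt0 // ltr0_norm ?subr_lt0 //.
  by move: k1 k2; clear; lra.
Qed.

(** The squares are centred [3 * g] above and below the point. In their vertical strip the loop runs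
    either within [g] of the level [y s0], between the squares, or at least [7 * g] away from it,
    beyond both; the former happens on the short arc, which crosses the strip once. *)
Lemma density_jump (x y : R -> R) : regular_loop x y ->
  exists p q q' r w w', [/\ 0 < r, density_on x y p q r w, density_on x y p q' r w' &
    `|w - w'| = 1].
Proof.
move=> J; have [ix iy] := regular_loop_ointable J.
have [s0 [d [r [g [[r0 d0 sd sd1] rg nearg farg sides]]]]] := loop_graph_box J.
have yrange t : 0 <= t <= 1 -> `|x t - x s0| <= r ->
    `|t - s0| < d /\ `|y t - y s0| <= g \/ d <= `|t - s0| /\ 7 * g <= `|y t - y s0|.
  by move=> ht h; have [h'|h'] := ltP `|t - s0| d; [left|right]; split => //;
    [apply: nearg => //; exact: ltW|apply: farg].
have off k : `|k| = 3 -> off_square x y (x s0) (y s0 + k * g) r.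
  move=> k3 t ht h1 h2.
  have kk : k = 3 \/ k = -3.
    by move: k3; case: (ger0P k) => _ e; [left|right; rewrite -e opprK].
  have : `|x t - x s0| <= r by rewrite ler_norml; lra.
  move=> /(yrange t ht)[] [_]; first by rewrite ler_norml; case: kk h2 => ->; lra.
  by rewrite ler_normr => /orP[]; case: kk h2 => ->; lra.
have o1 := off 3 (ger0_norm (ler0n R 3)).
have o2 := off (-3) (etrans (normrN _) (ger0_norm (ler0n R 3))).
have [w Hw] := density_exists J r0 o1; have [w' Hw'] := density_exists J r0 o2.
exists (x s0), (y s0 + 3 * g), (y s0 + -3 * g), r, w, w'; split => //.
have Bx := hat_bump (x s0) r0.
have B1 := hat_bump (y s0 + 3 * g) r0; have B2 := hat_bump (y s0 + -3 * g) r0.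
have e1 := Hw.2 _ _ _ _ _ _ Bx B1; have e2 := Hw'.2 _ _ _ _ _ _ Bx B2.
have l := bump_comp_lip Bx ix.1.
have l1 := lipM (bump_comp_lip2 B1 iy.1) l; have l2 := lipM (bump_comp_lip2 B2 iy.1) l.
have [K HK] := ix.2 _ l1; have [K' HK'] := ix.2 _ l2.
have HD : prim (fun t => (hat_int r (y s0 + -3 * g) (y t) - hat_int r (y s0 + 3 * g) (y t))
     * hat r (x s0) (x t)) x (fun t => K' t - K t) 0 1.
  have := primD HK' (primZ (-1) HK); apply: prim_ext => // t ht; ring.
have zero t : r < `|x t - x s0| -> hat r (x s0) (x t) = 0.
  by rewrite ltr_normr => /orP[h|h]; apply: (bump_out Bx); [right|left]; lra.
(* Beyond both squares the two antiderivatives in [y] agree, so the difference of the integrands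
   vanishes. *)
have outside a b : 0 <= a -> a <= b -> b <= 1 ->
    (forall t, a <= t <= b -> d <= `|t - s0|) -> (K' b - K b) - (K' a - K a) = 0.
  move=> a0 ab b1 far.
  have P0 : prim (fun=> 0) x (fun t => K' t - K t) a b.
    apply: prim_ext (prim_sub a0 b1 HD) => // t ht.
    have ht' : 0 <= t <= 1 by case/andP: ht => h1 h2; rewrite (le_trans a0) // (le_trans h2).
    have [xr|xr] := leP `|x t - x s0| r; last by rewrite zero // mulr0.
    have := farg t ht' (far t ht) xr; rewrite ler_normr => /orP[h|h].
      by rewrite (bump_right B1) ?(bump_right B2) ?subrr ?mul0r //; lra.
    by rewrite (bump_left B1) ?(bump_left B2) ?subrr ?mul0r //; lra.
  by rewrite (prim_uniq ab P0 (prim_cst 0 x a b)) !mul0r subrr.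
(* On the short arc the antiderivatives differ by the full mass [r ^+ 2], and what remains is the
   integral of the hat in [x]. *)
have inside : (K' (s0 + d) - K (s0 + d)) - (K' (s0 - d) - K (s0 - d)) =
    r ^+ 2 * (hat_int r (x s0) (x (s0 + d)) - hat_int r (x s0) (x (s0 - d))).
  have P0 : prim (fun t => r ^+ 2 * hat r (x s0) (x t)) x (fun t => K' t - K t) (s0 - d) (s0 + d).
    apply: prim_ext (prim_sub sd sd1 HD) => // t ht.
    have ht' : 0 <= t <= 1.
      by case/andP: ht => h1 h2; rewrite (le_trans sd) // (le_trans h2).
    have td : `|t - s0| <= d by rewrite ler_norml; case/andP: ht => h1 h2; lra.
    have [xr|xr] := leP `|x t - x s0| r; last by rewrite zero // !mulr0.
    have := nearg t ht' td; rewrite ler_norml => /andP[h1 h2].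
    by rewrite (bump_right B2) ?(bump_left B1) ?subr0 //; lra.
  have ab : s0 - d <= s0 + d by lra.
  have := prim_uniq ab P0 (primZ (r ^+ 2) (prim_sub sd sd1 (bump_comp_prim Bx ix.1))).
  by rewrite mulrBr.
have left0 := outside 0 (s0 - d) (lexx _) sd (ltac:(lra))
  (fun t ht => ltac:(rewrite ler_normr; apply/orP; right; lra)).
have right0 := outside (s0 + d) 1 (ltac:(lra)) sd1 (lexx _)
  (fun t ht => ltac:(rewrite ler_normr; apply/orP; left; lra)).
rewrite (oint_prim HK) in e1; rewrite (oint_prim HK') in e2.
have r4 : r ^+ 2 * r ^+ 2 != 0 by rewrite mulf_neq0 // expf_neq0 // gt_eqF.
have total : (w' - w) * (r ^+ 2 * r ^+ 2) =
    r ^+ 2 * (hat_int r (x s0) (x (s0 + d)) - hat_int r (x s0) (x (s0 - d))).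
  by rewrite -inside; lra.
case: sides total => -[h1 h2].
  rewrite (bump_right Bx (ltW h2)) (bump_left Bx (ltW h1)) subr0 -[RHS]mul1r => /(mulIf r4) e.
  by rewrite distrC e normr1.
rewrite (bump_right Bx (ltW h2)) (bump_left Bx (ltW h1)) sub0r mulrN -[RHS]mulN1r => /(mulIf r4) e.
by rewrite distrC e normrN normr1.
Qed.

(** * The two sides of a loop *)

Definition dist2 (z w : R * R) : R :=
  (z.1 - w.1) ^+ 2 + (z.2 - w.2) ^+ 2.

Lemma path_joined (P : set (R * R)) (f g : R -> R) :
  (forall t, 0 <= t <= 1 -> {for t, continuous f}) ->
  (forall t, 0 <= t <= 1 -> {for t, continuous g}) ->
  (forall t, 0 <= t <= 1 -> ~ P (f t, g t)) ->
  connected_component (~` P) (f 0, g 0) (f 1, g 1).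
Proof.
move=> cf cg nP.
exists ((fun t => (f t, g t)) @` `[0, 1]); last first.
  by exists 1 => //=; rewrite in_itv /= ler01 lexx.
split.
- by exists 0 => //=; rewrite in_itv /= ler01 lexx.
- by move=> z [t /= + <-]; rewrite in_itv /=; exact: (nP t).
- apply: connected_continuous_connected; first exact: segment_connected.
  apply/subspace_continuousP => t /=; rewrite in_itv /= => ht.
  apply: cvg_within_filter; exact: (cvg_pair (cf t ht) (cg t ht)).
Qed.

(* st tau is the stereographic parametrization of the unit circle minus (1, 0). *)
Definition st1 (t : R) : R := (t ^+ 2 - 1) / (t ^+ 2 + 1).
Definition st2 (t : R) : R := 2 * t / (t ^+ 2 + 1).

Lemma st_den (t : R) : 0 < t ^+ 2 + 1.
Proof. by rewrite ltr_wpDl ?sqr_ge0. Qed.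

Lemma st_norm (t : R) : st1 t ^+ 2 + st2 t ^+ 2 = 1.
Proof. by have := st_den t; rewrite /st1 /st2 => h; field; rewrite gt_eqF. Qed.

Lemma st1_neq1 (t : R) : 1 - st1 t = 2 / (t ^+ 2 + 1).
Proof. by have := st_den t; rewrite /st1 => h; field; rewrite gt_eqF. Qed.

Lemma st2_E (t : R) : st2 t = t * (1 - st1 t).
Proof. by have := st_den t; rewrite /st1 /st2 => h; field; rewrite gt_eqF. Qed.

(* Reading plane vectors as complex numbers: if |a|^2 = |b|^2 = r then b / a is
   the point of the unit circle with stereographic parameter
   det(a, b) / (r - <a, b>). *)
Lemma stereographic_quotient (a1 a2 b1 b2 r : R) :
  a1 ^+ 2 + a2 ^+ 2 = r -> b1 ^+ 2 + b2 ^+ 2 = r -> r != 0 ->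
  r - (a1 * b1 + a2 * b2) != 0 ->
  let t := (a1 * b2 - a2 * b1) / (r - (a1 * b1 + a2 * b2)) in
  b1 = a1 * st1 t - a2 * st2 t /\ b2 = a2 * st1 t + a1 * st2 t.
Proof.
move=> na nb r0; set D := a1 * b1 + a2 * b2; set E := a1 * b2 - a2 * b1 => rD /=.
have DE : E ^+ 2 = (r - D) * (r + D).
  have <- : r ^+ 2 - D ^+ 2 = (r - D) * (r + D) by ring.
  rewrite [r ^+ 2](_ : _ = (a1 ^+ 2 + a2 ^+ 2) * (b1 ^+ 2 + b2 ^+ 2)); last by rewrite na nb.
  by rewrite /D /E; ring.
have t1 : (E / (r - D)) ^+ 2 + 1 = 2 * r / (r - D) by rewrite expr_div_n DE; field.
have t2 : (E / (r - D)) ^+ 2 - 1 = 2 * D / (r - D) by rewrite expr_div_n DE; field.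
have -> : st1 (E / (r - D)) = D / r by rewrite /st1 t1 t2; field; rewrite r0 rD.
have -> : st2 (E / (r - D)) = E / r by rewrite /st2 t1; field; rewrite r0 rD.
split; apply: (mulIf r0).
  have -> : (a1 * (D / r) - a2 * (E / r)) * r = b1 * (a1 ^+ 2 + a2 ^+ 2) by rewrite /D /E; field.
  by rewrite na.
have -> : (a2 * (D / r) + a1 * (E / r)) * r = b2 * (a1 ^+ 2 + a2 ^+ 2) by rewrite /D /E; field.
by rewrite na.
Qed.

Lemma convex_gt0 (a b s : R) : 0 < a -> 0 < b -> 0 <= s <= 1 ->
  0 < a + s * (b - a).
Proof.
move=> a0 b0 /andP[s0 s1]; have [h|/ltW h] := leP a b.
  by rewrite ltr_wpDr // mulr_ge0 // subr_ge0.
have : 0 <= (1 - s) * (a - b) by rewrite mulr_ge0 // subr_ge0.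
by lra.
Qed.

(** * A disc cut by two arcs from its centre *)

Section Sectors.
Context (P : set (R * R)) (p q e : R) (A1 A2 B1 B2 : R -> R).
Hypothesis e0 : 0 < e.
Hypothesis cA1 : forall r, 0 < r < e -> {for r, continuous A1}.
Hypothesis cA2 : forall r, 0 < r < e -> {for r, continuous A2}.
Hypothesis cB1 : forall r, 0 < r < e -> {for r, continuous B1}.
Hypothesis cB2 : forall r, 0 < r < e -> {for r, continuous B2}.
Hypothesis nA : forall r, 0 <= r < e -> A1 r ^+ 2 + A2 r ^+ 2 = r.
Hypothesis nB : forall r, 0 <= r < e -> B1 r ^+ 2 + B2 r ^+ 2 = r.
Hypothesis AB : forall r, 0 < r < e -> A1 r = B1 r -> A2 r = B2 r -> False.
Hypothesis PE : forall z, dist2 z (p, q) < e -> P z <->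
  z = (p + A1 (dist2 z (p, q)), q + A2 (dist2 z (p, q))) \/
  z = (p + B1 (dist2 z (p, q)), q + B2 (dist2 z (p, q))).

(* The stereographic parameter of B / A. *)
Let tB r := (A1 r * B2 r - A2 r * B1 r) / (r - (A1 r * B1 r + A2 r * B2 r)).
(** First coordinate of the point at squared distance [r] from the centre whose stereographic
    parameter, read from [A], is [t]. The arc [A] sits at infinite [t], so the rest of the punctured
    disc becomes a strip in which [B] is the graph of [tB]. *)
Let m1 r t := p + (A1 r * st1 t - A2 r * st2 t).
Let m2 r t := q + (A2 r * st1 t + A1 r * st2 t).

Let dot_lt (r b1 b2 : R) : 0 < r < e -> b1 ^+ 2 + b2 ^+ 2 = r ->
  (A1 r = b1 -> A2 r = b2 -> False) -> 0 < r - (A1 r * b1 + A2 r * b2).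
Proof.
move=> hr nb ne; have na := nA (r := r) ltac:(by case/andP: hr => /ltW -> ->).
have : 0 < (A1 r - b1) ^+ 2 + (A2 r - b2) ^+ 2.
  rewrite lt_neqAle addr_ge0 ?sqr_ge0 // andbT eq_sym paddr_eq0 ?sqr_ge0 //.
  rewrite !sqrf_eq0 !subr_eq0; apply/negP => /andP[/eqP h1 /eqP h2]; exact: ne.
by move: na nb; lra.
Qed.

Let dist_m r t : 0 <= r < e -> dist2 (m1 r t, m2 r t) (p, q) = r.
Proof.
move=> hr; rewrite /dist2 /m1 /m2 /= -[RHS](nA hr).
have -> : (p + (A1 r * st1 t - A2 r * st2 t) - p) ^+ 2 +
   (q + (A2 r * st1 t + A1 r * st2 t) - q) ^+ 2 =
   (A1 r ^+ 2 + A2 r ^+ 2) * (st1 t ^+ 2 + st2 t ^+ 2) by ring.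
by rewrite st_norm mulr1.
Qed.

Let m_off r t : 0 < r < e -> t != tB r -> ~ P (m1 r t, m2 r t).
Proof.
move=> hr tne; have hr' : 0 <= r < e by case/andP: hr => /ltW -> ->.
case/andP: (hr) => r0 _; have rn : r != 0 by rewrite gt_eqF.
have na := nA hr'.
rewrite PE dist_m //; last by case/andP: hr.
have c1 := st1_neq1 t; have d0 := st_den t.
have c0 : 0 < 1 - st1 t by rewrite c1 divr_gt0.
case=> -[]; rewrite /m1 /m2 => /addrI h1 /addrI h2.
  have : A1 r * (A1 r * st1 t - A2 r * st2 t) + A2 r * (A2 r * st1 t + A1 r * st2 t) =
      (A1 r ^+ 2 + A2 r ^+ 2) * st1 t by ring.
  rewrite h1 h2 na => h; have : r * (1 - st1 t) = 0 by move: h na; lra.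
  by move/eqP; rewrite mulf_eq0 (negbTE rn) gt_eqF.
have hd : A1 r * B1 r + A2 r * B2 r = r * st1 t.
  have : A1 r * B1 r + A2 r * B2 r = (A1 r ^+ 2 + A2 r ^+ 2) * st1 t.
    by rewrite -h1 -h2; ring.
  by rewrite na.
have hc : A1 r * B2 r - A2 r * B1 r = r * st2 t.
  have : A1 r * B2 r - A2 r * B1 r = (A1 r ^+ 2 + A2 r ^+ 2) * st2 t.
    by rewrite -h1 -h2; ring.
  by rewrite na.
case/eqP: tne; rewrite /tB hd hc st2_E.
have -> : r - r * st1 t = r * (1 - st1 t) by ring.
by field; rewrite rn gt_eqF.
Qed.

Let B_st r : 0 < r < e ->
  B1 r = A1 r * st1 (tB r) - A2 r * st2 (tB r) /\
  B2 r = A2 r * st1 (tB r) + A1 r * st2 (tB r).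
Proof.
move=> hr; have hr' : 0 <= r < e by case/andP: hr => /ltW -> ->.
have r0 : r != 0 by case/andP: hr => r0 _; rewrite gt_eqF.
exact: stereographic_quotient (nA hr') (nB hr') r0 (lt0r_neq0 (dot_lt hr (nB hr') (AB hr))).
Qed.

Let m_onto z : 0 < dist2 z (p, q) < e -> ~ P z ->
  exists2 t, t != tB (dist2 z (p, q)) &
    z = (m1 (dist2 z (p, q)) t, m2 (dist2 z (p, q)) t).
Proof.
set r := dist2 z (p, q) => hr nPz; have hr' : 0 <= r < e by case/andP: hr => /ltW -> ->.
case/andP: (hr) => r0 re; have rn : r != 0 by rewrite gt_eqF.
have na := nA hr'.
pose z1 := z.1 - p; pose z2 := z.2 - q.
have zE : z = (p + z1, q + z2) by rewrite /z1 /z2 ![_ + (_ - _)]addrC !subrK -surjective_pairing.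
have nz : z1 ^+ 2 + z2 ^+ 2 = r by [].
have zA : A1 r = z1 -> A2 r = z2 -> False.
  by move=> h1 h2; apply: nPz; rewrite PE //; left; rewrite -/r h1 h2.
have zB : B1 r = z1 -> B2 r = z2 -> False.
  by move=> h1 h2; apply: nPz; rewrite PE //; right; rewrite -/r h1 h2.
have dz := dot_lt hr nz zA.
have [e1 e2] := stereographic_quotient na nz rn (lt0r_neq0 dz).
set t := _ / _ in e1 e2.
exists t; last by rewrite zE {1}e1 {1}e2.
apply/eqP => tt; have [f1 f2] := B_st hr.
by apply: zB; [rewrite f1 -tt|rewrite f2 -tt].
Qed.

Let ctB r : 0 < r < e -> {for r, continuous tB}.
Proof.
move=> hr; have hr' : 0 <= r < e by case/andP: hr => /ltW -> ->.
have d0 := dot_lt hr (nB hr') (AB hr).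
apply: cvgM.
  by apply: cvgB; apply: cvgM; [exact: cA1|exact: cB2|exact: cA2|exact: cB1].
apply: cvgV; first by rewrite gt_eqF.
apply: cvgB; first exact: cvg_id.
by apply: cvgD; apply: cvgM; [exact: cA1|exact: cB1|exact: cA2|exact: cB2].
Qed.

(** The radius and the offset from [tB] are interpolated linearly. The offset keeps its sign, so the
    path does not meet [B]; it cannot meet [A], which has no finite parameter. *)
Let m_joined r t r' t' : 0 < r < e -> 0 < r' < e -> 0 < t * t' ->
  connected_component (~` P) (m1 r (tB r + t), m2 r (tB r + t))
    (m1 r' (tB r' + t'), m2 r' (tB r' + t')).
Proof.
move=> hr hr' tt.
pose rr s := r + s * (r' - r); pose uu s := t + s * (t' - t).
have hrr s : 0 <= s <= 1 -> 0 < rr s < e.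
  move=> hs; case/andP: hr hr' => r0 re /andP[r0' re']; rewrite /rr convex_gt0 //=.
  rewrite -subr_gt0; have := @convex_gt0 (e - r) (e - r') s.
  by rewrite !subr_gt0 => /(_ re re' hs); lra.
have crr s : {for s, continuous rr}.
  by apply: cvgD; [exact: cvg_cst|apply: cvgM; [exact: cvg_id|exact: cvg_cst]].
have cuu s : {for s, continuous uu}.
  by apply: cvgD; [exact: cvg_cst|apply: cvgM; [exact: cvg_id|exact: cvg_cst]].
have comp (f : R -> R) : (forall s, 0 < s < e -> {for s, continuous f}) ->
    forall s, 0 <= s <= 1 -> {for s, continuous (fun s => f (rr s))}.
  move=> cf s hs; apply: (continuous_comp (crr s)).
  exact: cf (hrr s hs).
pose tt_ s := tB (rr s) + uu s.
have ctt s : 0 <= s <= 1 -> {for s, continuous tt_}.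
  by move=> hs; apply: cvgD; [exact: (comp _ ctB)|exact: cuu].
have cden s : 0 <= s <= 1 -> {for s, continuous (fun s => (tt_ s ^+ 2 + 1)^-1)}.
  move=> hs; apply: cvgV; first by rewrite gt_eqF // st_den.
  by apply: cvgD; [apply: cvgM; exact: ctt|exact: cvg_cst].
have cst1 s : 0 <= s <= 1 -> {for s, continuous (fun s => st1 (tt_ s))}.
  move=> hs; apply: cvgM; last exact: cden.
  by apply: cvgB; [apply: cvgM; exact: ctt|exact: cvg_cst].
have cst2 s : 0 <= s <= 1 -> {for s, continuous (fun s => st2 (tt_ s))}.
  move=> hs; apply: cvgM; last exact: cden.
  by apply: cvgM; [exact: cvg_cst|exact: ctt].
have := @path_joined P (fun s => m1 (rr s) (tt_ s)) (fun s => m2 (rr s) (tt_ s)).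
have e1 : rr 0 = r by rewrite /rr mul0r addr0.
have e2 : rr 1 = r' by rewrite /rr; ring.
have e3 : uu 0 = t by rewrite /uu mul0r addr0.
have e4 : uu 1 = t' by rewrite /uu; ring.
rewrite /tt_ e1 e2 e3 e4; apply.
- move=> s hs; apply: cvgD; first exact: cvg_cst.
  apply: cvgB; apply: cvgM; [exact: (comp _ cA1)|exact: cst1|exact: (comp _ cA2)|exact: cst2].
- move=> s hs; apply: cvgD; first exact: cvg_cst.
  apply: cvgD; apply: cvgM; [exact: (comp _ cA2)|exact: cst1|exact: (comp _ cA1)|exact: cst2].
- move=> s hs; apply: m_off; first exact: hrr.
  rewrite -subr_eq0 addrC addKr /uu.
  have : 0 < (t + s * (t' - t)) * t.
    have tn : t != 0 by apply/eqP => z; move: tt; rewrite z mul0r ltxx.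
    have := @convex_gt0 (t ^+ 2) (t * t') s.
    by rewrite exprn_even_gt0 //= => /(_ tn tt hs); lra.
  by move=> h; apply/eqP => z; move: h; rewrite z mul0r ltxx.
Qed.

(** The two sides consist of the points with parameter above and below [tB]. Besides covering the
    disc off the arcs, each side comes arbitrarily close to every point of the arcs; this is what
    lets the sides be followed along the whole loop. *)
Lemma sectors : exists z1 z2,
  (forall z, ~ P z -> dist2 z (p, q) < e ->
     connected_component (~` P) z z1 \/ connected_component (~` P) z z2) /\
  (forall w eps, P w -> dist2 w (p, q) < e -> 0 < eps ->
     (exists2 z, dist2 z w < eps & connected_component (~` P) z z1) /\
     (exists2 z, dist2 z w < eps & connected_component (~` P) z z2)).
Proof.
have he : 0 < e / 2 < e.
  by rewrite divr_gt0 //= ltr_pdivrMr // ltr_pMr // ltr1n.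
pose Z k := (m1 (e / 2) (tB (e / 2) + k), m2 (e / 2) (tB (e / 2) + k)).
exists (Z 1), (Z (-1)); split.
  move=> z nPz ze.
  have [d0|dn] := eqVneq (dist2 z (p, q)) 0.
    case: nPz; rewrite PE // d0; left.
    have h0 : 0 <= (0 : R) < e by rewrite lexx.
    move: d0 => /eqP; rewrite /dist2 paddr_eq0 ?sqr_ge0 // !sqrf_eq0 !subr_eq0 => /andP[/eqP h1 /eqP h2].
    have /eqP := nA h0; rewrite paddr_eq0 ?sqr_ge0 // !sqrf_eq0 => /andP[/eqP -> /eqP ->].
    by rewrite !addr0 [z]surjective_pairing h1 h2.
  have hr : 0 < dist2 z (p, q) < e.
    by rewrite ze andbT lt_neqAle eq_sym dn addr_ge0 ?sqr_ge0.
  have [t tne ->] := m_onto hr nPz.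
  set r := dist2 _ _ in hr t tne *.
  have -> : t = tB r + (t - tB r) by ring.
  have [tp|tn] := leP (tB r) t.
    left; apply: m_joined => //; rewrite mulr1 subr_gt0 lt_neqAle eq_sym tne; exact: tp.
  right; apply: m_joined => //; rewrite mulrN1 oppr_gt0 subr_lt0; exact: tn.
move=> w eps Pw we eps0.
suff key k : k ^+ 2 = 1 -> exists2 z, dist2 z w < eps & connected_component (~` P) z (Z k).
  by split; apply: key; rewrite ?sqrrN expr1n.
move=> k2.
have kk l : 0 < l -> 0 < k * l * k by move=> l0; rewrite mulrAC -expr2 k2 mul1r.
set r := dist2 w (p, q).
(* At the centre, a point of small radius with offset [k] will do. *)
have [r0|rn] := eqVneq r 0.
  pose r' := Num.min (eps / 2) (e / 2).
  have hr' : 0 < r' < e.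
    rewrite lt_min !divr_gt0 //=; apply: (@le_lt_trans _ _ (e / 2)); last by lra.
    by rewrite ge_min lexx orbT.
  exists (m1 r' (tB r' + k * 1), m2 r' (tB r' + k * 1)); last first.
    by apply: m_joined => //; exact: kk.
  have -> : w = (p, q).
    move: r0 => /eqP; rewrite /r /dist2 paddr_eq0 ?sqr_ge0 // !sqrf_eq0 !subr_eq0.
    by move=> /andP[/eqP /= h1 /eqP /= h2]; rewrite [w]surjective_pairing h1 h2.
  rewrite dist_m; last by case/andP: hr' => /ltW -> ->.
  apply: (@le_lt_trans _ _ (eps / 2)); last by lra.
  by rewrite ge_min lexx.
have hr : 0 < r < e by rewrite we andbT lt_neqAle eq_sym rn addr_ge0 ?sqr_ge0.
have hr' : 0 <= r < e by case/andP: hr => /ltW -> ->.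
case/andP: (hr) => r0 re.
have na := nA hr'.
have [wE|wE] := (PE we).1 Pw; rewrite wE -/r.
  (* To approach [A] the parameter is sent to infinity: the squared distance is
     [4 * r / (t ^+ 2 + 1)], and this offset ensures [|t| >= 1 + 4 * r / eps]. *)
  pose l := `|tB r| + 1 + 4 * r / eps.
  have er : 0 < 4 * r / eps by rewrite divr_gt0 // mulr_gt0.
  have l0 : 0 < l by rewrite /l; have := normr_ge0 (tB r); lra.
  exists (m1 r (tB r + k * l), m2 r (tB r + k * l)); last by apply: m_joined => //; exact: kk.
  set t := tB r + k * l.
  have -> : dist2 (m1 r t, m2 r t) (p + A1 r, q + A2 r) = 4 * r / (t ^+ 2 + 1).
    rewrite /dist2 /m1 /m2 /=.
    have -> : (p + (A1 r * st1 t - A2 r * st2 t) - (p + A1 r)) ^+ 2 +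
      (q + (A2 r * st1 t + A1 r * st2 t) - (q + A2 r)) ^+ 2 =
      (A1 r ^+ 2 + A2 r ^+ 2) * ((st1 t ^+ 2 + st2 t ^+ 2) + 1 - 2 * st1 t) by ring.
    by rewrite na st_norm /st1; field; rewrite gt_eqF // st_den.
  rewrite ltr_pdivrMr ?st_den // [eps * _]mulrC -ltr_pdivrMr //.
  have lt : 4 * r / eps + 1 <= `|t|.
    have : `|k * l| <= `|t| + `|tB r|.
      by rewrite (_ : k * l = t - tB r) ?ler_normB // /t; ring.
    have k1 : `|k| = 1.
      by have /eqP := k2; rewrite sqrf_eq1 => /orP[] /eqP ->; rewrite ?normrN normr1.
    by rewrite normrM k1 mul1r (gtr0_norm l0) /l; lra.
  have : 4 * r / eps + 1 <= `|t| ^+ 2.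
    apply: (le_trans lt); rewrite expr2 ler_peMr //.
    by apply: le_trans lt; rewrite lerDr ltW.
  by rewrite real_normK ?num_real //; lra.
(* To approach [B] the offset is made small: the squared distance is at most
   [4 * r * l ^+ 2 <= 4 * r * l <= eps / 2]. *)
pose l := Num.min 1 (eps / (8 * r)).
have l0 : 0 < l by rewrite lt_min ltr01 divr_gt0 // mulr_gt0.
have l1 : l <= 1 by rewrite ge_min lexx.
have l2 : 8 * r * l <= eps.
  by rewrite mulrC -ler_pdivlMr ?mulr_gt0 // ge_min lexx orbT.
exists (m1 r (tB r + k * l), m2 r (tB r + k * l)); last by apply: m_joined => //; exact: kk.
set t := tB r + k * l; set t' := tB r in t *.
have [b1 b2] := B_st hr.
have -> : dist2 (m1 r t, m2 r t) (p + B1 r, q + B2 r) =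
    r * (4 * (t - t') ^+ 2 / ((t ^+ 2 + 1) * (t' ^+ 2 + 1))).
  rewrite /dist2 /m1 /m2 /= b1 b2 -/t'.
  have -> : (p + (A1 r * st1 t - A2 r * st2 t) - (p + (A1 r * st1 t' - A2 r * st2 t'))) ^+ 2 +
    (q + (A2 r * st1 t + A1 r * st2 t) - (q + (A2 r * st1 t' + A1 r * st2 t'))) ^+ 2 =
    (A1 r ^+ 2 + A2 r ^+ 2) * ((st1 t - st1 t') ^+ 2 + (st2 t - st2 t') ^+ 2) by ring.
  rewrite na; congr (_ * _); rewrite /st1 /st2.
  by field; rewrite !gt_eqF // st_den.
have -> : (t - t') ^+ 2 = l ^+ 2.
  have -> : t - t' = k * l by rewrite /t; ring.
  by rewrite exprMn k2 mul1r.
have h1 : 4 * l ^+ 2 / ((t ^+ 2 + 1) * (t' ^+ 2 + 1)) <= 4 * l ^+ 2.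
  rewrite ler_pdivrMr ?mulr_gt0 ?st_den // ler_peMr //.
    by rewrite mulr_ge0 // sqr_ge0.
  by rewrite -[leLHS]mulr1 ler_pM // lerDr sqr_ge0.
have h2 : l ^+ 2 <= l by rewrite expr2 ler_piMr // ltW.
apply: (le_lt_trans (ler_wpM2l (ltW r0) h1)).
apply: (@le_lt_trans _ _ (r * (4 * l))).
  by rewrite ler_wpM2l ?ler_wpM2l // ltW.
have := mulr_gt0 r0 l0; lra.
Qed.

End Sectors.

(** * The local sides of a regular loop *)

Definition trace (x y : R -> R) : set (R * R) :=
  [set z | exists2 t, 0 <= t <= 1 & z = (x t, y t)].

Definition radius2 (ax ay : R -> R) (h : R) : R :=
  (ax h - ax 0) ^+ 2 + (ay h - ay 0) ^+ 2.

(* Near 0 the product of the derivatives of each coordinate at two points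
   stays close to its square at 0, so the squared radius increases. *)
Lemma radius2_increasing (ax ay dax day : R -> R) (d : R) : 0 < d ->
  C1_scalar ax dax 0 d -> C1_scalar ay day 0 d -> dax 0 != 0 \/ day 0 != 0 ->
  exists2 e, 0 < e <= d & forall s t, 0 <= s -> s < t -> t <= e ->
    radius2 ax ay s < radius2 ax ay t.
Proof.
move=> d0 Hx Hy H; have [cx cdx Dx] := Hx; have [cy cdy Dy] := Hy.
pose D := dax 0 ^+ 2 + day 0 ^+ 2.
have D0 : 0 < D.
  rewrite /D lt_neqAle addr_ge0 ?sqr_ge0 // andbT eq_sym paddr_eq0 ?sqr_ge0 // !sqrf_eq0.
  by apply/negP => /andP[/eqP h1 /eqP h2]; case: H; rewrite ?h1 ?h2 eqxx.
pose B := `|dax 0| + `|day 0| + 1.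
have B0 : 0 < B by rewrite /B; have := normr_ge0 (dax 0); have := normr_ge0 (day 0); lra.
(* The errors [k * (2 * |f0| + 1)] of [prod], summed over both coordinates, give
   [2 * k * B <= D / 2]. *)
pose k := Num.min 1 (D / (4 * B)).
have k0 : 0 < k by rewrite lt_min ltr01 divr_gt0 // mulr_gt0.
have k1 : k <= 1 by rewrite ge_min lexx.
have kD : k * (4 * B) <= D by rewrite -ler_pdivlMr ?mulr_gt0 // ge_min lexx orbT.
have z0 : 0 <= (0 : R) <= d by rewrite lexx ltW.
have [e1 e10 He1] := within_itv_eps cdx z0 k0.
have [e2 e20 He2] := within_itv_eps cdy z0 k0.
pose e := Num.min d (Num.min (e1 / 2) (e2 / 2)).
have e0 : 0 < e by rewrite !lt_min d0 !divr_gt0.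
have ed : e <= d by rewrite ge_min lexx.
have ee1 : e < e1.
  by apply: (@le_lt_trans _ _ (e1 / 2)); [rewrite !ge_min lexx !orbT|lra].
have ee2 : e < e2.
  by apply: (@le_lt_trans _ _ (e2 / 2)); [rewrite !ge_min lexx !orbT|lra].
have near_x a : 0 <= a -> a <= e -> `|dax a - dax 0| < k.
  by move=> a0 ae; apply: He1; [lra|rewrite subr0 ger0_norm //; lra].
have near_y a : 0 <= a -> a <= e -> `|day a - day 0| < k.
  by move=> a0 ae; apply: He2; [lra|rewrite subr0 ger0_norm //; lra].
have prod (f0 fa fb : R) : `|fa - f0| < k -> `|fb - f0| < k ->
    f0 ^+ 2 - k * (2 * `|f0| + 1) <= fa * fb.
  move=> ha hb.
  have -> : fa * fb = f0 ^+ 2 + ((fa - f0) * (fb - f0) + f0 * ((fa - f0) + (fb - f0))) by ring.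
  rewrite lerD2l lerNl.
  apply: (le_trans (ler_norm _)); rewrite normrN (le_trans (ler_normD _ _)) // !normrM.
  have h1 : `|fa - f0| * `|fb - f0| <= k * 1.
    by rewrite ler_pM // ltW //; apply: lt_le_trans hb k1.
  have h2 : `|f0| * `|fa - f0 + (fb - f0)| <= `|f0| * (2 * k).
    by rewrite ler_wpM2l // (le_trans (ler_normD _ _)) //; move: ha hb; lra.
  by move: h1 h2; lra.
exists e; first by rewrite e0.
move=> s t s0 st te.
have Ax := C1_scalarB Hx (C1_scalar_cst (ax 0) 0 d).
have Ay := C1_scalarB Hy (C1_scalar_cst (ay 0) 0 d).
have HN := C1_scalar_sub s0 (le_trans te ed) (C1_scalarD (C1_scalarM Ax Ax) (C1_scalarM Ay Ay)).
(* The derivative of the squared radius at [r] contains the increments of the coordinates from 0 to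
   [r]; two more mean values make them [r] times a derivative near 0. *)
have [r /andP[sr rt] E] := C1_scalar_MVT st HN.
have r0 : 0 < r by exact: le_lt_trans sr.
have re : r <= e by rewrite (le_trans (ltW rt)).
have rd := le_trans re ed.
have [rx /andP[rx0 rxr] Ex] := C1_scalar_MVT r0 (C1_scalar_sub (lexx _) rd Hx).
have [ry /andP[ry0 ryr] Ey] := C1_scalar_MVT r0 (C1_scalar_sub (lexx _) rd Hy).
have near_r := near_x r (ltW r0) re; have near_r' := near_y r (ltW r0) re.
have px := prod _ _ _ (near_x rx (ltW rx0) (le_trans (ltW rxr) re)) near_r.
have py := prod _ _ _ (near_y ry (ltW ry0) (le_trans (ltW ryr) re)) near_r'.
rewrite -subr_gt0 (_ : _ - _ = 2 * (r * (dax rx * dax r + day ry * day r)) * (t - s)); last first.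
  by rewrite /radius2 E Ex Ey !subr0; ring.
rewrite !mulr_gt0 ?subr_gt0 //; clear - px py kD D0.
have : k * (2 * `|dax 0| + 1) + k * (2 * `|day 0| + 1) <= D / 2.
  by move: kD; rewrite /B; lra.
by move: px py D0; rewrite /D; lra.
Qed.

(** Reparametrizes an arc by the squared distance to its starting point, the form in which [sectors]
    takes its two arcs. *)
Lemma radial_inverse (ax ay : R -> R) (d : R) : 0 < d ->
  {within `[0, d], continuous ax} -> {within `[0, d], continuous ay} ->
  (forall s t, 0 <= s -> s < t -> t <= d -> radius2 ax ay s < radius2 ax ay t) ->
  exists g : R -> R, [/\
    forall h, 0 <= h <= d -> g (radius2 ax ay h) = h,
    forall r, 0 <= r <= radius2 ax ay d -> 0 <= g r <= d /\ radius2 ax ay (g r) = r,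
    forall r, 0 < r < radius2 ax ay d -> {for r, continuous (fun r => ax (g r))} &
    forall r, 0 < r < radius2 ax ay d -> {for r, continuous (fun r => ay (g r))}].
Proof.
move=> d0 cx cy incr; pose N := radius2 ax ay.
have N0 : N 0 = 0 by rewrite /N /radius2 !subrr expr0n addr0.
have Nd : 0 < N d by rewrite -N0; apply: incr; rewrite ?lexx.
have cN : {within `[0, d], continuous N}.
  apply/subspace_continuousP => h hh; apply: cvgD; apply: cvgM; apply: cvgB;
    try exact: cvg_cst;
    by [move/subspace_continuousP: cx; apply|move/subspace_continuousP: cy; apply].
have Nincr s t : 0 <= s -> s < t -> t <= d -> N s < N t by exact: incr.
have /choice[g Hg] : forall r, exists h, 0 <= r <= N d -> 0 <= h <= d /\ N h = r.
  move=> r; have [hr|nr] := boolP (0 <= r <= N d); last by exists 0.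
  have [|h] := IVT (ltW d0) cN (v := r).
    by rewrite N0 (min_idPl (ltW Nd)) (max_idPr (ltW Nd)).
  by rewrite in_itv /= => hh e; exists h.
have Nrange h : 0 <= h <= d -> 0 <= N h <= N d.
  move=> /andP[h0 hd]; rewrite addr_ge0 ?sqr_ge0 //=.
  by move: hd; rewrite le_eqVlt => /predU1P[->//|hd]; apply/ltW/Nincr.
have gN h : 0 <= h <= d -> g (N h) = h.
  move=> hh; have [gr e] := Hg _ (Nrange h hh); case/andP: gr hh => g0 gd /andP[h0 hd].
  have [lt|lt|//] := ltgtP (g (N h)) h.
    by have := Nincr _ _ g0 lt hd; rewrite e ltxx.
  by have := Nincr _ _ h0 lt gd; rewrite e ltxx.
have cg : {within `[N 0, N d], continuous g}.
  by apply: segment_can_le_continuous (ltW d0) cN _ => h; rewrite in_itv /=; exact: gN.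
have inner r : 0 < r < N d -> 0 < g r < d.
  move=> /andP[r0 rd]; have [|/andP[g0 gd] e] := Hg r; first by rewrite !ltW.
  apply/andP; split; rewrite lt_neqAle ?g0 ?gd andbT; apply/eqP => h.
    by move: r0; rewrite -e -h N0 ltxx.
  by move: rd; rewrite -e h ltxx.
have cgr r : 0 < r < N d -> {for r, continuous g}.
  move=> hr; apply: within_continuous_continuous cg _; first by rewrite N0.
  by rewrite in_itv /= N0.
exists g; split => // r hr; apply: (continuous_comp (cgr r hr)).
  by apply: within_continuous_continuous cx _ => //; rewrite in_itv /=; exact: inner.
by apply: within_continuous_continuous cy _ => //; rewrite in_itv /=; exact: inner.
Qed.

Lemma dist2_ge0 (z w : R * R) : 0 <= dist2 z w.
Proof. by rewrite addr_ge0 ?sqr_ge0. Qed.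

Lemma dist2_norm1 (a b e : R) : 0 < e -> e <= `|a| + `|b| ->
  e ^+ 2 / 4 <= a ^+ 2 + b ^+ 2.
Proof.
move=> e0 h; rewrite -(real_normK (num_real a)) -(real_normK (num_real b)).
move: (normr_ge0 a) (normr_ge0 b) h; move: `|a| `|b| => u v u0 v0 h.
have : e ^+ 2 <= (u + v) ^+ 2 by rewrite lerXn2r ?nnegrE //; lra.
by have := sqr_ge0 (u - v); have := mulr_ge0 u0 v0; lra.
Qed.

(* The forward and the backward arc out of the parameter s0, both read from
   h = 0; at the base point the backward arc starts from the parameter 1. *)
Lemma loop_two_arcs (x y : R -> R) (s0 : R) :
  regular_loop x y -> 0 <= s0 < 1 ->
  exists s1 a b, [/\ [/\ s1 = s0 /\ 0 < s0 \/ s1 = 1 /\ s0 = 0, 0 < a, 0 < b,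
       a <= (1 - s0) / 3 & b <= s1 / 3],
    [/\ {within `[0, a], continuous (fun h => x (s0 + h))},
        {within `[0, a], continuous (fun h => y (s0 + h))},
        {within `[0, b], continuous (fun h => x (s1 - h))} &
        {within `[0, b], continuous (fun h => y (s1 - h))}],
    forall s t, 0 <= s -> s < t -> t <= a ->
      radius2 (fun h => x (s0 + h)) (fun h => y (s0 + h)) s <
      radius2 (fun h => x (s0 + h)) (fun h => y (s0 + h)) t &
    forall s t, 0 <= s -> s < t -> t <= b ->
      radius2 (fun h => x (s1 - h)) (fun h => y (s1 - h)) s <
      radius2 (fun h => x (s1 - h)) (fun h => y (s1 - h)) t].
Proof.
move=> J /andP[s00 s01]; have Jreg := loop_regular J.
pose s1 := if s0 == 0 then 1 else s0.
have s1P : s1 = s0 /\ 0 < s0 \/ s1 = 1 /\ s0 = 0.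
  rewrite /s1; case: eqVneq => [->|n]; first by right.
  by left; rewrite lt_neqAle eq_sym n.
have s1r : 0 < s1 <= 1 by case: s1P => -[-> h]; lra.
have [v [sv v1 Hv]] := (Jreg s0).1 ltac:(by rewrite s00).
have [dx [dy [Hx Hy Hn]]] := Hv v ltac:(by rewrite sv lexx).
have [u [u0 us Hu]] := (Jreg s1).2 s1r.
have [ex [ey [Kx Ky Kn]]] := Hu u ltac:(by rewrite us lexx).
have fwd f df : C1_scalar f df s0 v ->
    C1_scalar (fun h => f (s0 + 1 * h)) (fun h => 1 * df (s0 + 1 * h)) 0 (v - s0).
  by apply: C1_scalar_affine; rewrite ?oner_eq0 // => h; rewrite mul1r; lra.
have bwd f df : C1_scalar f df u s1 ->
    C1_scalar (fun h => f (s1 + -1 * h)) (fun h => -1 * df (s1 + -1 * h)) 0 (s1 - u).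
  by apply: C1_scalar_affine; rewrite ?oppr_eq0 ?oner_eq0 // => h; rewrite mulN1r; lra.
have [||a /andP[a0 av] Ha] := radius2_increasing (_ : 0 < v - s0) (fwd _ _ Hx) (fwd _ _ Hy).
- by rewrite subr_gt0.
- by rewrite mulr0 addr0 !mul1r; apply: Hn; rewrite lexx ltW.
have [||b /andP[b0 bv] Hb] := radius2_increasing (_ : 0 < s1 - u) (bwd _ _ Kx) (bwd _ _ Ky).
- by rewrite subr_gt0.
- by rewrite mulr0 addr0 !mulN1r !oppr_eq0; apply: Kn; rewrite lexx ltW.
(* The thirds keep the parameters inside the unit interval and, at the base point, keep the two arcs
   apart. *)
pose a' := Num.min a ((1 - s0) / 3); pose b' := Num.min b (s1 / 3).
have a'a : a' <= a by rewrite ge_min lexx.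
have b'b : b' <= b by rewrite ge_min lexx.
have wit f df d d' k s : d' <= d -> C1_scalar (fun h => f (s + k * h)) df 0 d ->
    {within `[0, d'], continuous (fun h => f (s + k * h))}.
  by move=> dd /(C1_scalar_sub (lexx 0) dd)[].
exists s1, a', b'; split.
- split => //; rewrite ?ge_min ?lexx ?orbT //.
    by rewrite lt_min a0 divr_gt0 // subr_gt0.
  by rewrite lt_min b0 divr_gt0 //; case/andP: s1r.
- have E (f : R -> R) : (fun h => f (s0 + h)) = (fun h => f (s0 + 1 * h)).
    by apply/funext => h; rewrite mul1r.
  have E' (f : R -> R) : (fun h => f (s1 - h)) = (fun h => f (s1 + -1 * h)).
    by apply/funext => h; rewrite mulN1r.
  rewrite !E !E'; split.
  + by apply: wit (fwd _ _ Hx); lra.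
  + by apply: wit (fwd _ _ Hy); lra.
  + by apply: wit (bwd _ _ Kx); lra.
  + by apply: wit (bwd _ _ Ky); lra.
- move=> s t h1 h2 h3; have := Ha s t h1 h2 ltac:(lra).
  by rewrite /radius2 !mul1r.
- move=> s t h1 h2 h3; have := Hb s t h1 h2 ltac:(lra).
  by rewrite /radius2 !mulN1r.
Qed.

Lemma loop_near_arcs (x y : R -> R) (s0 s1 a b : R) :
  regular_loop x y -> 0 <= s0 < 1 -> s1 = s0 /\ 0 < s0 \/ s1 = 1 /\ s0 = 0 ->
  0 < a -> 0 < b ->
  exists2 e, 0 < e & forall t, 0 <= t <= 1 -> dist2 (x t, y t) (x s0, y s0) < e ->
    s0 <= t < s0 + a \/ s1 - b < t <= s1.
Proof.
move=> J s01 s1P a0 b0; have m0 : 0 < Num.min a b by rewrite lt_min a0.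
have [e e0 He] := loop_isolated J s01 m0.
exists (e ^+ 2 / 4) => [|t ht near_]; first by rewrite divr_gt0 // exprn_gt0.
have [ma mb] : Num.min a b <= a /\ Num.min a b <= b by rewrite !ge_min !lexx !orbT.
have [||] := He t ht.
- by rewrite ltNge; apply/negP => /(dist2_norm1 e0); rewrite leNgt near_.
- rewrite ltr_norml => h; have [st|ts] := leP s0 t; first by left; move: h ma; clear; lra.
  by right; case: s1P => -[-> z]; move: h mb ht ts; rewrite ?z; clear; lra.
- by move=> [z h]; right; case: s1P => -[-> z']; move: h mb ht z'; rewrite z; clear; lra.
Qed.

(** Below a suitable radius the loop consists only of the two arcs leaving the point of [s0], and
    both arcs reach that radius, so [sectors] applies. *)
Lemma loop_local_sides (x y : R -> R) (s0 : R) :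
  regular_loop x y -> 0 <= s0 < 1 ->
  exists e z1 z2, [/\ 0 < e,
  (forall z, ~ trace x y z -> dist2 z (x s0, y s0) < e ->
     connected_component (~` trace x y) z z1 \/ connected_component (~` trace x y) z z2) &
  (forall w eps, trace x y w -> dist2 w (x s0, y s0) < e -> 0 < eps ->
     (exists2 z, dist2 z w < eps & connected_component (~` trace x y) z z1) /\
     (exists2 z, dist2 z w < eps & connected_component (~` trace x y) z z2))].
Proof.
move=> J s01; have [_ Jx Jy Jinj] := J.
have [s1 [a [b [[s1P a0 b0 a3 b3] [cax cay cbx cby] incA incB]]]] := loop_two_arcs J s01.
have [e e0 He] := loop_near_arcs J s01 s1P a0 b0.
pose NA := radius2 (fun h => x (s0 + h)) (fun h => y (s0 + h)).
pose NB := radius2 (fun h => x (s1 - h)) (fun h => y (s1 - h)).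
have [gA [gA1 gA2 cA1 cA2]] := radial_inverse a0 cax cay incA.
have [gB [gB1 gB2 cB1 cB2]] := radial_inverse b0 cbx cby incB.
have NA0 : 0 < NA a.
  have <- : NA 0 = 0 by rewrite /NA /radius2 !subrr expr0n addr0.
  by apply: incA; rewrite ?lexx.
have NB0 : 0 < NB b.
  have <- : NB 0 = 0 by rewrite /NB /radius2 !subrr expr0n addr0.
  by apply: incB; rewrite ?lexx.
have xs1 : x s1 = x s0 by case: s1P => -[-> h]; rewrite // h Jx.
have ys1 : y s1 = y s0 by case: s1P => -[-> h]; rewrite // h Jy.
case/andP: (s01) => s00 s0lt.
pose e' := Num.min e (Num.min (NA a) (NB b)).
have e'0 : 0 < e' by rewrite !lt_min e0 NA0.
have e'e : e' <= e by rewrite ge_min lexx.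
have e'A : e' <= NA a by rewrite !ge_min lexx !orbT.
have e'B : e' <= NB b by rewrite !ge_min lexx !orbT.
pose A1 r := x (s0 + gA r) - x s0; pose A2 r := y (s0 + gA r) - y s0.
pose B1 r := x (s1 - gB r) - x s0; pose B2 r := y (s1 - gB r) - y s0.
have rA r : 0 <= r < e' -> 0 <= r <= NA a by move=> /andP[-> /ltW h]; exact: le_trans h e'A.
have rB r : 0 <= r < e' -> 0 <= r <= NB b by move=> /andP[-> /ltW h]; exact: le_trans h e'B.
have NAE h : NA h = (x (s0 + h) - x s0) ^+ 2 + (y (s0 + h) - y s0) ^+ 2.
  by rewrite /NA /radius2 addr0.
have NBE h : NB h = (x (s1 - h) - x s0) ^+ 2 + (y (s1 - h) - y s0) ^+ 2.
  by rewrite /NB /radius2 subr0 xs1 ys1.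
have [||||||||z1 [z2 [H1 H2]]] := @sectors (trace x y) (x s0) (y s0) e' A1 A2 B1 B2 e'0;
  last by exists e', z1, z2.
- by move=> r hr; apply: cvgB; [apply: cA1; rewrite -/NA; lra|exact: cvg_cst].
- by move=> r hr; apply: cvgB; [apply: cA2; rewrite -/NA; lra|exact: cvg_cst].
- by move=> r hr; apply: cvgB; [apply: cB1; rewrite -/NB; lra|exact: cvg_cst].
- by move=> r hr; apply: cvgB; [apply: cB2; rewrite -/NB; lra|exact: cvg_cst].
- by move=> r hr; have [_ e1] := gA2 r (rA r hr); rewrite -[RHS]e1 -/NA NAE.
- by move=> r hr; have [_ e1] := gB2 r (rB r hr); rewrite -[RHS]e1 -/NB NBE.
- move=> r /andP[r0 re] /addIr h1 /addIr h2.
  have hr : 0 <= r < e' by rewrite ltW.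
  have [ga eA] := gA2 r (rA r hr); have [gb eB] := gB2 r (rB r hr).
  have gbp : 0 < gB r.
    rewrite lt_neqAle eq_sym; case/andP: gb => -> _; rewrite andbT.
    apply/eqP => z; move: r0; rewrite -eB z -/NB NBE subr0 xs1 ys1 !subrr expr0n addr0 ltxx.
    by [].
  (* A common point would have one parameter, while [gB r > 0] and the bounds on [a] and [b]
     separate the parameters of the two arcs. *)
  have : s0 + gA r = s1 - gB r.
    apply: Jinj => //; clear - s00 s0lt s1P a3 b3 ga gb gbp;
      by case: s1P b3 => -[-> s0p] b3; lra.
  by clear - s00 s0lt s1P a3 b3 ga gb gbp; case: s1P b3 => -[-> s0p] b3; lra.
- move=> z ze; have hr : 0 <= dist2 z (x s0, y s0) < e' by rewrite dist2_ge0.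
  set r := dist2 z _ in hr ze *; split.
    move=> [t ht zE]; have [|h|h] := He t ht.
    + by rewrite -zE; apply: lt_le_trans ze e'e.
    + left; have e1 : r = NA (t - s0) by rewrite NAE /r zE /dist2 /= subrKC.
      rewrite /A1 /A2 e1 gA1; last by lra.
      by rewrite zE !subrKC.
    + right; have e1 : r = NB (s1 - t) by rewrite NBE /r zE /dist2 /= subKr.
      rewrite /B1 /B2 e1 gB1; last by lra.
      by rewrite zE !subKr !subrKC.
  move=> [->|->].
    have [ga _] := gA2 r (rA r hr); exists (s0 + gA r); first by lra.
    by rewrite /A1 /A2 !subrKC.
  have [gb _] := gB2 r (rB r hr); exists (s1 - gB r).
    by clear - s1P b3 gb s00 s0lt; case: s1P b3 => -[-> s0p] b3; lra.
  by rewrite /B1 /B2 !subrKC.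
Qed.

(** * Densities and the components of the complement *)

Definition has_density (x y : R -> R) (z : R * R) (w : R) : Prop :=
  exists2 r, 0 < r & density_on x y z.1 z.2 r w.

Lemma has_density_uniq (x y : R -> R) (z : R * R) (w w' : R) :
  has_density x y z w -> has_density x y z w' -> w = w'.
Proof. by move=> [r r0 H] [r' r0' H']; exact: density_on_uniq r0 r0' H H'. Qed.

Lemma has_density_off (x y : R -> R) (z : R * R) (w : R) :
  has_density x y z w -> ~ trace x y z.
Proof.
move=> [r r0 [off _]] [t ht e]; apply: (off t ht); rewrite e /=; lra.
Qed.

Lemma has_density_exists (x y : R -> R) (z : R * R) :
  regular_loop x y -> ~ trace x y z -> exists w, has_density x y z w.
Proof.
move=> J nz.
have [cx cy] := regular_loop_continuous J.
have [|e e0 He] := @arc_away x y 0 1 z.1 z.2 cx cy.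
  by move=> t ht h1 h2; apply: nz; exists t => //; rewrite h1 h2 -surjective_pairing.
have off : off_square x y z.1 z.2 (e / 3).
  move=> t ht h1 h2; have := He t ht.
  have : `|x t - z.1| <= e / 3 by rewrite ler_norml; lra.
  have : `|y t - z.2| <= e / 3 by rewrite ler_norml; lra.
  by lra.
have e3 : 0 < e / 3 by rewrite divr_gt0.
by have [w Hw] := density_exists J e3 off; exists w, (e / 3).
Qed.

Lemma has_density_near (x y : R -> R) (z : R * R) (w : R) :
  has_density x y z w -> exists2 r, 0 < r &
    forall z', `|z'.1 - z.1| < r -> `|z'.2 - z.2| < r -> has_density x y z' w.
Proof.
move=> [r r0 H]; have r2 : 0 < r / 2 by rewrite divr_gt0.
exists (r / 2) => // z'; rewrite !ltr_norml => h1 h2; exists (r / 2) => //.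
by apply: density_on_sub H; lra.
Qed.

Lemma open_has_density (x y : R -> R) (W : R -> Prop) :
  open [set z | exists2 w, W w & has_density x y z w].
Proof.
rewrite openE => z [w Ww /has_density_near[r r0 Hr]].
apply/nbhs_ballP; exists r => // z' [h1 h2]; exists w => //.
by apply: Hr; rewrite distrC; [exact: h1|exact: h2].
Qed.

(** The points of density [w] and those of any other density form two disjoint open sets covering
    the complement of the loop, so the former are both open and closed in a connected subset. *)
Lemma density_component (x y : R -> R) (z z' : R * R) (w : R) :
  regular_loop x y -> connected_component (~` trace x y) z z' ->
  has_density x y z w -> has_density x y z' w.
Proof.
move=> J [B [Bz BP Bc] Bz'] Hz.
suff E : B `&` [set v | exists2 w', w' = w & has_density x y v w'] = B.
  by move: Bz'; rewrite -E => -[_ [w' ->]].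
apply: Bc.
- by exists z; split => //; exists w.
- by exists [set v | exists2 w', w' = w & has_density x y v w'] => //; exact: open_has_density.
- exists (~` [set v | exists2 w', w' <> w & has_density x y v w']).
    by apply: open_closedC; exact: open_has_density.
  apply/seteqP; split=> v [Bv].
    move=> [w' -> Hv]; split=> // -[w2 n H2]; apply: n; exact: has_density_uniq H2 Hv.
  move=> n; split => //; have [w' Hw'] := has_density_exists J (BP v Bv).
  have [e|ne] := pselect (w' = w); first by exists w'.
  by case: n; exists w'.
Qed.

Lemma dist2_open (w p : R * R) (e : R) : dist2 w p < e ->
  exists2 d, 0 < d & forall z, dist2 z w < d -> dist2 z p < e.
Proof.
move=> h; set D := dist2 w p in h.
pose g := e - D; have g0 : 0 < g by rewrite subr_gt0.
have D0 : 0 <= D by exact: dist2_ge0.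
pose k := g / (2 * (D + 1)).
have D1 : 0 < D + 1 by lra.
have k0 : 0 < k by rewrite divr_gt0 // mulr_gt0.
exists (g / 2 / (1 + k^-1)); first by rewrite !divr_gt0 // addr_gt0 ?invr_gt0.
move=> z; rewrite ltr_pdivlMr; last by rewrite addr_gt0 ?invr_gt0.
move=> hz.
(* AM-GM: 2 u v <= k v^2 + u^2 / k for u = z - w and v = w - p. *)
have amgm (u v : R) : (u + v) ^+ 2 <= u ^+ 2 * (1 + k^-1) + v ^+ 2 * (1 + k).
  have kn : k != 0 by rewrite gt_eqF.
  have : 0 <= k^-1 * (u - k * v) ^+ 2 by rewrite mulr_ge0 ?sqr_ge0 // invr_ge0 ltW.
  have -> : k^-1 * (u - k * v) ^+ 2 = u ^+ 2 * k^-1 - 2 * (u * v) + k * v ^+ 2 by field.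
  by lra.
have : dist2 z p <= dist2 z w * (1 + k^-1) + D * (1 + k).
  have := amgm (z.1 - w.1) (w.1 - p.1); have := amgm (z.2 - w.2) (w.2 - p.2).
  by rewrite /D /dist2 !addrA !subrK; lra.
have Dk : D * k <= g / 2.
  have -> : g / 2 = (D + 1) * k.
    by rewrite /k; have Dn : D + 1 != 0 by [rewrite gt_eqF]; field.
  by rewrite ler_wpM2r ?ltW //; lra.
by rewrite /g in hz Dk *; lra.
Qed.

Lemma loop_dist2_near (x y : R -> R) (s e : R) :
  regular_loop x y -> 0 <= s <= 1 -> 0 < e ->
  exists2 d, 0 < d & forall t, 0 <= t <= 1 -> `|t - s| < d ->
    dist2 (x t, y t) (x s, y s) < e.
Proof.
move=> J hs e0.
have [cx cy] := regular_loop_continuous J.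
pose k := Num.min 1 (e / 2).
have k0 : 0 < k by rewrite lt_min ltr01 divr_gt0.
have [d1 d10 H1] := within_itv_eps cx hs k0.
have [d2 d20 H2] := within_itv_eps cy hs k0.
exists (Num.min d1 d2); first by rewrite lt_min d10.
move=> t ht; rewrite lt_min => /andP[h1 h2]; rewrite /dist2 /=.
have sq (u : R) : `|u| < k -> u ^+ 2 < e / 2.
  move=> h; rewrite -(real_normK (num_real u)) expr2.
  apply: (@le_lt_trans _ _ (1 * `|u|)).
    by rewrite ler_wpM2r //; apply: ltW (lt_le_trans h _); rewrite ge_min lexx.
  by rewrite mul1r (lt_le_trans h) // ge_min lexx orbT.
by have := sq _ (H1 t ht h1); have := sq _ (H2 t ht h2); lra.
Qed.

(** The two components found near the parameter 0 are carried along the loop, so that near each of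
    its points they are the only ones. Any other point is joined to a neighbourhood of the loop by
    the segment towards its nearest point on the loop. *)
Lemma loop_two_sides (x y : R -> R) : regular_loop x y ->
  exists z1 z2, forall z, ~ trace x y z ->
    connected_component (~` trace x y) z z1 \/ connected_component (~` trace x y) z z2.
Proof.
move=> J; have [_ Jx Jy _] := J.
pose cc := connected_component (~` trace x y).
have ccs z z' : cc z z' -> cc z' z by exact: connected_component_sym.
have cct z z' z'' : cc z z' -> cc z' z'' -> cc z z'' by exact: connected_component_trans.
have local s : 0 <= s <= 1 -> exists e w1 w2, [/\ 0 < e,
  (forall z, ~ trace x y z -> dist2 z (x s, y s) < e -> cc z w1 \/ cc z w2) &
  (forall w eps, trace x y w -> dist2 w (x s, y s) < e -> 0 < eps ->
     (exists2 z, dist2 z w < eps & cc z w1) /\ (exists2 z, dist2 z w < eps & cc z w2))].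
  move=> /andP[s0]; rewrite le_eqVlt => /predU1P[->|s1].
    by rewrite -Jx -Jy; apply: loop_local_sides => //; rewrite lexx ltr01.
  by apply: loop_local_sides => //; rewrite s0.
have t01 : 0 <= (0 : R) <= 1 by rewrite lexx ler01.
have [e [z1 [z2 [e0 Hz _]]]] := local 0 t01.
exists z1, z2.
pose good s := exists2 e, 0 < e & forall z, ~ trace x y z -> dist2 z (x s, y s) < e ->
  cc z z1 \/ cc z z2.
have ccoff z z' : cc z z' -> ~ trace x y z.
  by move=> /ccs; exact: connected_component_sub.
have good0 : good 0 by exists e.
(* Both local sides at [s] come arbitrarily close to the point of [t]. So if [t] is good, each of
   them lies in the component of [z1] or of [z2]; near [t'] there is nothing but these sides. *)
have transfer s e' w1 w2 t t' : 0 <= t <= 1 -> 0 <= t' <= 1 ->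
   (forall z, ~ trace x y z -> dist2 z (x s, y s) < e' -> cc z w1 \/ cc z w2) ->
   (forall w eps, trace x y w -> dist2 w (x s, y s) < e' -> 0 < eps ->
     (exists2 z, dist2 z w < eps & cc z w1) /\ (exists2 z, dist2 z w < eps & cc z w2)) ->
   dist2 (x t, y t) (x s, y s) < e' -> dist2 (x t', y t') (x s, y s) < e' ->
   good t -> good t'.
  move=> ht ht' H1 H2 ts ts' [eps eps0 He].
  have [|[a1 da1 ca1] [a2 da2 ca2]] := H2 (x t, y t) eps _ ts eps0; first by exists t.
  have side a w : dist2 a (x t, y t) < eps -> cc a w -> cc w z1 \/ cc w z2.
    move=> da ca; have [h|h] := He a (ccoff _ _ ca) da; [left|right];
      exact: cct (ccs _ _ ca) h.
  have [d d0 Hd] := dist2_open ts'.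
  exists d => // z nz dz.
  have [h|h] := H1 z nz (Hd z dz).
    by have [k|k] := side a1 w1 da1 ca1; [left|right]; exact: cct h k.
  by have [k|k] := side a2 w2 da2 ca2; [left|right]; exact: cct h k.
have near_ s : 0 <= s <= 1 -> exists2 d, 0 < d &
    forall t, 0 <= t <= 1 -> `|t - s| < d -> (good s <-> good t).
  move=> hs; have [e' [w1 [w2 [e'0 H1 H2]]]] := local s hs.
  have [d d0 Hd] := loop_dist2_near J hs e'0.
  have ss : dist2 (x s, y s) (x s, y s) < e' by rewrite /dist2 !subrr expr0n addr0.
  exists d => // t ht td; split; apply: (transfer s e' w1 w2) => //; exact: Hd.
have all_good s : 0 <= s <= 1 -> good s.
  move=> /andP[]; rewrite le_eqVlt => /predU1P[<-//|s0] s1.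
  suff : good 0 <-> good s by move=> [+ _]; apply.
  apply: (@interval_induction (fun u v => good u <-> good v) _ _ s0).
    by move=> u w v _ _ _ _ h1 h2; exact: iff_trans h1 h2.
  apply: locally_on_near => t /andP[h1 h2].
  have [d d0 Hd] := near_ t ltac:(by rewrite h1 (le_trans h2)).
  exists d => // t' /andP[h3 h4] td; have E := Hd t' ltac:(by rewrite h3 (le_trans h4)) td.
  by split=> _ //; exact: iff_sym.
move=> z nz.
have [cx cy] := regular_loop_continuous J.
have [|t] := @EVT_min _ (fun t => dist2 (x t, y t) z) 0 1 ler01.
  by move=> t; apply: cvgD; apply: cvgM; apply: cvgB; try exact: cvg_cst;
    [exact: cx|exact: cx|exact: cy|exact: cy].
rewrite in_itv /= => ht Hmin; pose w := (x t, y t).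
pose D := dist2 w z.
have D0 : 0 < D.
  rewrite lt_neqAle dist2_ge0 andbT eq_sym /D /dist2 paddr_eq0 ?sqr_ge0 //.
  rewrite !sqrf_eq0 !subr_eq0 /=; apply/negP => /andP[/eqP h1 /eqP h2].
  by apply: nz; exists t => //; rewrite h1 h2 -surjective_pairing.
have [eps eps0 Heps] := all_good t ht.
(* The segment stops at the fraction [1 - k] of the way: short of the loop, but at squared distance
   [k ^+ 2 * D < eps] from its point. *)
pose k := Num.min 2^-1 (eps / (2 * D)).
have k0 : 0 < k by rewrite lt_min invr_gt0 ltr0n divr_gt0 // mulr_gt0.
have k1 : k <= 2^-1 by rewrite ge_min lexx.
have k1' : k < 1 by apply: le_lt_trans k1 _; rewrite invf_lt1 // ltr1n.
have kD : k * (2 * D) <= eps by rewrite -ler_pdivlMr ?mulr_gt0 // ge_min lexx orbT.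
pose l := 1 - k.
pose f u := z.1 + u * (l * (w.1 - z.1)); pose g u := z.2 + u * (l * (w.2 - z.2)).
have ca (a b u : R) : {for u, continuous (fun u : R => a + u * b)}.
  by apply: cvgD; [exact: cvg_cst|apply: cvgM; [exact: cvg_id|exact: cvg_cst]].
have avoid u : 0 <= u <= 1 -> ~ trace x y (f u, g u).
  move=> /andP[u0 u1] [t' ht' E].
  have := Hmin t'; rewrite in_itv /= => /(_ ht'); rewrite -E.
  have -> : dist2 (f u, g u) z = (u * l) ^+ 2 * D.
    by rewrite /dist2 /f /g /D /dist2 /w /=; ring.
  rewrite -/w -/D leNgt gtr_pMl // expr_lt1 //; last first.
    by rewrite mulr_ge0 // /l; lra.
  suff -> : u * l < 1 by [].
  apply: (@le_lt_trans _ _ (1 * l)); last by rewrite mul1r /l; lra.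
  by rewrite ler_wpM2r // /l; lra.
have c01 := @path_joined (trace x y) f g (fun u _ => ca _ _ u) (fun u _ => ca _ _ u) avoid.
have e00 : (f 0, g 0) = z by rewrite /f /g !mul0r !addr0 -surjective_pairing.
rewrite e00 in c01.
have d1 : dist2 (f 1, g 1) w < eps.
  have -> : dist2 (f 1, g 1) w = k ^+ 2 * D by rewrite /dist2 /f /g /l /D /dist2 /w /=; ring.
  have k2 : k ^+ 2 <= k by rewrite expr2 ler_piMr // ltW.
  have := ler_wpM2r (ltW D0) k2.
  by have := mulr_gt0 k0 D0; lra.
have t11 : 0 <= (1 : R) <= 1 by rewrite ler01 lexx.
by have [h|h] := Heps _ (avoid 1 t11) d1; [left|right]; exact: cct c01 h.
Qed.

Lemma far_unbounded (A : set (R * R)) (z : R * R) :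
  (forall M : R, exists2 z', A z' & M < `|z'.1| \/ M < `|z'.2|) -> ~ bounded_set A.
Proof.
move=> far [M [_ HM]]; have [z' Az' h] := far (M + 1).
have : `|z'| <= M + 1 by apply: (HM (M + 1)); rewrite ?ltrDl.
by rewrite prod_normE ge_max => /andP[h1 h2]; case: h; rewrite ltNge ?h1 ?h2.
Qed.

Lemma unbounded_far (A : set (R * R)) (M : R) : ~ bounded_set A ->
  exists2 z', A z' & M < `|z'.1| \/ M < `|z'.2|.
Proof.
move=> nb; apply: contrapT => no; apply: nb.
exists M; split; first exact: num_real.
move=> M' MM' z Az /=; rewrite prod_normE ge_max; apply/andP; split; apply: le_trans (ltW MM');
  rewrite leNgt; apply/negP => h; apply: no; exists z => //; by [left|right].
Qed.

(** The two densities of [density_jump] differ, so their points lie in different components. With at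
    most two components, one of them is that of the far points, of density 0, and the other has
    density 1 or -1, hence contains no far point and is bounded. *)
Lemma jordan_density (x y : R -> R) : regular_loop x y ->
  exists k M : R, [/\ `|k| = 1, 0 < M,
    forall z, bounded_region (trace x y) z <-> has_density x y z k,
    forall z, ~ trace x y z -> ~ has_density x y z k -> has_density x y z 0 &
    forall z, has_density x y z k -> `|z.1| <= M /\ `|z.2| <= M].
Proof.
move=> J; have [M M0 HM] := density_far J.
pose cc := connected_component (~` trace x y).
have far0 z : M < `|z.1| \/ M < `|z.2| -> has_density x y z 0.
  by move=> h; exists 1 => //; exact: HM.
have [p [q [q' [r [w [w' [r0 H H' ww']]]]]]] := density_jump J.
have K : has_density x y (p, q) w by exists r.
have K' : has_density x y (p, q') w' by exists r.
have [z1 [z2 sides]] := loop_two_sides J.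
pose far : R * R := (M + 1, 0).
have Mn : M < `|M + 1| by apply: lt_le_trans (ler_norm _); rewrite ltrDl.
have F0 : has_density x y far 0 by apply: far0; left.
have cden z z' v : cc z z' -> has_density x y z v -> has_density x y z' v.
  by move=> h; apply: density_component.
have ccs z z' : cc z z' -> cc z' z by exact: connected_component_sym.
have cct z z' z'' : cc z z' -> cc z' z'' -> cc z z'' by exact: connected_component_trans.
have [u split_u] : exists u, forall z, ~ trace x y z -> cc z far \/ cc z u.
  have [h|h] := sides far (has_density_off F0); [exists z2|exists z1] => z /sides[h'|h'].
  - by left; exact: cct h' (ccs _ _ h).
  - by right.
  - by right.
  - by left; exact: cct h' (ccs _ _ h).
have farE z v : cc z far -> has_density x y z v -> v = 0.
  by move=> h Hz; exact: has_density_uniq (cden _ _ _ h Hz) F0.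
have [k [Hu k1]] : exists k, has_density x y u k /\ `|k| = 1.
  have [h|h] := split_u _ (has_density_off K); have [h'|h'] := split_u _ (has_density_off K').
  - by move: ww' => /eqP; rewrite (farE _ _ h K) (farE _ _ h' K') subrr normr0 eq_sym oner_eq0.
  - exists w'; split; first exact: cden h' K'.
    by move: ww'; rewrite (farE _ _ h K) sub0r normrN.
  - exists w; split; first exact: cden h K.
    by move: ww'; rewrite (farE _ _ h' K') subr0.
  have e := has_density_uniq (cden _ _ _ h K) (cden _ _ _ h' K').
  by move: ww' => /eqP; rewrite e subrr normr0 eq_sym oner_eq0.
have k0 : k <> 0 by move=> z; move: k1 => /eqP; rewrite z normr0 eq_sym oner_eq0.
exists k, M; split => //.
- move=> z; split.
    move=> [nz bz]; have [h|h] := split_u z nz; last exact: cden (ccs _ _ h) Hu.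
    exfalso; apply: (@far_unbounded _ z) bz => M'.
    pose z' : R * R := (Num.max M M' + 1, 0).
    have big : Num.max M M' < `|z'.1| by apply: lt_le_trans (ler_norm _); rewrite ltrDl.
    have H0 : has_density x y z' 0 by apply: far0; left; apply: le_lt_trans big; rewrite le_max lexx.
    exists z'; last by left; apply: le_lt_trans big; rewrite le_max lexx orbT.
    have [h'|h'] := split_u z' (has_density_off H0).
      exact: cct h (ccs _ _ h').
    by case: k0; apply: has_density_uniq Hu (cden _ _ _ h' H0).
  move=> Hz; split; first exact: has_density_off Hz.
  apply: contrapT => /(unbounded_far M)[z' cz' h].
  by case: k0; apply: has_density_uniq (cden _ _ _ cz' Hz) (far0 _ h).
- move=> z nz nk; have [h|h] := split_u z nz; first exact: cden (ccs _ _ h) F0.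
  by case: nk; exact: cden (ccs _ _ h) Hu.
- move=> z Hz; split; rewrite leNgt; apply/negP => h; apply: k0;
    apply: has_density_uniq Hz (far0 _ _); by [left|right].
Qed.

(** * The area of the bounded region *)

(** An open set is the countable union of the rational boxes it contains. *)
Lemma open_area_measurable (A : set (R * R)) : open A ->
  measurable (A : set (measurableTypeR R * measurableTypeR R)).
Proof.
move=> oA.
pose box (q : rat * rat * (rat * rat)) : set (R * R) :=
  `]ratr q.1.1, ratr q.1.2[ `*` `]ratr q.2.1, ratr q.2.2[.
have -> : A = \bigcup_q (if pselect (box q `<=` A) then box q else set0).
  apply/seteqP; split => [z Az|z [q _]]; last by case: pselect => //= h; exact: h.
  have /nbhs_ballP[e /= e0 He] : nbhs z A by move: oA; rewrite openE; exact.
  have [a ha] := @rat_in_itvoo R (z.1 - e) z.1 ltac:(lra).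
  have [b hb] := @rat_in_itvoo R z.1 (z.1 + e) ltac:(lra).
  have [c hc] := @rat_in_itvoo R (z.2 - e) z.2 ltac:(lra).
  have [d hd] := @rat_in_itvoo R z.2 (z.2 + e) ltac:(lra).
  move: ha hb hc hd; rewrite !in_itv /= => /andP[a1 a2] /andP[b1 b2] /andP[c1 c2] /andP[d1 d2].
  exists ((a, b), (c, d)) => //; case: pselect => /= [h|no].
    by split; rewrite /= in_itv /= ?a2 ?b1 ?c2 ?d1.
  case: no => z' [k1 k2]; move: k1 k2; rewrite /= !in_itv /= => /andP[h1 h2] /andP[h3 h4].
  by apply: He; split; rewrite /ball /= ltr_norml; lra.
apply: countable_bigcupT_measurable; first exact: countableP.
by move=> q; case: pselect => /= h //; exact: measurableX.
Qed.

(** * Slices, and sums of hat functions over a grid *)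

Section Grid.
Notation mu := (@lebesgue_measure R \x @lebesgue_measure R)%E.

Lemma measure_slices (A : set (measurableTypeR R * measurableTypeR R)) (m : nat)
    (F : 'I_m -> set (measurableTypeR R * measurableTypeR R)) :
  measurable A -> (forall i, measurable (F i)) -> trivIset setT F ->
  (forall z, A z -> exists i, F i z) ->
  mu A = (\sum_(i < m) mu (A `&` F i))%E.
Proof.
move=> mA mF tF cover.
have {1}-> : A = \big[setU/set0]_(i < m) (A `&` F i).
  rewrite -bigcup_seq; apply/seteqP; split=> z; last by move=> [i _ []].
  by move=> Az; have [i Fi] := cover z Az; exists i => //=; rewrite mem_index_enum.
rewrite measure_bigsetU_ord //=; last exact: trivIset_setIl.
by move=> i; exact: measurableI.
Qed.
End Grid.

(** [hat] is a second difference of the positive part and [hat_int] one of half its square, so their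
    sums over all nodes reduce to terms at the two ends. *)
Lemma telescope2 (a : nat -> R) (m : nat) :
  \sum_(i < m) (a i - 2 * a i.+1 + a i.+2) = a 0%N - a 1%N - a m + a m.+1.
Proof.
elim: m => [|m IH]; first by rewrite big_ord0; ring.
by rewrite big_ord_recr /= IH; ring.
Qed.

Definition node (N n i : nat) : R := i%:R / n%:R - N%:R.

Section Nodes.
Context (N n : nat).
Hypothesis n0 : (0 < n)%N.
Let d : R := n%:R^-1.
Let m := (2 * N * n).+1.

Let nR0 : 0 < (n%:R : R). Proof. by rewrite ltr0n. Qed.
Let nRn : (n%:R : R) != 0. Proof. by rewrite gt_eqF. Qed.
Let d0 : 0 < d. Proof. by rewrite invr_gt0. Qed.

Let last_node (u : R) : u <= N%:R -> u + N%:R + d - m%:R * d <= 0 /\ u + N%:R + d - m.+1%:R * d <= 0.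
Proof.
move=> uN; have md : m%:R * d = 2 * N%:R + d.
  by rewrite /m -natr1 !natrM /d; field.
have : m.+1%:R * d = 2 * N%:R + d + d by rewrite -natr1 mulrDl md mul1r.
by rewrite md => ->; move: d0 => h; split; lra.
Qed.

Lemma hat_sum (u : R) : `|u| <= N%:R -> \sum_(i < m) hat d (node N n i) u = d.
Proof.
rewrite ler_norml => /andP[u1 u2].
pose a i := posp (u + N%:R + d - i%:R * d).
rewrite (eq_bigr (fun i : 'I_m => a i - 2 * a i.+1 + a i.+2)); last first.
  move=> i _; rewrite /hat /a /node -/d.
  by congr (posp _ - 2 * posp _ + posp _); rewrite -?natr1; ring.
have [l1 l2] := last_node u2; have dp := d0.
rewrite (telescope2 a) /a mul0r mul1r subr0 /posp (max_idPr l1) (max_idPr l2).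
by rewrite (max_idPl (_ : 0 <= u + N%:R + d)) ?(max_idPl (_ : 0 <= u + N%:R + d - d)); lra.
Qed.

(** Only the slope matters later: the constant integrates to 0 against dx over a closed loop. *)
Lemma hat_int_sum (u : R) : `|u| <= N%:R ->
  \sum_(i < m) hat_int d (node N n i) u = d * u + (d * N%:R + d ^+ 2 / 2).
Proof.
rewrite ler_norml => /andP[u1 u2].
pose a i := posp (u + N%:R + d - i%:R * d) ^+ 2 / 2.
rewrite (eq_bigr (fun i : 'I_m => a i - 2 * a i.+1 + a i.+2)); last first.
  move=> i _; rewrite /hat_int /a /node -/d.
  have -> : u - (i%:R * d - N%:R) + d = u + N%:R + d - i%:R * d by ring.
  have -> : u - (i%:R * d - N%:R) = u + N%:R + d - i.+1%:R * d by rewrite -natr1; ring.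
  have -> : u + N%:R + d - i.+1%:R * d - d = u + N%:R + d - i.+2%:R * d by rewrite -!natr1; ring.
  by field.
have [l1 l2] := last_node u2; have dp := d0.
rewrite (telescope2 a) /a mul0r mul1r subr0 /posp (max_idPr l1) (max_idPr l2).
have h1 : 0 <= u + N%:R + d by lra.
have h2 : 0 <= u + N%:R + d - d by lra.
by rewrite (max_idPl h1) (max_idPl h2); field.
Qed.

Lemma node_eq (i j : nat) : `|node N n i - node N n j| < d -> i = j.
Proof.
rewrite /node -/d; have -> : i%:R * d - N%:R - (j%:R * d - N%:R) = (i%:R - j%:R) * d by ring.
rewrite normrM (gtr0_norm d0) -ltr_pdivlMr // divff ?gt_eqF // ltr_norml.
case: (ltngtP i j) => // ij /andP[h1 h2]; exfalso.
  have : (i%:R + 1 : R) <= j%:R by rewrite natr1 ler_nat.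
  by lra.
have : (j%:R + 1 : R) <= i%:R by rewrite natr1 ler_nat.
by lra.
Qed.

Lemma node_cover (u : R) : `|u| <= N%:R -> exists i : 'I_m,
  node N n i - d / 2 <= u < node N n i + d / 2.
Proof.
rewrite ler_norml => /andP[u1 u2]; pose a := (u + N%:R) * n%:R + 1 / 2.
have a0 : 0 <= a by rewrite /a addr_ge0 ?mulr_ge0 //; lra.
have am : a < m%:R.
  rewrite /m -natr1 !natrM /a.
  have : (u + N%:R) * n%:R <= 2 * N%:R * n%:R by rewrite ler_wpM2r //; lra.
  by lra.
have /andP[h1 h2] := truncn_itv a0.
have im : (Num.truncn a < m)%N by rewrite -(ltr_nat R) (le_lt_trans h1).
exists (Ordinal im); rewrite /node /= -/d.
have e : u = (a - 1 / 2) * d - N%:R by rewrite /a /d; field.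
move: h2; rewrite -natr1 => h2.
have k1 := ler_wpM2r (ltW d0) h1; have k2 : a * d < (Num.truncn a)%:R * d + d.
  by rewrite -[X in _ < _ + X]mul1r -mulrDl ltr_pM2r.
by lra.
Qed.

(** As the nodes have spacing [d], each counted index exceeds the smallest counted one by at most
    [2 * K]. *)
Lemma node_count (K : nat) (u : R) :
  (\sum_(i < m) (`|u - node N n i| <= K%:R * d)%R <= (2 * K).+1)%N.
Proof.
pose P (i : 'I_m) : bool := `|u - node N n i| <= K%:R * d.
pose A := [set i : 'I_m | P i]%SET.
have -> : (\sum_(i < m) (`|u - node N n i| <= K%:R * d)%R = #|A|)%N.
  rewrite -sum1_card [RHS]big_mkcond /=; apply: eq_bigr => i _.
  by rewrite inE -/(P i); case: (P i).
have [->|[i0 Ai0]] := set_0Vmem A; first by rewrite cards0.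
have [i iA imin] := @arg_minnP _ i0 (mem A) (fun i => nat_of_ord i) Ai0.
rewrite cardE -(size_map (@nat_of_ord m)) -(size_iota i (2 * K).+1).
apply: uniq_leq_size; first by rewrite map_inj_uniq ?enum_uniq //; exact: ord_inj.
move=> l /mapP[j]; rewrite mem_enum => jA ->; rewrite mem_iota (imin j jA) /=.
move: iA jA; rewrite !inE /P !ler_norml /node -/d => iA jA.
have : (j%:R - i%:R) * d <= (2 * K)%:R * d by rewrite natrM; lra.
rewrite ler_pM2r // lerBlDr -natrD ler_nat addnS ltnS => h.
by rewrite addnC.
Qed.

End Nodes.

(** A square meeting the loop has its centre within [K.+1 * d] of one of the [n.+1] sample points at
    the parameters [l / n], in both coordinates, and each sample point accounts for a bounded number
    of squares. So the count is linear in [n], although there are of order [n ^ 2] cells. *)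
Lemma bad_count (x y : R -> R) (K N n : nat) : (0 < n)%N ->
  (forall s t, 0 <= s <= 1 -> 0 <= t <= 1 -> `|x t - x s| <= K%:R * `|t - s|) ->
  (forall s t, 0 <= s <= 1 -> 0 <= t <= 1 -> `|y t - y s| <= K%:R * `|t - s|) ->
  (\sum_(i < (2 * N * n).+1) \sum_(j < (2 * N * n).+1)
     `[< ~ off_square x y (node N n i) (node N n j) n%:R^-1 >]
   <= n.+1 * ((2 * K.+1).+1 * (2 * K.+1).+1))%N.
Proof.
move=> n0 Lx Ly; set m := (2 * N * n).+1; set d : R := n%:R^-1.
have nR0 : 0 < (n%:R : R) by rewrite ltr0n.
have d0 : 0 < d by rewrite invr_gt0.
pose p (l i : nat) := `|x (l%:R * d) - node N n i| <= K.+1%:R * d.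
pose q (l i : nat) := `|y (l%:R * d) - node N n i| <= K.+1%:R * d.
have key (i j : 'I_m) :
    (`[< ~ off_square x y (node N n i) (node N n j) d >] <= \sum_(l < n.+1) p l i * q l j)%N.
  case: asboolP => // bad.
  have [t [ht h1 h2]] : exists t, [/\ 0 <= t <= 1,
      node N n i - d <= x t <= node N n i + d & node N n j - d <= y t <= node N n j + d].
    apply: contrapT => no; apply: bad => t ht h1 h2; apply: no; by exists t.
  case/andP: (ht) => t0 t1.
  have tn0 : 0 <= t * n%:R by rewrite mulr_ge0 // ltW.
  have /andP[k1 k2] := truncn_itv tn0; set l := Num.truncn _ in k1 k2.
  have ln : (l < n.+1)%N.
    by rewrite ltnS -(ler_nat R) (le_trans k1) // ger_pMl.
  have td : t = t * n%:R * d by rewrite -mulrA divff ?mulr1 ?gt_eqF.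
  have e1 : l%:R * d <= t by rewrite [leRHS]td ler_wpM2r // ltW.
  have e2 : t < l%:R * d + d.
    by rewrite {1}td -[X in _ < _ + X]mul1r -mulrDl ltr_pM2r // natr1.
  have e3 : 0 <= l%:R * d <= 1.
    by rewrite (le_trans e1 t1) andbT mulr_ge0 ?ler0n // ltW.
  have close (f : R -> R) (c : R) :
      (forall s t, 0 <= s <= 1 -> 0 <= t <= 1 -> `|f t - f s| <= K%:R * `|t - s|) ->
      c - d <= f t <= c + d -> `|f (l%:R * d) - c| <= K.+1%:R * d.
    move=> Lf hc; have h := Lf _ _ ht e3.
    have : K%:R * `|l%:R * d - t| <= K%:R * d.
      by rewrite ler_wpM2l ?ler0n // ler_norml; lra.
    by move: h; rewrite -natr1 !ler_norml; lra.
  rewrite (bigD1 (Ordinal ln)) //= /p /q (close x) // (close y) //.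
apply: (@leq_trans (\sum_(i < m) \sum_(j < m) \sum_(l < n.+1) p l i * q l j)%N).
  by apply: leq_sum => i _; apply: leq_sum => j _; exact: key.
have -> : (\sum_(i < m) \sum_(j < m) \sum_(l < n.+1) p l i * q l j =
    \sum_(l < n.+1) (\sum_(i < m) p l i) * (\sum_(j < m) q l j))%N.
  under eq_bigr => i _ do rewrite exchange_big /=.
  rewrite exchange_big /=; apply: eq_bigr => l _.
  rewrite big_distrl /=; apply: eq_bigr => i _.
  by rewrite big_distrr.
rewrite -[X in (_ <= X * _)%N]card_ord -sum_nat_const.
apply: leq_sum => l _; apply: leq_mul; exact: node_count.
Qed.

Lemma half_open_measure (a d : R) : 0 < d ->
  @lebesgue_measure R `[a - d / 2, a + d / 2[ = d%:E.
Proof.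
move=> d0; rewrite lebesgue_measure_itv /= lte_fin.
have -> : a - d / 2 < a + d / 2 by lra.
by rewrite -EFinB; congr EFin; field.
Qed.

(** * Comparison of the integral and the area, cell by cell *)

Section GridArea.
Context (x y : R -> R) (k : R) (N K n : nat) (C : R).
Hypothesis J : regular_loop x y.
Hypothesis n0 : (0 < n)%N.
Hypothesis k1 : `|k| = 1.
Hypothesis dichotomy : forall z, ~ trace x y z -> ~ has_density x y z k -> has_density x y z 0.
Hypothesis bounded : forall z, has_density x y z k -> `|z.1| <= N%:R /\ `|z.2| <= N%:R.
Hypothesis xN : forall t, 0 <= t <= 1 -> `|x t| <= N%:R.
Hypothesis yN : forall t, 0 <= t <= 1 -> `|y t| <= N%:R.
Hypothesis Lx : forall s t, 0 <= s <= 1 -> 0 <= t <= 1 -> `|x t - x s| <= K%:R * `|t - s|.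
Hypothesis Ly : forall s t, 0 <= s <= 1 -> 0 <= t <= 1 -> `|y t - y s| <= K%:R * `|t - s|.
Hypothesis C0 : 0 <= C.
Hypothesis HC : forall phi Phi psi Psi a b c d m n,
  bump phi Phi a b m -> bump psi Psi c d n ->
  `|oint (fun t => Psi (y t) * phi (x t)) x| <= C * m * n.

Notation mu := (@lebesgue_measure R \x @lebesgue_measure R)%E.
Let m := (2 * N * n).+1.
Let d : R := n%:R^-1.
Let xi (i : nat) : R := node N n i.
Let Omega : set (measurableTypeR R * measurableTypeR R) := [set z | has_density x y z k].
Let cell (i : nat) : set (measurableTypeR R) := `[xi i - d / 2, xi i + d / 2[%classic.
Let X (i : 'I_m) : set (measurableTypeR R * measurableTypeR R) := cell i `*` setT.
Let Y (j : 'I_m) : set (measurableTypeR R * measurableTypeR R) := setT `*` cell j.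
Let I (i j : nat) := oint (fun t => hat_int d (xi j) (y t) * hat d (xi i) (x t)) x.
Let bad (i j : nat) : bool := `[< ~ off_square x y (xi i) (xi j) d >].
Let V (i j : 'I_m) : R := fine (mu (Omega `&` X i `&` Y j)).

Let d0 : 0 < d. Proof. by rewrite invr_gt0 ltr0n. Qed.

Let mcell i : measurable (cell i). Proof. exact: measurable_itv. Qed.

Let mX i : measurable (X i). Proof. exact: measurableX. Qed.

Let mY i : measurable (Y i). Proof. exact: measurableX. Qed.

Let mOmega : measurable Omega.
Proof.
apply: open_area_measurable.
have -> : Omega = [set z | exists2 w, w = k & has_density x y z w].
  by apply/seteqP; split=> z; [exists k|move=> [w ->]].
exact: open_has_density.
Qed.

Let cellE i j : X i `&` Y j = cell i `*` cell j.
Proof. by apply/seteqP; split => z [] /=; [move=> [a _] [_ b]|move=> a b]. Qed.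

Let mu_cell (i j : 'I_m) : mu (X i `&` Y j) = (d ^+ 2)%:E.
Proof.
have hc a : @lebesgue_measure R (cell a) = d%:E by exact: half_open_measure.
rewrite cellE product_measure1E //; transitivity (d%:E * d%:E)%E; last by rewrite -EFinM expr2.
by congr (_ * _)%E; exact: hc.
Qed.

Let mu_bound i j : (mu (Omega `&` X i `&` Y j) <= (d ^+ 2)%:E)%E.
Proof.
rewrite -(mu_cell i j); apply: le_measure; rewrite ?inE; try exact: measurableI.
- by apply: measurableI => //; exact: measurableI.
- by move=> z [[_ h1] h2].
Qed.

Let VE i j : mu (Omega `&` X i `&` Y j) = (V i j)%:E.
Proof.
rewrite /V fineK // ge0_fin_numE; last exact: measure_ge0.
by apply: le_lt_trans (mu_bound i j) _; rewrite ltry.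
Qed.

Let V_range i j : 0 <= V i j <= d ^+ 2.
Proof.
have := mu_bound i j; rewrite VE lee_fin => ->; rewrite andbT.
by rewrite -lee_fin -VE measure_ge0.
Qed.

Let cell_sep (i j : 'I_m) (u : R) : cell i u -> cell j u -> i = j.
Proof.
rewrite /cell /= !in_itv /= => h1 h2; apply: ord_inj; apply: (@node_eq N n n0).
by rewrite ltr_norml; rewrite -/(xi i) -/(xi j) -/d; lra.
Qed.

Let mu_Omega : mu Omega = (\sum_(i < m) \sum_(j < m) V i j)%:E.
Proof.
rewrite (@measure_slices _ m X) //.
- rewrite -sumEFin; apply: eq_bigr => i _; rewrite (@measure_slices _ m Y) //.
  + by rewrite -sumEFin; apply: eq_bigr => j _; rewrite VE.
  + exact: measurableI.
  + by move=> a b _ _ [z [[_ h1] [_ h2]]]; exact: cell_sep h1 h2.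
  + move=> z [/bounded[_ h] _]; have [j hj] := @node_cover N n n0 _ h.
    by exists j; split => //=; rewrite in_itv.
- by move=> a b _ _ [z [[h1 _] [h2 _]]]; exact: cell_sep h1 h2.
- move=> z /bounded[h _]; have [j hj] := @node_cover N n n0 _ h.
  by exists j; split => //=; rewrite in_itv.
Qed.

(** Off the loop the comparison is exact: the density is constant on the cell, which is therefore
    inside or outside as a whole. For a bad cell both terms are of order [d ^+ 4], by [oint_bound]
    and by the area of the cell. *)
Let cell_error (i j : 'I_m) :
  `|I i j - k * d ^+ 2 * V i j| <= (C + 1) * d ^+ 4 * (bad i j)%:R.
Proof.
have Bi := hat_bump (xi i) d0; have Bj := hat_bump (xi j) d0.
have d2 : 0 <= d ^+ 2 by exact: sqr_ge0.
have d4 : d ^+ 4 = d ^+ 2 * d ^+ 2 by rewrite -exprD.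
rewrite /bad; case: asboolP => [_|/contrapT off].
  have hI : `|I i j| <= C * (d ^+ 2 * d ^+ 2) by rewrite mulrA; exact: HC Bi Bj.
  have hV : `|k * d ^+ 2 * V i j| <= d ^+ 2 * d ^+ 2.
    have /andP[v0 v1] := V_range i j.
    rewrite -mulrA normrM k1 mul1r ger0_norm; first exact: ler_wpM2l.
    exact: mulr_ge0.
  rewrite mulr1 mulrDl mul1r d4; apply: (le_trans (ler_normB _ _)).
  exact: lerD.
rewrite mulr0 normr_le0 subr_eq0; apply/eqP.
have [w Hw] := density_exists J d0 off.
have -> : I i j = w * d ^+ 2 * d ^+ 2 by rewrite /I; exact: Hw.2 _ _ _ _ _ _ Bi Bj.
(* The hats live on a square of radius [d], the cell has half that size; so each point of the cell
   has a square of radius [d / 2] inside the support of the hats. *)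
have inside z : cell i z.1 -> cell j z.2 -> has_density x y z w.
  rewrite /cell /= !in_itv /= => h1 h2; exists (d / 2); first by rewrite divr_gt0.
  by apply: density_on_sub Hw; lra.
have [wk|wk] := pselect (w = k).
  have -> : V i j = d ^+ 2.
    apply: EFin_inj; rewrite -VE -(mu_cell i j); congr (mu _).
    rewrite -setIA setIidr // => z; rewrite cellE => -[h1 h2].
    by rewrite /Omega /= -wk; exact: inside.
  by rewrite wk.
have w0 : w = 0.
  have Hn : has_density x y (xi i, xi j) w by exists d.
  apply: (has_density_uniq Hn); apply: dichotomy; first exact: has_density_off Hn.
  by move=> Hk; apply: wk; exact: has_density_uniq Hn Hk.
have -> : V i j = 0.
  apply: EFin_inj; rewrite -VE.
  rewrite (_ : _ `&` _ = set0) ?measure0 // -setIA -subset0 => z [zO].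
  rewrite cellE => -[h1 h2]; apply: wk.
  exact: has_density_uniq (inside z h1 h2) zO.
by rewrite w0 !mul0r mulr0.
Qed.

Let sum_I : \sum_(i < m) \sum_(j < m) I i j = d ^+ 2 * oint y x.
Proof.
have [ix iy] := regular_loop_ointable J; have [_ Jx Jy _] := J.
have lh (i : nat) : lip (fun t => hat d (xi i) (x t)) 0 1 := bump_comp_lip (hat_bump (xi i) d0) ix.1.
have lhi (j : nat) : lip (fun t => hat_int d (xi j) (y t)) 0 1 := bump_comp_lip2 (hat_bump (xi j) d0) iy.1.
have l2 i j := lipM (lhi j) (lh i).
have -> : \sum_(i < m) \sum_(j < m) I i j =
    oint (fun t => \sum_(i < m) \sum_(j < m) hat_int d (xi j) (y t) * hat d (xi i) (x t)) x.
  rewrite (@oint_sum _ _ (fun (i : 'I_m) t => \sum_(j < m) hat_int d (xi j) (y t) * hat d (xi i) (x t))) //.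
    by apply: eq_bigr => i _;
      rewrite (@oint_sum _ _ (fun (j : 'I_m) t => hat_int d (xi j) (y t) * hat d (xi i) (x t))).
  by move=> i; apply: lip_sum.
pose c := d * N%:R + d ^+ 2 / 2.
have ly2 : lip (fun t => d ^+ 2 * y t) 0 1 by apply: lipM; [exact: lip_cst|exact: iy.1].
rewrite (@oint_ext _ (fun t => d ^+ 2 * y t + d * c)) //.
- rewrite ointD //; last exact: lip_cst.
  by rewrite ointZ ?oint_cst ?Jx ?subrr ?mulr0 ?addr0 //; exact: iy.1.
- by apply: lip_sum => i; apply: lip_sum.
move=> t ht; under eq_bigr => i _ do rewrite -big_distrl /=.
rewrite -big_distrr /= (hat_int_sum n0 (yN ht)) (hat_sum n0 (xN ht)).
by rewrite -/d /c; ring.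
Qed.

(** The bad cells contribute O(n) errors of order [d ^+ 4]; division by the factor [d ^+ 2] of
    [sum_I] leaves O(1 / n). The factor 2 comes from [n.+1 <= 2 * n]. *)
Lemma grid_area : exists A, mu Omega = A%:E /\
  `|oint y x - k * A| <= 2 * (C + 1) * ((2 * K.+1).+1 ^ 2)%:R / n%:R.
Proof.
exists (\sum_(i < m) \sum_(j < m) V i j); split; first exact: mu_Omega.
set A := \sum_(i < m) _.
have d2 : 0 < d ^+ 2 by rewrite exprn_gt0.
have nR : 0 < (n%:R : R) by rewrite ltr0n.
have e : d ^+ 2 * (oint y x - k * A) =
    \sum_(i < m) \sum_(j < m) (I i j - k * d ^+ 2 * V i j).
  under eq_bigr => i _ do rewrite sumrB.
  rewrite sumrB sum_I /A; rewrite mulrBr; congr (_ - _).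
  rewrite mulrA [d ^+ 2 * k]mulrC big_distrr /=; apply: eq_bigr => i _.
  by rewrite big_distrr.
have b1 : `|d ^+ 2 * (oint y x - k * A)| <=
    (C + 1) * d ^+ 4 * (\sum_(i < m) \sum_(j < m) bad i j)%N%:R.
  rewrite e natr_sum big_distrr /= (le_trans (ler_norm_sum _ _ _)) //.
  apply: ler_sum => i _; rewrite natr_sum big_distrr /= (le_trans (ler_norm_sum _ _ _)) //.
  by apply: ler_sum => j _; exact: cell_error.
have cnt : ((\sum_(i < m) \sum_(j < m) bad i j)%N%:R : R) <=
    2 * n%:R * ((2 * K.+1).+1 ^ 2)%:R.
  rewrite -!natrM ler_nat (leq_trans (bad_count N n0 Lx Ly)) //.
  by rewrite -mulnn leq_mul2r; apply/orP; right; rewrite mul2n -addnn -addn1 leq_add2l.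
have C1 : 0 <= (C + 1) * d ^+ 4 by rewrite mulr_ge0 ?addr_ge0 // exprn_even_ge0.
have := le_trans b1 (ler_wpM2l C1 cnt).
rewrite normrM (gtr0_norm d2) -[leRHS](_ : d ^+ 2 * (2 * (C + 1) * ((2 * K.+1).+1 ^ 2)%:R / n%:R) = _).
  by rewrite ler_pM2l.
have nn : (n%:R : R) != 0 by rewrite gt_eqF.
by rewrite /d; field.
Qed.

End GridArea.

Lemma loop_area (x y F : R -> R) : regular_loop x y ->
  area_prim x y F 0 1 ->
  area (bounded_region (trace x y)) = (`|F 1 - F 0| / 2)%:E.
Proof.
move=> J HF; have [ix iy] := regular_loop_ointable J; have [_ Jx Jy _] := J.
have [k [M [k1 M0 Ob nOb bnd]]] := jordan_density J.
have E : bounded_region (trace x y) = [set z | has_density x y z k].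
  by apply/seteqP; split=> z /Ob.
(* On a closed loop the integrals of x dy and of y dx are opposite. *)
have FY : F 1 - F 0 = - (2 * oint y x).
  have [K HK] := ix.2 _ iy.1; have [K' HK'] := iy.2 _ ix.1.
  have -> := area_prim_uniq ltr01 HF (area_primB HK' HK).
  have := prim_by_parts ler01 iy.1 ix.1 HK HK'; rewrite Jx Jy (oint_prim HK); lra.
have [C C0 HC] := oint_bound J.
have [A A0 HA] := lip_bounded ix.1; have [B B0 HB] := lip_bounded iy.1.
case: (ix.1) => [L L0 HL]; case: (iy.1) => [L' L0' HL'].
pose N := (Num.truncn (A + B + M)).+1; pose K := (Num.truncn (L + L')).+1.
have NN : A + B + M < N%:R by exact: truncnS_gt.
have KK : L + L' < K%:R by exact: truncnS_gt.
have est n : (0 < n)%N -> exists V, (@lebesgue_measure R \x @lebesgue_measure R)%E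
     [set z | has_density x y z k] = V%:E /\
  `|oint y x - k * V| <= 2 * (C + 1) * ((2 * K.+1).+1 ^ 2)%:R / n%:R.
  move=> n0; apply: (@grid_area x y k N K n C) => //.
  - by move=> z /bnd[h1 h2]; split; lra.
  - by move=> t /HA; lra.
  - by move=> t /HB; lra.
  - by move=> s t hs ht; apply: (le_trans (HL s t hs ht)); rewrite ler_wpM2r //; lra.
  - by move=> s t hs ht; apply: (le_trans (HL' s t hs ht)); rewrite ler_wpM2r //; lra.
have [V [VE _]] := est 1%N isT.
have V0 : 0 <= V by rewrite -lee_fin -VE; exact: measure_ge0.
rewrite E /area VE FY normrN normrM ger0_norm // mulrAC divff // mul1r; congr EFin.
pose D := 2 * (C + 1) * ((2 * K.+1).+1 ^ 2)%:R : R.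
have Yk : oint y x = k * V.
  (* The area does not depend on [n], while the error bound [D / n] tends to 0. *)
  apply/eqP; rewrite -subr_eq0 -normr_le0 leNgt; apply/negP => pos.
  pose n := (Num.truncn (D / `|oint y x - k * V|)).+1.
  have nD : D / `|oint y x - k * V| < n%:R by exact: truncnS_gt.
  have [V' [VE' h]] := est n isT.
  have e : V' = V by apply: EFin_inj; rewrite -VE -VE'.
  move: h; rewrite e -/D leNgt ltr_pdivrMr ?ltr0n // mulrC -ltr_pdivrMr //.
  by rewrite nD.
by rewrite Yk normrM k1 mul1r ger0_norm.
Qed.

End ShapeArea.

Theorem theorem1p3 (R : realType) (P : set (R * R)) (alpha : R -> quad R)
    (hP : piecewise_smooth_jordan_loop P)
    (halpha : piecewise_C1_path alpha) :
  [/\ hyperbolic_arc P alpha ->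
        `|signed_area (hyperbolic_shape_loop alpha)|%:E =
          area (bounded_region P),
      null_arc P alpha -> signed_area (null_shape_loop alpha) = 0 &
      closed_loop P alpha -> signed_area (shape_curve alpha) = 0].
Proof.
have [c [cP cpw]] := hP.
have J := jordan_regular_loop cP cpw.
have C1c : locally_on (C1_curve c) 0 1.
  by apply: locally_on_impl (loop_regular J) => u v _ _ _ [dx [dy []]]; exists dx, dy.
have [F HF] := area_prim_exists ltr01 C1c.
apply: (area_by_loop cP cpw HF halpha).
rewrite -(loop_area J HF); congr (area (bounded_region _)).
have [_ _ _ ->] := cP; apply/seteqP; split=> z /=.
  by move=> [t]; rewrite in_itv /= => ht <-; exists t => //; exact: surjective_pairing.
by move=> [t ht ->]; exists t; [rewrite in_itv|exact: surjective_pairing].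
Qed.
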